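(* Let $f\colon\mathbb{D}\to\mathbb{D}$ be a hyperbolic map with Denjoy--Wolff point $\tau\in\partial\mathbb{D}$, and let $\gamma\colon[0,+\infty)\to\mathbb{D}$ be a curve landing at $\tau$ and satisfying $$\lim_{t\to+\infty}\arg(1-\overline{\tau}\gamma(t))=\theta\in\left(-\tfrac{\pi}{2},\tfrac{\pi}{2}\right).$$ Fix $z\in\mathbb{D}$ and, for each $n\in\mathbb{N}$, let $\pi_\gamma(f^n(z))$ be a (i.e. any choice of) projection of $f^n(z)$ onto $\gamma$. Then, for any $w\in\mathbb{D}$, the sequence $\{d_{\mathbb{D}}(w,\pi_\gamma(f^n(z)))\}$ is eventually strictly increasing.
   Context: $\mathbb{D}$ is the open unit disc of $\mathbb{C}$. Its hyperbolic metric is $d_{\mathbb{D}}(z,w)=\inf_{\sigma}\int_{\sigma}\frac{|d\zeta|}{1-|\zeta|^2}$, the infimum being over all piecewise $C^1$-smooth curves $\sigma$ in $\mathbb{D}$ joining $z$ to $w$. $f^n$ denotes the $n$-th iterate $f\circ\cdots\circ f$ ($n$ times). If $f\colon\mathbb{D}\to\mathbb{D}$ is holomorphic without fixed points in $\mathbb{D}$, the Denjoy--Wolff Theorem gives a unique point $\tau\in\partial\mathbb{D}$, the Denjoy--Wolff point of $f$, such that $f^n$ converges to the constant $\tau$ uniformly on compact subsets of $\mathbb{D}$; moreover the angular derivative $f'(\tau)$ (the non-tangential limit of $\frac{f(z)-\tau}{z-\tau}$ as $z\to\tau$) exists and lies in $(0,1]$. The map $f$ is called hyperbolic if it is holomorphic,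 has no fixed points in $\mathbb{D}$, and $f'(\tau)<1$. A curve is a continuous map $\gamma\colon[0,+\infty)\to\mathbb{D}$; it lands at $\zeta\in\partial\mathbb{D}$ if $\gamma(t)\to\zeta$ as $t\to+\infty$ in the Euclidean metric. Given $z_0\in\mathbb{D}$, a point $\pi_\gamma(z_0)\in\mathbb{D}$ is a projection of $z_0$ onto $\gamma$ if $\pi_\gamma(z_0)=\gamma(t_0)$ for some $t_0\ge0$ and $d_{\mathbb{D}}(z_0,\gamma(t_0))=\inf\{d_{\mathbb{D}}(z_0,\gamma(t)):t\in[0,+\infty)\}$. Projections onto a curve landing at a boundary point always exist but need not be unique. $\arg$ is the principal argument. A sequence is eventually strictly increasing if there is an index from which on it is strictly increasing. *)

(* Defs.v *)
From Stdlib Require Import Reals List Lra.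
From Coquelicot Require Import Coquelicot.
Open Scope R_scope.

Definition unit_disc (z : C) : Prop := Cmod z < 1.

(** * Hyperbolic metric *)

Definition C1_arc (sigma : R -> C) (a b : R) : Prop :=
  a < b /\
  continuous_on (T := R_UniformSpace) (U := C_UniformSpace)
    (fun t => a <= t <= b) sigma /\
  exists dsigma : R -> C,
    continuous_on (T := R_UniformSpace) (U := C_UniformSpace)
      (fun t => a <= t <= b) dsigma /\
    forall t, a < t < b ->
      @is_derive R_AbsRing C_R_NormedModule sigma t (dsigma t).

Inductive piecewise_C1 (sigma : R -> C) : R -> R -> Prop :=
| piecewise_C1_arc a b :
    C1_arc sigma a b -> piecewise_C1 sigma a b
| piecewise_C1_cat a b c :
    C1_arc sigma a b -> piecewise_C1 sigma b c -> piecewise_C1 sigma a c.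

(** At the finitely many break points of a piecewise C1 curve [Derive] returns
    an unspecified value, which does not affect the integral below. *)
Definition velocity (sigma : R -> C) (t : R) : C :=
  (Derive (fun s => Re (sigma s)) t, Derive (fun s => Im (sigma s)) t).

Definition hyp_length_of_curve (z w : C) (l : R) : Prop :=
  exists (sigma : R -> C) (a b : R),
    piecewise_C1 sigma a b /\
    (forall t, a <= t <= b -> unit_disc (sigma t)) /\
    sigma a = z /\ sigma b = w /\
    is_RInt (V := R_NormedModule)
      (fun t => Cmod (velocity sigma t) / (1 - Cmod (sigma t) ^ 2)) a b l.

(** For [z] and [w] in the disc the set of lengths is nonempty and bounded
    below by 0, so that [Glb_Rbar] is finite and [real] loses nothing. *)
Definition hyp_dist (z w : C) : R := real (Glb_Rbar (hyp_length_of_curve z w)).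

(** * Holomorphic self-maps of the disc *)

(** Maps of the disc are total functions on [C], of which only the values on
    the disc matter. *)
Definition holomorphic_self_map (f : C -> C) : Prop :=
  (forall z, unit_disc z -> unit_disc (f z)) /\
  (forall z, unit_disc z -> @ex_derive C_AbsRing C_NormedModule f z).

Definition compact_set (K : C -> Prop) : Prop :=
  forall F : (C -> Prop) -> Prop,
    (forall U, F U -> @open C_UniformSpace U) ->
    (forall z, K z -> exists U, F U /\ U z) ->
    exists l : list (C -> Prop),
      List.Forall F l /\ forall z, K z -> List.Exists (fun U => U z) l.

Definition Denjoy_Wolff_point (f : C -> C) (tau : C) : Prop :=
  Cmod tau = 1 /\
  forall K : C -> Prop,
    compact_set K -> (forall z, K z -> unit_disc z) ->
    forall eps : R, 0 < eps ->
      exists N : nat, forall n : nat, (N <= n)%nat ->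
        forall z, K z -> Cmod (Nat.iter n f z - tau)%C < eps.

(** Non-tangential approach regions; they are contained in the disc. *)
Definition Stolz_region (tau : C) (M : R) (z : C) : Prop :=
  Cmod (z - tau)%C < M * (1 - Cmod z).

Definition nontangential_limit (g : C -> C) (tau l : C) : Prop :=
  forall M : R, 1 < M ->
    filterlim g
      (within (Stolz_region tau M) (@locally C_UniformSpace tau))
      (@locally C_UniformSpace l).

(** [f] is understood to have the boundary value [tau] at [tau]. *)
Definition angular_derivative (f : C -> C) (tau l : C) : Prop :=
  nontangential_limit (fun z => ((f z - tau) / (z - tau))%C) tau l.

Definition hyperbolic_map (f : C -> C) : Prop :=
  holomorphic_self_map f /\
  (forall z, unit_disc z -> f z <> z) /\
  exists (tau : C) (alpha : R),
    Denjoy_Wolff_point f tau /\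
    angular_derivative f tau (RtoC alpha) /\
    alpha < 1.

(** * Curves and projections *)

Definition disc_curve (gamma : R -> C) : Prop :=
  (forall t, 0 <= t -> unit_disc (gamma t)) /\
  continuous_on (T := R_UniformSpace) (U := C_UniformSpace)
    (fun t => 0 <= t) gamma.

Definition lands_at (gamma : R -> C) (zeta : C) : Prop :=
  filterlim gamma (Rbar_locally p_infty) (@locally C_UniformSpace zeta).

Definition is_projection (gamma : R -> C) (z0 p : C) : Prop :=
  exists t0 : R,
    0 <= t0 /\ p = gamma t0 /\
    is_glb_Rbar (fun r => exists t, 0 <= t /\ r = hyp_dist z0 (gamma t))
      (Finite (hyp_dist z0 (gamma t0))).

(** * Principal argument *)

(** With values in (-PI, PI]; see [Arg_spec]. *)
Definition Arg (z : C) : R :=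
  if Rle_dec 0 (Im z) then acos (Re z / Cmod z) else - acos (Re z / Cmod z).

Lemma Arg_spec (z : C) : z <> RtoC 0 ->
  - PI < Arg z <= PI /\
  Re z = Cmod z * cos (Arg z) /\ Im z = Cmod z * sin (Arg z).
Proof.
intros Hz.
assert (Hm : 0 < Cmod z) by now apply Cmod_gt_0.
assert (H2 : Re z * Re z + Im z * Im z = Cmod z * Cmod z).
{ unfold Cmod. rewrite sqrt_sqrt; [simpl; unfold Re, Im; ring|].
  simpl. pose proof (Rle_0_sqr (fst z)). pose proof (Rle_0_sqr (snd z)).
  unfold Rsqr in *. lra. }
set (x := Re z / Cmod z). set (y := Im z / Cmod z).
assert (Hx : Re z = Cmod z * x) by (unfold x; field; lra).
assert (Hy : Im z = Cmod z * y) by (unfold y; field; lra).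
assert (Hxy : x * x + y * y = 1).
{ apply Rmult_eq_reg_l with (Cmod z * Cmod z); [|nra].
  rewrite Hx, Hy in H2. lra. }
assert (Hx1 : -1 <= x <= 1) by (split; nra).
pose proof (acos_bound x) as Hb.
pose proof (cos_acos x Hx1) as Hc.
pose proof (sin_acos x Hx1) as Hs.
assert (Hyy : 1 - Rsqr x = Rsqr y) by (unfold Rsqr; lra).
rewrite Hyy, sqrt_Rsqr_abs in Hs.
unfold Arg. fold x. destruct (Rle_dec 0 (Im z)) as [Hi|Hi].
- assert (0 <= y) by (rewrite Hy in Hi; nra).
  rewrite Rabs_pos_eq in Hs by assumption.
  rewrite Hc, Hs. pose proof PI_RGT_0. repeat split; try assumption; lra.
- assert (Hy0 : y < 0) by (apply Rnot_le_lt in Hi; rewrite Hy in Hi; nra).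
  rewrite Rabs_left in Hs by assumption.
  rewrite cos_neg, sin_neg, Hc, Hs.
  assert (acos x <> PI).
  { intros E. rewrite E, sin_PI in Hs. lra. }
  repeat split; try assumption; lra.
Qed.

Definition eventually_strictly_increasing (u : nat -> R) : Prop :=
  exists N : nat, forall m n : nat, (N <= m)%nat -> (m < n)%nat -> u m < u n.

(* Main.v *)
Require Import Defs.
From Stdlib Require Import Reals Lra Lia Psatz.
From Coquelicot Require Import Coquelicot.
Open Scope R_scope.

(** The Cayley transform sending [tau] to infinity turns the disc into the right
    half-plane, where the whole question becomes one about moduli.  Write [Z n]
    for the image of the [n]-th iterate of [z], [Gamma] for the image of
    [gamma], and [P n] for the image of [p n].  The hypothesis on the argument
    says that [Gamma t / |Gamma t|] tends to a point [e] of the unit circle with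
    positive real part.

    Orbit.  The angular derivative [alpha < 1] acts as an expansion at infinity.
    Julia's lemma gives [Re (Z n) <= alpha * Re (Z (n+1))], and by the
    Schwarz-Pick lemma the hyperbolic length of the steps is bounded, so that
    [|Im (Z (n+1)) - Im (Z n)|] is at most a constant times [Re (Z n)].  Summing
    a geometric series, the orbit stays in a sector.  It therefore approaches
    [tau] within a Stolz region, where the angular derivative may be evaluated:
    [|Z n| / |Z (n+1)|] tends to [alpha] ([orbit_ratio]).

    Projection.  In polar form, [cosh^2] of the distance between [Z] and [W] is
    [(s + 1/s + 2 Re (a g)) / (4 Re a Re g)], where [s = |W| / |Z|] and [a], [g]
    are the directions of [Z] and [W].  For fixed directions it is least at
    [s = 1].  Comparing [P n] with a point of the curve that has the same modulus
    as [Z n] ([nearest_modulus_ratio]) and using that all far points of the curve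
    have nearly the same direction, one gets [|P n| / |Z n| -> 1]; the direction
    of [Z n] cancels in this estimate ([projection_ratio]).

    Conclusion.  Thus [|P n| / |P (n+1)|] tends to [alpha < 1], and since [cosh^2]
    of the distance from a fixed [W] to [P n] is asymptotic to a constant times
    [|P n|], it increases eventually ([half_plane_cosh2_increasing]).

    Two classical facts carry this.  The Schwarz-Pick lemma is obtained for maps
    that are merely complex differentiable: Goursat's theorem on rectangles, in
    logarithmic coordinates, says that circular means about [0] are constant, and
    this bounds the value at the centre by the values on a circle.  Applied to
    [g * (g / B)^n], with [B] a Moebius factor vanishing at a zero of [g], it
    yields Schwarz's lemma without any theorem on removable singularities.  The
    closed form of the distance ([hyp_dist_eq]) is bounded from above by an
    explicit geodesic and from below by Busemann functions, which are smooth on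
    the disc and whose gradient has hyperbolic norm one. *)

(** * Limits and continuity of complex functions *)

Notation ccontinuous := (@continuous C_UniformSpace C_UniformSpace).

Lemma Cmod_le_Rabs (z : C) : Cmod z <= Rabs (Re z) + Rabs (Im z).
Proof.
pose proof (Cmod2_alt z). pose proof (Cmod_ge_0 z).
pose proof (Rabs_pos (Re z)). pose proof (Rabs_pos (Im z)).
rewrite <- (pow2_abs (Re z)), <- (pow2_abs (Im z)) in H. nra.
Qed.

Lemma Re_le_Cmod (z : C) : Re z <= Cmod z.
Proof. eapply Rle_trans; [apply Rle_abs|apply re_le_Cmod]. Qed.

(** The product topology on [C] comes with square neighbourhoods; this and the
    next two lemmas exchange them for discs and for coordinates. *)
Lemma locally_Cmod (z : C) (P : C -> Prop) :
  @locally C_UniformSpace z P <->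
  exists d, 0 < d /\ forall w, Cmod (w - z)%C < d -> P w.
Proof.
split.
- intros [d Hd]. exists d. split; [apply cond_pos|].
  intros w Hw. apply Hd. apply C_NormedModule_mixin_compat1. exact Hw.
- intros (d & Hd & H).
  assert (Hp : 0 < d / 2) by lra.
  exists (mkposreal _ Hp). intros w Hw. apply H.
  destruct Hw as [H1 H2].
  change (Rabs (fst w - fst z) < d / 2) in H1.
  change (Rabs (snd w - snd z) < d / 2) in H2.
  eapply Rle_lt_trans; [apply Cmod_2Rmax|].
  assert (Hm : Rmax (Rabs (fst (w - z)%C)) (Rabs (snd (w - z)%C)) < d / 2).
  { simpl. unfold Rminus in *. now apply Rmax_lub_lt. }
  assert (sqrt 2 < 2).
  { rewrite <- (sqrt_square 2) at 2 by lra. apply sqrt_lt_1; lra. }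
  pose proof (Rmax_l (Rabs (fst (w - z)%C)) (Rabs (snd (w - z)%C))).
  pose proof (Rabs_pos (fst (w - z)%C)).
  pose proof (sqrt_pos 2). nra.
Qed.

Lemma filterlim_Cmod {T : Type} (F : (T -> Prop) -> Prop) {FF : Filter F}
  (f : T -> C) (l : C) :
  filterlim f F (@locally C_UniformSpace l) <->
  forall e, 0 < e -> F (fun t => Cmod (f t - l)%C < e).
Proof.
split.
- intros H e He. apply (H (fun w => Cmod (w - l)%C < e)). apply locally_Cmod. exists e. split; auto.
- intros H P HP. apply locally_Cmod in HP. destruct HP as (d & Hd & HP).
  unfold filtermap. generalize (H d Hd). apply filter_imp. intros t; apply HP.
Qed.

Lemma filterlim_C_components {T : Type} (F : (T -> Prop) -> Prop) {FF : Filter F}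
  (f : T -> C) (l : C) :
  filterlim f F (@locally C_UniformSpace l) <->
  filterlim (fun t => Re (f t)) F (locally (Re l)) /\
  filterlim (fun t => Im (f t)) F (locally (Im l)).
Proof.
split.
- intros H. split.
  + apply filterlim_comp with (1 := H). intros P [d Hd].
    exists d. intros w [H1 _]. now apply Hd.
  + apply filterlim_comp with (1 := H). intros P [d Hd].
    exists d. intros w [_ H1]. now apply Hd.
- intros [H1 H2] P [d Hd]. unfold filtermap.
  specialize (H1 (ball (Re l) d) (locally_ball _ d)).
  specialize (H2 (ball (Im l) d) (locally_ball _ d)).
  unfold filtermap in *.
  generalize (filter_and _ _ H1 H2). apply filter_imp.
  intros t [A B]. apply Hd. split; assumption.
Qed.

Section ComplexLimits.
Context {T : Type} (F : (T -> Prop) -> Prop) {FF : Filter F}.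

Lemma Rlim_plus (f g : T -> R) (a b : R) :
  filterlim f F (locally a) -> filterlim g F (locally b) ->
  filterlim (fun t => f t + g t) F (locally (a + b)).
Proof.
intros Hf Hg. eapply filterlim_comp_2; [exact Hf|exact Hg|].
exact (@filterlim_plus R_AbsRing R_NormedModule a b).
Qed.

Lemma Rlim_opp (f : T -> R) (a : R) :
  filterlim f F (locally a) -> filterlim (fun t => - f t) F (locally (- a)).
Proof.
intros Hf. eapply filterlim_comp; [exact Hf|].
exact (@filterlim_opp R_AbsRing R_NormedModule a).
Qed.

Lemma Rlim_mult (f g : T -> R) (a b : R) :
  filterlim f F (locally a) -> filterlim g F (locally b) ->
  filterlim (fun t => f t * g t) F (locally (a * b)).
Proof.
intros Hf Hg. eapply filterlim_comp_2; [exact Hf|exact Hg|].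
exact (@filterlim_mult R_AbsRing a b).
Qed.

Lemma Rlim_const (a : R) : filterlim (fun _ : T => a) F (locally a).
Proof. apply filterlim_const. Qed.

Lemma Rlim_continuous (f : T -> R) (h : R -> R) (a : R) :
  filterlim f F (locally a) -> continuity_pt h a ->
  filterlim (fun t => h (f t)) F (locally (h a)).
Proof.
intros Hf Hh. eapply filterlim_comp; [exact Hf|].
now apply continuity_pt_filterlim.
Qed.

Lemma Rlim_minus (f g : T -> R) (a b : R) :
  filterlim f F (locally a) -> filterlim g F (locally b) ->
  filterlim (fun t => f t - g t) F (locally (a - b)).
Proof. intros Hf Hg. apply Rlim_plus; [exact Hf|now apply Rlim_opp]. Qed.

Lemma Rlim_sqr (f : T -> R) (a : R) :
  filterlim f F (locally a) -> filterlim (fun t => f t ^ 2) F (locally (a ^ 2)).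
Proof.
intros Hf. apply (Rlim_continuous f (fun x => x ^ 2)); [exact Hf|].
apply derivable_continuous_pt, derivable_pt_pow.
Qed.

Lemma Rlim_inv (f : T -> R) (a : R) :
  filterlim f F (locally a) -> a <> 0 ->
  filterlim (fun t => / f t) F (locally (/ a)).
Proof.
intros Hf Ha. eapply filterlim_comp; [exact Hf|].
apply continuity_pt_filterlim. apply (continuity_pt_inv (fun x => x)); [|exact Ha].
apply continuity_pt_id.
Qed.

Lemma Clim_plus (f g : T -> C) (a b : C) :
  filterlim f F (@locally C_UniformSpace a) ->
  filterlim g F (@locally C_UniformSpace b) ->
  filterlim (fun t => f t + g t)%C F (@locally C_UniformSpace (a + b)%C).
Proof.
rewrite !filterlim_C_components by assumption.
intros [A B] [A' B']. split; simpl; now apply Rlim_plus.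
Qed.

Lemma Clim_opp (f : T -> C) (a : C) :
  filterlim f F (@locally C_UniformSpace a) ->
  filterlim (fun t => - f t)%C F (@locally C_UniformSpace (- a)%C).
Proof.
rewrite !filterlim_C_components by assumption.
intros [A B]. split; simpl; now apply Rlim_opp.
Qed.

Lemma Clim_minus (f g : T -> C) (a b : C) :
  filterlim f F (@locally C_UniformSpace a) ->
  filterlim g F (@locally C_UniformSpace b) ->
  filterlim (fun t => f t - g t)%C F (@locally C_UniformSpace (a - b)%C).
Proof. intros Hf Hg. apply Clim_plus; [exact Hf|now apply Clim_opp]. Qed.

Lemma Clim_mult (f g : T -> C) (a b : C) :
  filterlim f F (@locally C_UniformSpace a) ->
  filterlim g F (@locally C_UniformSpace b) ->
  filterlim (fun t => f t * g t)%C F (@locally C_UniformSpace (a * b)%C).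
Proof.
rewrite !filterlim_C_components by assumption.
intros [A B] [A' B']. split; simpl;
  apply Rlim_plus; try apply Rlim_opp; now apply Rlim_mult.
Qed.

Lemma Clim_const (a : C) : filterlim (fun _ : T => a) F (@locally C_UniformSpace a).
Proof. apply filterlim_const. Qed.

Lemma Clim_inv (f : T -> C) (a : C) :
  filterlim f F (@locally C_UniformSpace a) -> a <> 0%C ->
  filterlim (fun t => / f t)%C F (@locally C_UniformSpace (/ a)%C).
Proof.
intros H Ha. rewrite filterlim_C_components in H by assumption.
destruct H as [A B].
assert (Hn : Re a ^ 2 + Im a ^ 2 <> 0).
{ rewrite <- Cmod2_alt. apply pow_nonzero. intros E. now apply Ha, Cmod_eq_0. }
assert (Hs : filterlim (fun t => Re (f t) ^ 2 + Im (f t) ^ 2) F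
               (locally (Re a ^ 2 + Im a ^ 2))).
{ apply Rlim_plus; now apply Rlim_sqr. }
rewrite filterlim_C_components by assumption.
split; simpl; unfold Rdiv; apply Rlim_mult; try apply Rlim_opp; try assumption;
  now apply (Rlim_inv (fun t => Re (f t) ^ 2 + Im (f t) ^ 2)).
Qed.

Lemma Clim_div (f g : T -> C) (a b : C) :
  filterlim f F (@locally C_UniformSpace a) ->
  filterlim g F (@locally C_UniformSpace b) -> b <> 0%C ->
  filterlim (fun t => f t / g t)%C F (@locally C_UniformSpace (a / b)%C).
Proof. intros. apply Clim_mult; [assumption|now apply Clim_inv]. Qed.

Lemma Clim_pow (f : T -> C) (a : C) (n : nat) :
  filterlim f F (@locally C_UniformSpace a) ->
  filterlim (fun t => f t ^ n)%C F (@locally C_UniformSpace (a ^ n)%C).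
Proof.
intros H. induction n as [|n IH]; simpl; [apply Clim_const|now apply Clim_mult].
Qed.

Lemma Clim_Cmod (f : T -> C) (a : C) :
  filterlim f F (@locally C_UniformSpace a) ->
  filterlim (fun t => Cmod (f t)) F (locally (Cmod a)).
Proof.
rewrite filterlim_C_components by assumption. intros [A B].
unfold Cmod. apply (Rlim_continuous _ sqrt); [|apply continuity_pt_sqrt].
- apply Rlim_plus; now apply Rlim_sqr.
- pose proof (pow2_ge_0 (fst a)). pose proof (pow2_ge_0 (snd a)). lra.
Qed.

End ComplexLimits.

Lemma lim_inv_infty {T : Type} (F : (T -> Prop) -> Prop) {FF : Filter F} (u : T -> R) :
  filterlim u F (Rbar_locally p_infty) -> filterlim (fun t => / u t) F (locally 0).
Proof.
intros H. apply (filterlim_comp _ _ _ u Rinv F (Rbar_locally p_infty) (Rbar_locally 0) H).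
apply (filterlim_Rbar_inv p_infty). discriminate.
Qed.

Lemma Clim_0_of_Cmod {T : Type} (F : (T -> Prop) -> Prop) {FF : Filter F} (u : T -> C) :
  filterlim (fun t => Cmod (u t)) F (locally 0) ->
  filterlim u F (@locally C_UniformSpace (RtoC 0)).
Proof.
intros H. apply filterlim_Cmod; [exact FF|]. intros e He.
specialize (H (ball 0 (mkposreal e He)) (locally_ball _ _)).
unfold filtermap in H. revert H. apply filter_imp. intros t Ht.
change (Rabs (Cmod (u t) - 0) < e) in Ht.
rewrite Rminus_0_r, Rabs_pos_eq in Ht by apply Cmod_ge_0.
now replace (u t - 0)%C with (u t) by ring.
Qed.

Lemma Clim_inv_infty {T : Type} (F : (T -> Prop) -> Prop) {FF : Filter F} (u : T -> C) :
  (forall t, u t <> 0%C) ->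
  filterlim (fun t => Cmod (u t)) F (Rbar_locally p_infty) ->
  filterlim (fun t => / u t)%C F (@locally C_UniformSpace (RtoC 0)).
Proof.
intros Hn H. apply Clim_0_of_Cmod; [exact FF|].
apply (filterlim_ext (fun t => / Cmod (u t))).
- intros t. symmetry. now apply Cmod_inv.
- now apply lim_inv_infty.
Qed.

Lemma lim_infty_le (u v : nat -> R) : (forall n, u n <= v n) ->
  filterlim u eventually (Rbar_locally p_infty) ->
  filterlim v eventually (Rbar_locally p_infty).
Proof.
intros H Hu. apply (is_lim_seq_le_p_loc u v); [|exact Hu].
apply filter_forall. exact H.
Qed.

Lemma lim_infty_gt {T : Type} (F : (T -> Prop) -> Prop) {FF : Filter F} (u : T -> R) (M : R) :
  filterlim u F (Rbar_locally p_infty) -> F (fun t => M < u t).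
Proof. intros H. apply (H (fun y => M < y)). now exists M. Qed.

Lemma lim_shift (u : nat -> R) (F : (R -> Prop) -> Prop) :
  filterlim u eventually F -> filterlim (fun n => u (S n)) eventually F.
Proof.
intros H. apply (filterlim_comp _ _ _ S u eventually eventually); [|exact H].
apply eventually_subseq. intros n. lia.
Qed.

Lemma continuous_C_id (z : C) : ccontinuous (fun w => w) z.
Proof. apply continuous_id. Qed.

Lemma ccontinuous_eps (f : C -> C) (z : C) : ccontinuous f z ->
  forall e, 0 < e -> exists d, 0 < d /\
  forall w, Cmod (w - z)%C < d -> Cmod (f w - f z)%C < e.
Proof.
intros H e He. apply locally_Cmod. exact (proj1 (filterlim_Cmod _ _ _) H e He).
Qed.

(** * Complex differentiability *)

(** Caratheodory's form of the derivative: it makes the closure properties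
    below consequences of the algebra of limits. *)
Definition cdiff (f : C -> C) (z : C) : Prop :=
  exists phi : C -> C, ccontinuous phi z /\
    @locally C_UniformSpace z (fun w => (f w - f z = phi w * (w - z))%C).

Lemma cdiff_approx (f : C -> C) (z : C) : cdiff f z ->
  exists l : C, forall e, 0 < e -> exists d, 0 < d /\ forall w,
    Cmod (w - z)%C < d -> Cmod (f w - f z - l * (w - z))%C <= e * Cmod (w - z)%C.
Proof.
intros (phi & Hc & Hl). exists (phi z). intros e He.
assert (H1 := proj1 (filterlim_Cmod _ _ _) Hc e He).
generalize (filter_and _ _ H1 Hl). rewrite locally_Cmod.
intros (d & Hd & H). exists d. split; [exact Hd|].
intros w Hw. destruct (H w Hw) as [A B]. rewrite B.
replace (phi w * (w - z) - phi z * (w - z))%C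
  with ((phi w - phi z) * (w - z))%C by ring.
rewrite Cmod_mult. apply Rmult_le_compat_r; [apply Cmod_ge_0|lra].
Qed.

(** The difference quotient, extended by [l] at [z], is the function required
    by Caratheodory's form. *)
Lemma cdiff_of_approx (f : C -> C) (z l : C) :
  (forall e, 0 < e -> exists d, 0 < d /\ forall w,
    Cmod (w - z)%C < d -> Cmod (f w - f z - l * (w - z))%C <= e * Cmod (w - z)%C) ->
  cdiff f z.
Proof.
intros H.
exists (fun w => if Ceq_dec w z then l else ((f w - f z) / (w - z))%C). split.
- apply filterlim_Cmod; [apply locally_filter|]. intros e He.
  destruct (H (e / 2)) as (d & Hd & Hw); [lra|].
  apply locally_Cmod. exists d. split; [exact Hd|]. intros w Hwd.
  destruct (Ceq_dec z z) as [_|n]; [|now elim n].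
  destruct (Ceq_dec w z) as [->|n].
  + replace (l - l)%C with (RtoC 0) by ring. rewrite Cmod_0. exact He.
  + assert (Hn : (w - z)%C <> 0%C).
    { intros E. apply n. replace w with ((w - z) + z)%C by ring. rewrite E. ring. }
    assert (Hm : 0 < Cmod (w - z)%C) by now apply Cmod_gt_0.
    replace ((f w - f z) / (w - z) - l)%C
      with ((f w - f z - l * (w - z)) / (w - z))%C by now field.
    rewrite Cmod_div by assumption. apply Rle_lt_trans with (e / 2); [|lra].
    apply Rmult_le_reg_r with (1 := Hm). unfold Rdiv at 1.
    rewrite Rmult_assoc, Rinv_l, Rmult_1_r by lra. now apply Hw.
- apply locally_Cmod. exists 1. split; [lra|]. intros w _.
  destruct (Ceq_dec w z) as [->|n]; [ring|].
  field. intros E. apply n. replace w with ((w - z) + z)%C by ring. rewrite E. ring.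
Qed.

Lemma cdiff_of_ex_derive (f : C -> C) (z : C) :
  @ex_derive C_AbsRing C_NormedModule f z -> cdiff f z.
Proof.
intros [l [_ Hd]]. apply cdiff_of_approx with l. intros e He.
specialize (Hd z (fun P H => H) (mkposreal e He)).
apply (proj2 (locally_C z _)) in Hd.
apply locally_Cmod in Hd. destruct Hd as (d & Hd & H).
exists d. split; [exact Hd|]. intros w Hw. specialize (H w Hw).
simpl in H.
replace (f w - f z - l * (w - z))%C with (f w - f z - (w - z) * l)%C by ring.
exact H.
Qed.

Lemma cdiff_continuous (f : C -> C) (z : C) : cdiff f z -> ccontinuous f z.
Proof.
intros (phi & Hc & Hl).
assert (H : filterlim (fun w => f z + phi w * (w - z))%C
  (@locally C_UniformSpace z) (@locally C_UniformSpace (f z + phi z * (z - z))%C)).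
{ apply Clim_plus; [apply locally_filter|apply Clim_const, locally_filter|].
  apply Clim_mult; [apply locally_filter|exact Hc|].
  apply Clim_minus; [apply locally_filter|apply continuous_C_id|].
  apply Clim_const, locally_filter. }
replace (f z + phi z * (z - z))%C with (f z) in H by ring.
eapply filterlim_ext_loc; [|exact H].
generalize Hl. apply filter_imp. intros w E. change (f z + phi w * (w - z) = f w)%C. rewrite <- E. ring.
Qed.

Lemma cdiff_const (c z : C) : cdiff (fun _ => c) z.
Proof.
exists (fun _ => 0%C). split; [apply continuous_const|].
apply filter_forall. intros w. ring.
Qed.

Lemma cdiff_id (z : C) : cdiff (fun w => w) z.
Proof.
exists (fun _ => 1%C). split; [apply continuous_const|].
apply filter_forall. intros w. ring.
Qed.

Lemma cdiff_plus (f g : C -> C) (z : C) :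
  cdiff f z -> cdiff g z -> cdiff (fun w => f w + g w)%C z.
Proof.
intros (p & Hp & Ep) (q & Hq & Eq).
exists (fun w => p w + q w)%C. split.
- now apply Clim_plus; [apply locally_filter| |].
- generalize (filter_and _ _ Ep Eq). apply filter_imp. intros w [A B].
  replace (f w + g w - (f z + g z))%C with ((f w - f z) + (g w - g z))%C by ring.
  rewrite A, B. ring.
Qed.

Lemma cdiff_mult (f g : C -> C) (z : C) :
  cdiff f z -> cdiff g z -> cdiff (fun w => f w * g w)%C z.
Proof.
intros Hf (q & Hq & Eq). pose proof (cdiff_continuous _ _ Hf) as Cf.
destruct Hf as (p & Hp & Ep).
exists (fun w => p w * g z + f w * q w)%C. split.
- apply Clim_plus; [apply locally_filter| |].
  + apply Clim_mult; [apply locally_filter|exact Hp|apply Clim_const, locally_filter].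
  + now apply Clim_mult; [apply locally_filter| |].
- generalize (filter_and _ _ Ep Eq). apply filter_imp. intros w [A B].
  replace (f w * g w - (f z * g z))%C
    with ((f w - f z) * g z + f w * (g w - g z))%C by ring.
  rewrite A, B. ring.
Qed.

Lemma cdiff_opp (f : C -> C) (z : C) : cdiff f z -> cdiff (fun w => - f w)%C z.
Proof.
intros (p & Hp & Ep). exists (fun w => - p w)%C. split.
- now apply Clim_opp; [apply locally_filter|].
- generalize Ep. apply filter_imp. intros w A.
  replace (- f w - - f z)%C with (- (f w - f z))%C by ring. rewrite A. ring.
Qed.

Lemma cdiff_minus (f g : C -> C) (z : C) :
  cdiff f z -> cdiff g z -> cdiff (fun w => f w - g w)%C z.
Proof. intros Hf Hg. apply cdiff_plus; [exact Hf|now apply cdiff_opp]. Qed.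

Lemma cdiff_pow (f : C -> C) (z : C) (n : nat) :
  cdiff f z -> cdiff (fun w => f w ^ n)%C z.
Proof.
intros Hf. induction n as [|n IH]; simpl; [apply cdiff_const|now apply cdiff_mult].
Qed.

Lemma cdiff_inv (f : C -> C) (z : C) :
  cdiff f z -> f z <> 0%C -> cdiff (fun w => / f w)%C z.
Proof.
intros Hf Hz. pose proof (cdiff_continuous _ _ Hf) as Cf.
destruct Hf as (p & Hp & Ep).
exists (fun w => - p w * / (f w * f z))%C. split.
- apply Clim_mult; [apply locally_filter| |].
  + now apply Clim_opp; [apply locally_filter|].
  + apply (Clim_inv _ (fun w => f w * f z)%C); [|now apply Cmult_neq_0].
    apply Clim_mult; [apply locally_filter|exact Cf|apply Clim_const, locally_filter].
- assert (Hn := proj1 (filterlim_Cmod _ _ _) Cf (Cmod (f z))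
    (proj1 (Cmod_gt_0 _) Hz)).
  generalize (filter_and _ _ Ep Hn). apply filter_imp. intros w [A B].
  assert (Hw : f w <> 0%C).
  { intros E. rewrite E in B. replace (0 - f z)%C with (- f z)%C in B by ring.
    rewrite Cmod_opp in B. lra. }
  replace (/ f w - / f z)%C with (- (f w - f z) * / (f w * f z))%C by (field; auto).
  rewrite A. ring.
Qed.

Lemma cdiff_div (f g : C -> C) (z : C) :
  cdiff f z -> cdiff g z -> g z <> 0%C -> cdiff (fun w => f w / g w)%C z.
Proof. intros. apply cdiff_mult; [assumption|now apply cdiff_inv]. Qed.

Lemma cdiff_comp (f g : C -> C) (z : C) :
  cdiff g z -> cdiff f (g z) -> cdiff (fun w => f (g w)) z.
Proof.
intros Hg (p & Hp & Ep). pose proof (cdiff_continuous _ _ Hg) as Cg.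
destruct Hg as (q & Hq & Eq).
exists (fun w => p (g w) * q w)%C. split.
- apply Clim_mult; [apply locally_filter| |exact Hq].
  apply (filterlim_comp _ _ _ g p) with (1 := Cg). exact Hp.
- specialize (Cg _ Ep). unfold filtermap in Cg.
  generalize (filter_and _ _ Cg Eq). apply filter_imp. intros w [A B].
  rewrite A, B. ring.
Qed.

(** The zero of [g] absorbs the lack of differentiability of [k]. *)
Lemma cdiff_mult_zero (g k : C -> C) (z : C) :
  cdiff g z -> g z = 0%C -> ccontinuous k z -> cdiff (fun w => g w * k w)%C z.
Proof.
intros (p & Hp & Ep) Hz Hk. exists (fun w => p w * k w)%C. split.
- now apply Clim_mult; [apply locally_filter| |].
- generalize Ep. apply filter_imp. intros w A.
  rewrite Hz. replace (g w) with (p w * (w - z))%C; [ring|].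
  rewrite <- A, Hz. ring.
Qed.

(** * Goursat's theorem on rectangles *)

Record rect := Rect { xmin : R; xmax : R; ymin : R; ymax : R }.

Definition in_rect (Q : rect) (z : C) : Prop :=
  xmin Q <= Re z <= xmax Q /\ ymin Q <= Im z <= ymax Q.

Definition proper_rect (Q : rect) : Prop := xmin Q < xmax Q /\ ymin Q < ymax Q.

(** The imaginary part of the integral of [g] along the boundary of [Q],
    traversed counterclockwise.  It is the part in which the vertical sides
    contribute the integral of [Re g], whose circular means are wanted below. *)
Definition boundary_integral (g : C -> C) (Q : rect) : R :=
  RInt (fun x => Im (g (x, ymin Q))) (xmin Q) (xmax Q)
  - RInt (fun x => Im (g (x, ymax Q))) (xmin Q) (xmax Q)
  + RInt (fun y => Re (g (xmax Q, y))) (ymin Q) (ymax Q)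
  - RInt (fun y => Re (g (xmin Q, y))) (ymin Q) (ymax Q).

Definition area (Q : rect) : R := (xmax Q - xmin Q) * (ymax Q - ymin Q).

Lemma continuous_pair (x y : R) :
  @continuous R_UniformSpace C_UniformSpace (fun t => (t, y)) x /\
  @continuous R_UniformSpace C_UniformSpace (fun t => (x, t)) y.
Proof.
split; (apply filterlim_C_components; [apply locally_filter|]); simpl;
  split; (apply filterlim_id || apply filterlim_const).
Qed.

Lemma continuous_Re_Im (f : R -> C) (t : R) :
  @continuous R_UniformSpace C_UniformSpace f t ->
  continuous (fun s => Re (f s)) t /\ continuous (fun s => Im (f s)) t.
Proof. intros H. now apply filterlim_C_components in H; [|apply locally_filter]. Qed.

Lemma ex_RInt_horizontal (g : C -> C) (a b y : R) : a <= b ->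
  (forall x, a <= x <= b -> ccontinuous g (x, y)) ->
  ex_RInt (fun x => Re (g (x, y))) a b /\ ex_RInt (fun x => Im (g (x, y))) a b.
Proof.
intros Hab H.
split; apply (ex_RInt_continuous (V := R_CompleteNormedModule));
  rewrite Rmin_left, Rmax_right by assumption; intros x Hx;
  apply (continuous_Re_Im (fun x => g (x, y)) x);
  apply (continuous_comp (fun t : R => (t, y) : C_UniformSpace) g);
  try apply continuous_pair; now apply H.
Qed.

Lemma ex_RInt_vertical (g : C -> C) (x c d : R) : c <= d ->
  (forall y, c <= y <= d -> ccontinuous g (x, y)) ->
  ex_RInt (fun y => Re (g (x, y))) c d /\ ex_RInt (fun y => Im (g (x, y))) c d.
Proof.
intros Hab H.
split; apply (ex_RInt_continuous (V := R_CompleteNormedModule));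
  rewrite Rmin_left, Rmax_right by assumption; intros y Hy;
  apply (continuous_Re_Im (fun y => g (x, y)) y);
  apply (continuous_comp (fun t : R => (x, t) : C_UniformSpace) g);
  try apply continuous_pair; now apply H.
Qed.

Lemma RInt_Chasles_R (f : R -> R) (a b c : R) :
  ex_RInt f a b -> ex_RInt f b c -> RInt f a c = RInt f a b + RInt f b c.
Proof.
intros H1 H2. symmetry. exact (RInt_Chasles (V := R_CompleteNormedModule) f a b c H1 H2).
Qed.

Definition left_half (Q : rect) :=
  Rect (xmin Q) ((xmin Q + xmax Q) / 2) (ymin Q) (ymax Q).
Definition right_half (Q : rect) :=
  Rect ((xmin Q + xmax Q) / 2) (xmax Q) (ymin Q) (ymax Q).
Definition lower_half (Q : rect) :=
  Rect (xmin Q) (xmax Q) (ymin Q) ((ymin Q + ymax Q) / 2).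
Definition upper_half (Q : rect) :=
  Rect (xmin Q) (xmax Q) ((ymin Q + ymax Q) / 2) (ymax Q).

Lemma boundary_integral_halves_x (g : C -> C) (Q : rect) :
  proper_rect Q -> (forall z, in_rect Q z -> ccontinuous g z) ->
  boundary_integral g Q
  = boundary_integral g (left_half Q) + boundary_integral g (right_half Q).
Proof.
destruct Q as [a b c d]. intros [Hab Hcd] H. simpl in *.
unfold boundary_integral, left_half, right_half; simpl.
set (m := (a + b) / 2). assert (Hm : a < m < b) by (unfold m; lra).
assert (X : forall y, c <= y <= d ->
  RInt (fun x => Im (g (x, y))) a b
  = RInt (fun x => Im (g (x, y))) a m + RInt (fun x => Im (g (x, y))) m b).
{ intros y Hy. apply RInt_Chasles_R;
    (refine (proj2 (ex_RInt_horizontal _ _ _ _ _ _)); [lra|]); intros x Hx; apply H; split; simpl; lra. }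
rewrite (X c), (X d) by lra. ring.
Qed.

Lemma boundary_integral_halves_y (g : C -> C) (Q : rect) :
  proper_rect Q -> (forall z, in_rect Q z -> ccontinuous g z) ->
  boundary_integral g Q
  = boundary_integral g (lower_half Q) + boundary_integral g (upper_half Q).
Proof.
destruct Q as [a b c d]. intros [Hab Hcd] H. simpl in *.
unfold boundary_integral, lower_half, upper_half; simpl.
set (m := (c + d) / 2). assert (Hm : c < m < d) by (unfold m; lra).
assert (X : forall x, a <= x <= b ->
  RInt (fun y => Re (g (x, y))) c d
  = RInt (fun y => Re (g (x, y))) c m + RInt (fun y => Re (g (x, y))) m d).
{ intros x Hx. apply RInt_Chasles_R;
    (refine (proj1 (ex_RInt_vertical _ _ _ _ _ _)); [lra|]); intros y Hy; apply H; split; simpl; lra. }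
rewrite (X a), (X b) by lra. ring.
Qed.

(** Affine functions have zero boundary integral, so only the remainder of the
    first order expansion contributes. *)
Lemma boundary_integral_approx (g : C -> C) (Q : rect) (p l : C) (e : R) :
  proper_rect Q -> (forall z, in_rect Q z -> ccontinuous g z) ->
  (forall z, in_rect Q z -> Cmod (g z - (p + l * z))%C <= e) ->
  Rabs (boundary_integral g Q)
  <= 2 * e * ((xmax Q - xmin Q) + (ymax Q - ymin Q)).
Proof.
destruct Q as [a b c d]. intros [Hab Hcd] H Hg. simpl in *.
unfold boundary_integral; simpl.
assert (Hb : forall z, in_rect (Rect a b c d) z ->
  Rabs (Re (g z) - (Re p + (Re l * Re z - Im l * Im z))) <= e /\
  Rabs (Im (g z) - (Im p + (Re l * Im z + Im l * Re z))) <= e).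
{ intros z Hz. specialize (Hg z Hz).
  pose proof (Rmax_Cmod (g z - (p + l * z))%C) as M.
  pose proof (Rmax_l (Rabs (fst (g z - (p + l * z))%C)) (Rabs (snd (g z - (p + l * z))%C))) as M1.
  pose proof (Rmax_r (Rabs (fst (g z - (p + l * z))%C)) (Rabs (snd (g z - (p + l * z))%C))) as M2.
  split.
  - replace (_ - _) with (fst (g z - (p + l * z))%C)
      by (simpl; unfold Re, Im; ring). lra.
  - replace (_ - _) with (snd (g z - (p + l * z))%C)
      by (simpl; unfold Re, Im; ring). lra. }
assert (Hx : Rabs (RInt (fun x => (Im (g (x, c)) - Im (g (x, d))) - Re l * (c - d)) a b)
  <= (b - a) * (2 * e)).
{ apply abs_RInt_le_const; [lra| |].
  - apply (ex_RInt_minus (V := R_NormedModule)); [apply (ex_RInt_minus (V := R_NormedModule))|apply ex_RInt_const];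
      (refine (proj2 (ex_RInt_horizontal _ _ _ _ _ _)); [lra|]); intros x Hx; apply H; split; simpl; lra.
  - intros x Hx.
    destruct (Hb (x, c)) as [_ B1]; [split; simpl; lra|].
    destruct (Hb (x, d)) as [_ B2]; [split; simpl; lra|]. simpl in *.
    apply Rabs_le_between in B1. apply Rabs_le_between in B2.
    apply Rabs_le_between. lra. }
assert (Hy : Rabs (RInt (fun y => (Re (g (b, y)) - Re (g (a, y))) - Re l * (b - a)) c d)
  <= (d - c) * (2 * e)).
{ apply abs_RInt_le_const; [lra| |].
  - apply (ex_RInt_minus (V := R_NormedModule)); [apply (ex_RInt_minus (V := R_NormedModule))|apply ex_RInt_const];
      (refine (proj1 (ex_RInt_vertical _ _ _ _ _ _)); [lra|]); intros y Hy; apply H; split; simpl; lra.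
  - intros y Hy.
    destruct (Hb (b, y)) as [B1 _]; [split; simpl; lra|].
    destruct (Hb (a, y)) as [B2 _]; [split; simpl; lra|]. simpl in *.
    apply Rabs_le_between in B1. apply Rabs_le_between in B2.
    apply Rabs_le_between. lra. }
assert (Ex : RInt (fun x => (Im (g (x, c)) - Im (g (x, d))) - Re l * (c - d)) a b
  = RInt (fun x => Im (g (x, c))) a b - RInt (fun x => Im (g (x, d))) a b
    - (b - a) * (Re l * (c - d))).
{ apply (is_RInt_unique (V := R_CompleteNormedModule)).
  apply (is_RInt_minus (V := R_NormedModule));
    [apply (is_RInt_minus (V := R_NormedModule))|apply (is_RInt_const (V := R_NormedModule))];
    apply (RInt_correct (V := R_CompleteNormedModule));
    (refine (proj2 (ex_RInt_horizontal _ _ _ _ _ _)); [lra|]); intros x Hx'; apply H; split; simpl; lra. }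
assert (Ey : RInt (fun y => (Re (g (b, y)) - Re (g (a, y))) - Re l * (b - a)) c d
  = RInt (fun y => Re (g (b, y))) c d - RInt (fun y => Re (g (a, y))) c d
    - (d - c) * (Re l * (b - a))).
{ apply (is_RInt_unique (V := R_CompleteNormedModule)).
  apply (is_RInt_minus (V := R_NormedModule));
    [apply (is_RInt_minus (V := R_NormedModule))|apply (is_RInt_const (V := R_NormedModule))];
    apply (RInt_correct (V := R_CompleteNormedModule));
    (refine (proj1 (ex_RInt_vertical _ _ _ _ _ _)); [lra|]); intros y Hy'; apply H; split; simpl; lra. }
rewrite Ex in Hx. rewrite Ey in Hy.
apply Rabs_le_between in Hx. apply Rabs_le_between in Hy.
apply Rabs_le_between. nra.
Qed.

Section Bisection.
Variables (g : C -> C) (K : R).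

(** The defect per unit area is at least [K]; this survives bisection because
    both the area and the boundary integral are additive. *)
Definition heavy (Q : rect) : Prop := K * area Q <= Rabs (boundary_integral g Q).

(** Deciding which half to keep makes the sequence of rectangles a plain
    iteration. *)
Definition heavy_half_x (Q : rect) : rect :=
  if Rle_dec (K * area (left_half Q)) (Rabs (boundary_integral g (left_half Q)))
  then left_half Q else right_half Q.

Definition heavy_half_y (Q : rect) : rect :=
  if Rle_dec (K * area (lower_half Q)) (Rabs (boundary_integral g (lower_half Q)))
  then lower_half Q else upper_half Q.

Definition quarters (Q : rect) (n : nat) : rect :=
  Nat.iter n (fun Q => heavy_half_y (heavy_half_x Q)) Q.

Lemma heavy_half_x_spec (Q : rect) :
  proper_rect Q -> (forall z, in_rect Q z -> ccontinuous g z) -> heavy Q ->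
  let Q' := heavy_half_x Q in
  heavy Q' /\ xmin Q <= xmin Q' /\ xmax Q' <= xmax Q /\
  xmax Q' - xmin Q' = (xmax Q - xmin Q) / 2 /\ ymin Q' = ymin Q /\ ymax Q' = ymax Q.
Proof.
intros HQ Hc Hh. pose proof (boundary_integral_halves_x g Q HQ Hc) as E.
destruct HQ as [H1 H2]. unfold heavy_half_x. destruct Rle_dec as [Hl|Hl].
- split; [exact Hl|]. simpl. repeat split; lra.
- split; [|simpl; repeat split; lra].
  unfold heavy in *. rewrite E in Hh.
  pose proof (Rabs_triang (boundary_integral g (left_half Q))
    (boundary_integral g (right_half Q))) as T.
  assert (A : area Q = area (left_half Q) + area (right_half Q))
    by (unfold area; simpl; field).
  rewrite A in Hh. lra.
Qed.

Lemma heavy_half_y_spec (Q : rect) :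
  proper_rect Q -> (forall z, in_rect Q z -> ccontinuous g z) -> heavy Q ->
  let Q' := heavy_half_y Q in
  heavy Q' /\ ymin Q <= ymin Q' /\ ymax Q' <= ymax Q /\
  ymax Q' - ymin Q' = (ymax Q - ymin Q) / 2 /\ xmin Q' = xmin Q /\ xmax Q' = xmax Q.
Proof.
intros HQ Hc Hh. pose proof (boundary_integral_halves_y g Q HQ Hc) as E.
destruct HQ as [H1 H2]. unfold heavy_half_y. destruct Rle_dec as [Hl|Hl].
- split; [exact Hl|]. simpl. repeat split; lra.
- split; [|simpl; repeat split; lra].
  unfold heavy in *. rewrite E in Hh.
  pose proof (Rabs_triang (boundary_integral g (lower_half Q))
    (boundary_integral g (upper_half Q))) as T.
  assert (A : area Q = area (lower_half Q) + area (upper_half Q))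
    by (unfold area; simpl; field).
  rewrite A in Hh. lra.
Qed.

Lemma quarters_step (Q : rect) :
  proper_rect Q -> (forall z, in_rect Q z -> ccontinuous g z) -> heavy Q ->
  let Q' := heavy_half_y (heavy_half_x Q) in
  heavy Q' /\ xmin Q <= xmin Q' /\ xmax Q' <= xmax Q /\
  ymin Q <= ymin Q' /\ ymax Q' <= ymax Q /\
  xmax Q' - xmin Q' = (xmax Q - xmin Q) / 2 /\
  ymax Q' - ymin Q' = (ymax Q - ymin Q) / 2.
Proof.
intros HQ Hc Hh.
destruct (heavy_half_x_spec Q HQ Hc Hh) as (X1 & X2 & X3 & X4 & X5 & X6).
destruct (heavy_half_y_spec (heavy_half_x Q)) as (Y1 & Y2 & Y3 & Y4 & Y5 & Y6).
- destruct HQ. split; lra.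
- intros z [Z1 Z2]. apply Hc. split; lra.
- exact X1.
- cbv zeta. split; [exact Y1|]. rewrite Y5, Y6. rewrite X5, X6 in *. lra.
Qed.

Lemma quarters_spec (Q : rect) (n : nat) :
  proper_rect Q -> (forall z, in_rect Q z -> ccontinuous g z) -> heavy Q ->
  let Q' := quarters Q n in
  heavy Q' /\ xmin Q <= xmin Q' /\ xmax Q' <= xmax Q /\
  ymin Q <= ymin Q' /\ ymax Q' <= ymax Q /\
  xmax Q' - xmin Q' = (xmax Q - xmin Q) / 2 ^ n /\
  ymax Q' - ymin Q' = (ymax Q - ymin Q) / 2 ^ n.
Proof.
intros HQ Hc Hh. induction n as [|n IH].
- simpl. split; [exact Hh|]. lra.
- cbv zeta in *. destruct IH as (A0 & A1 & A2 & A3 & A4 & A5 & A6).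
  assert (P : 0 < 2 ^ n) by (apply pow_lt; lra).
  assert (B : 0 < / 2 ^ n) by now apply Rinv_0_lt_compat.
  destruct HQ as [Hx Hy].
  destruct (quarters_step (quarters Q n)) as (B0 & B1 & B2 & B3 & B4 & B5 & B6).
  + unfold Rdiv in *. split; nra.
  + intros z [Z1 Z2]. apply Hc. split; lra.
  + exact A0.
  + change (quarters Q (S n)) with (heavy_half_y (heavy_half_x (quarters Q n))).
    split; [exact B0|]. rewrite B5, B6, A5, A6.
    simpl. repeat split; try lra; field; lra.
Qed.

Lemma quarters_nested (Q : rect) (m n : nat) :
  proper_rect Q -> (forall z, in_rect Q z -> ccontinuous g z) -> heavy Q ->
  xmin (quarters Q m) <= xmin (quarters Q (m + n)) /\
  xmax (quarters Q (m + n)) <= xmax (quarters Q m) /\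
  ymin (quarters Q m) <= ymin (quarters Q (m + n)) /\
  ymax (quarters Q (m + n)) <= ymax (quarters Q m).
Proof.
intros HQ Hc Hh.
destruct (quarters_spec Q m HQ Hc Hh) as (A0 & A1 & A2 & A3 & A4 & A5 & A6).
assert (P : 0 < / 2 ^ m) by (apply Rinv_0_lt_compat, pow_lt; lra).
destruct HQ as [Hx Hy].
destruct (quarters_spec (quarters Q m) n) as (B0 & B1 & B2 & B3 & B4 & _).
- unfold Rdiv in *. split; nra.
- intros z [Z1 Z2]. apply Hc. split; lra.
- exact A0.
- replace (quarters Q (m + n)) with (quarters (quarters Q m) n); [lra|].
  unfold quarters. rewrite <- Nat.iter_add. f_equal. lia.
Qed.

End Bisection.

Lemma nested_intervals (a b : nat -> R) :
  (forall m n, a m <= b n) -> exists x, forall n, a n <= x <= b n.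
Proof.
intros H.
destruct (completeness (fun x => exists n, x = a n)) as [x [Hx1 Hx2]].
- exists (b 0%nat). intros y [n ->]. apply H.
- exists (a 0%nat), 0%nat. reflexivity.
- exists x. intros n. split.
  + apply Hx1. now exists n.
  + apply Hx2. intros y [m ->]. apply H.
Qed.

Lemma quarters_common_point (g : C -> C) (K : R) (Q : rect) :
  proper_rect Q -> (forall z, in_rect Q z -> ccontinuous g z) -> heavy g K Q ->
  exists z, forall n, in_rect (quarters g K Q n) z.
Proof.
intros HQ Hc Hh.
assert (W : forall n, xmin (quarters g K Q n) <= xmax (quarters g K Q n) /\
                      ymin (quarters g K Q n) <= ymax (quarters g K Q n)).
{ intros n. destruct (quarters_spec g K Q n HQ Hc Hh) as (_ & _ & _ & _ & _ & A & B).
  assert (P : 0 < / 2 ^ n) by (apply Rinv_0_lt_compat, pow_lt; lra).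
  destruct HQ. unfold Rdiv in *. split; nra. }
destruct (nested_intervals (fun n => xmin (quarters g K Q n))
                           (fun n => xmax (quarters g K Q n))) as [x Hx].
{ intros m n.
  pose proof (quarters_nested g K Q m n HQ Hc Hh).
  pose proof (quarters_nested g K Q n m HQ Hc Hh).
  rewrite (Nat.add_comm n m) in *. pose proof (W (m + n)%nat). lra. }
destruct (nested_intervals (fun n => ymin (quarters g K Q n))
                           (fun n => ymax (quarters g K Q n))) as [y Hy].
{ intros m n.
  pose proof (quarters_nested g K Q m n HQ Hc Hh).
  pose proof (quarters_nested g K Q n m HQ Hc Hh).
  rewrite (Nat.add_comm n m) in *. pose proof (W (m + n)%nat). lra. }
exists (x, y). intros n. split; simpl; auto.
Qed.

Lemma pow2_large (x : R) : exists n, x < 2 ^ n.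
Proof.
destruct (Pow_x_infinity 2) with (b := x + 1) as [N HN].
- rewrite Rabs_pos_eq; lra.
- exists N. specialize (HN N (le_n _)).
  rewrite Rabs_pos_eq in HN by (apply pow_le; lra). lra.
Qed.

(** Otherwise the nested heavy quarters shrink to a point at which [g] is
    differentiable, and there the defect is of smaller order than the area. *)
Theorem Goursat (g : C -> C) (Q : rect) :
  proper_rect Q -> (forall z, in_rect Q z -> cdiff g z) ->
  boundary_integral g Q = 0.
Proof.
intros HQ Hd.
assert (Hc : forall z, in_rect Q z -> ccontinuous g z)
  by (intros z Hz; now apply cdiff_continuous, Hd).
destruct (Req_dec (boundary_integral g Q) 0) as [|Hn]; [assumption|exfalso].
set (w := xmax Q - xmin Q). set (h := ymax Q - ymin Q).
assert (Hw : 0 < w) by (destruct HQ; unfold w; lra).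
assert (Hh : 0 < h) by (destruct HQ; unfold h; lra).
assert (Hwh : 0 < w * h) by nra.
set (K := Rabs (boundary_integral g Q) / (w * h)).
assert (HK : 0 < K) by (apply Rdiv_lt_0_compat; [now apply Rabs_pos_lt|exact Hwh]).
assert (Hv : heavy g K Q).
{ unfold heavy, area. fold w h. unfold K. right. field. split; lra. }
destruct (quarters_common_point g K Q HQ Hc Hv) as [z0 Hz].
destruct (cdiff_approx g z0) as [l Hl]; [exact (Hd z0 (Hz 0%nat))|].
(* Both the diameter and the half-perimeter of the [n]-th quarter are at most
   [(w + h) / 2 ^ n], so this [e] bounds its defect by half of [K] times its
   area. *)
set (e := K * (w * h) / (4 * (w + h) ^ 2)).
assert (He : 0 < e).
{ apply Rdiv_lt_0_compat; [nra|]. assert (0 < (w + h) ^ 2) by (apply pow_lt; lra). lra. }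
destruct (Hl e He) as (del & Hdel & Happ).
destruct (pow2_large ((w + h) / del)) as [n Hn2].
assert (P : 0 < 2 ^ n) by (apply pow_lt; lra).
assert (Hsmall : (w + h) / 2 ^ n < del).
{ apply Rmult_lt_reg_r with (2 ^ n); [exact P|]. unfold Rdiv.
  rewrite Rmult_assoc, Rinv_l, Rmult_1_r by lra.
  apply Rmult_lt_compat_r with (r := del) in Hn2; [|exact Hdel].
  unfold Rdiv in Hn2. rewrite Rmult_assoc, Rinv_l in Hn2 by lra. lra. }
destruct (quarters_spec g K Q n HQ Hc Hv) as (A0 & A1 & A2 & A3 & A4 & A5 & A6).
fold w in A5. fold h in A6. set (Qn := quarters g K Q n) in *.
set (dn := (w + h) / 2 ^ n) in *.
assert (Hdn : xmax Qn - xmin Qn + (ymax Qn - ymin Qn) = dn)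
  by (rewrite A5, A6; unfold dn; field; lra).
assert (Hbound : Rabs (boundary_integral g Qn) <= 2 * (e * dn) * dn).
{ rewrite <- Hdn at 2.
  apply boundary_integral_approx with (p := (g z0 - l * z0)%C) (l := l).
  - split; apply Rlt_0_minus; rewrite ?A5, ?A6; now apply Rdiv_lt_0_compat.
  - intros z [Z1 Z2]. apply Hc. split; lra.
  - intros z [Z1 Z2]. pose proof (Hz n) as [Z3 Z4]. fold Qn in Z3, Z4.
    assert (Hzz : Cmod (z - z0)%C <= dn).
    { eapply Rle_trans; [apply Cmod_le_Rabs|]. rewrite <- Hdn.
      apply Rplus_le_compat; apply Rabs_le_between; simpl; unfold Re, Im in *; lra. }
    replace (g z - (g z0 - l * z0 + l * z))%C
      with (g z - g z0 - l * (z - z0))%C by ring.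
    eapply Rle_trans; [apply Happ; lra|].
    apply Rmult_le_compat_l; lra. }
unfold heavy, area in A0. rewrite A5, A6 in A0.
assert (F : K * (w / 2 ^ n * (h / 2 ^ n)) <= 2 * (e * dn) * dn) by lra.
assert (F2 : 2 * (e * dn) * dn = K * (w / 2 ^ n * (h / 2 ^ n)) / 2).
{ unfold e, dn. field. split; lra. }
assert (0 < K * (w / 2 ^ n * (h / 2 ^ n))).
{ apply Rmult_lt_0_compat; [exact HK|].
  apply Rmult_lt_0_compat; now apply Rdiv_lt_0_compat. }
lra.
Qed.

(** * The mean value property and the maximum principle at the centre *)

Definition Cexp (z : C) : C := (exp (Re z) * cos (Im z), exp (Re z) * sin (Im z)).

Lemma Cexp_plus (z w : C) : Cexp (z + w)%C = (Cexp z * Cexp w)%C.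
Proof.
unfold Cexp, Cmult, Re, Im; simpl.
rewrite exp_plus, cos_plus, sin_plus. apply injective_projections; simpl; ring.
Qed.

Lemma Cmod_Cexp (z : C) : Cmod (Cexp z) = exp (Re z).
Proof.
apply Rsqr_inj; [apply Cmod_ge_0|apply Rlt_le, exp_pos|].
rewrite !Rsqr_pow2, Cmod2_alt. unfold Cexp; simpl.
pose proof (sin2_cos2 (Im z)) as H. unfold Rsqr in H. nra.
Qed.

Lemma derivable_pt_lim_approx (f : R -> R) (l : R) :
  derivable_pt_lim f 0 l -> forall e, 0 < e -> exists d, 0 < d /\
  forall x, Rabs x < d -> Rabs (f x - f 0 - l * x) <= e * Rabs x.
Proof.
intros H e He. destruct (H e He) as [d Hd]. exists d. split; [apply cond_pos|].
intros x Hx. destruct (Req_dec x 0) as [->|Hn].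
- replace (f 0 - f 0 - l * 0) with 0 by ring. rewrite Rabs_R0. lra.
- specialize (Hd x Hn Hx). rewrite Rplus_0_l in Hd.
  replace (f x - f 0 - l * x) with (((f x - f 0) / x - l) * x) by (field; auto).
  rewrite Rabs_mult. apply Rmult_le_compat_r; [apply Rabs_pos|lra].
Qed.

(** The remainder of [exp] at [0] splits into the one-variable remainders of the
    real exponential, sine and cosine. *)
Lemma cdiff_Cexp_0 : cdiff Cexp 0.
Proof.
apply cdiff_of_approx with (RtoC 1). intros e0 He0.
(* The two coordinates of the remainder will be bounded by [4 * e * m] and
   [5 * e * m], where [m] is the modulus of the increment. *)
set (e := Rmin 1 (e0 / 12)).
assert (He : 0 < e) by (apply Rmin_pos; lra).
assert (He1 : e <= 1) by apply Rmin_l.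
assert (He2 : 12 * e <= e0) by (pose proof (Rmin_r 1 (e0 / 12)); unfold e; lra).
clearbody e.
destruct (derivable_pt_lim_approx exp 1) with (e := e) as (d1 & Hd1 & H1);
  [apply derivable_pt_lim_exp_0|exact He|].
destruct (derivable_pt_lim_approx sin 1) with (e := e) as (d2 & Hd2 & H2);
  [apply derivable_pt_lim_sin_0|exact He|].
destruct (derivable_pt_lim_approx cos 0) with (e := e) as (d3 & Hd3 & H3);
  [apply derivable_pt_lim_cos_0|exact He|].
exists (Rmin (Rmin d1 d2) (Rmin d3 e)). split.
{ repeat apply Rmin_pos; assumption. }
intros w Hw. replace (w - 0)%C with w in * by ring.
destruct w as [x y].
pose proof (Rmax_Cmod (x, y)) as M. simpl in M.
set (m := Cmod (x, y)) in *.
pose proof (Rmax_l (Rabs x) (Rabs y)). pose proof (Rmax_r (Rabs x) (Rabs y)).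
pose proof (Rmin_l (Rmin d1 d2) (Rmin d3 e)). pose proof (Rmin_r (Rmin d1 d2) (Rmin d3 e)).
pose proof (Rmin_l d1 d2). pose proof (Rmin_r d1 d2).
pose proof (Rmin_l d3 e). pose proof (Rmin_r d3 e).
specialize (H1 x ltac:(lra)). specialize (H2 y ltac:(lra)). specialize (H3 y ltac:(lra)).
rewrite exp_0 in H1. rewrite sin_0 in H2. rewrite cos_0 in H3.
eapply Rle_trans; [apply Cmod_le_Rabs|].
unfold Cexp; simpl. rewrite exp_0, sin_0, cos_0.
set (E := exp x) in *. set (S := sin y) in *. set (D := cos y) in *.
assert (Hm : 0 <= m) by apply Cmod_ge_0.
apply Rle_trans with (12 * e * m); [|nra].
assert (X : Rabs x <= m) by lra. assert (Y : Rabs y <= m) by lra.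
assert (Xe : Rabs x < e) by lra.
assert (EB : Rabs (E - 1) <= 2 * e).
{ replace (E - 1) with ((E - 1 - 1 * x) + x) by ring.
  eapply Rle_trans; [apply Rabs_triang|]. pose proof (Rabs_pos x). nra. }
assert (EB2 : Rabs E <= 3).
{ replace E with ((E - 1) + 1) by ring.
  eapply Rle_trans; [apply Rabs_triang|]. rewrite Rabs_R1. lra. }
replace (E * D + - (1 * 1) + - (1 * x - 0 * y))
  with ((E - 1 - 1 * x) + E * (D - 1 - 0 * y)) by ring.
replace (E * S + - (1 * 0) + - (1 * y + 0 * x))
  with (E * (S - 0 - 1 * y) + (E - 1) * y) by ring.
assert (A1 : Rabs ((E - 1 - 1 * x) + E * (D - 1 - 0 * y)) <= 4 * e * m).
{ eapply Rle_trans; [apply Rabs_triang|]. rewrite Rabs_mult.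
  pose proof (Rabs_pos E). pose proof (Rabs_pos (D - 1 - 0 * y)).
  assert (Rabs E * Rabs (D - 1 - 0 * y) <= 3 * (e * m)).
  { apply Rmult_le_compat; try assumption. nra. }
  nra. }
assert (A2 : Rabs (E * (S - 0 - 1 * y) + (E - 1) * y) <= 5 * e * m).
{ eapply Rle_trans; [apply Rabs_triang|]. rewrite !Rabs_mult.
  pose proof (Rabs_pos E). pose proof (Rabs_pos (S - 0 - 1 * y)).
  pose proof (Rabs_pos (E - 1)). pose proof (Rabs_pos y).
  assert (Rabs E * Rabs (S - 0 - 1 * y) <= 3 * (e * m)).
  { apply Rmult_le_compat; try assumption. nra. }
  assert (Rabs (E - 1) * Rabs y <= 2 * e * m).
  { apply Rmult_le_compat; assumption. }
  lra. }
assert (0 <= e * m) by nra. lra.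
Qed.

Lemma cdiff_Cexp (z : C) : cdiff Cexp z.
Proof.
assert (H : cdiff (fun w => Cexp z * Cexp (w - z))%C z).
{ apply cdiff_mult; [apply cdiff_const|].
  apply (cdiff_comp Cexp (fun w => w - z)%C).
  - apply cdiff_minus; [apply cdiff_id|apply cdiff_const].
  - replace (z - z)%C with (RtoC 0) by ring. apply cdiff_Cexp_0. }
assert (K : forall w : C, (Cexp z * Cexp (w - z))%C = Cexp w).
{ intros w. rewrite <- Cexp_plus. f_equal. ring. }
destruct H as (p & Hp & Ep). exists p. split; [exact Hp|].
revert Ep. apply filter_imp. intros w. now rewrite !K.
Qed.

Lemma ccontinuous_Cexp_line (h : C -> C) (s y : R) :
  ccontinuous h (Cexp (s, y)) -> ccontinuous (fun z => h (Cexp z)) (s, y).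
Proof.
intros H. apply (filterlim_comp _ _ _ Cexp h) with (2 := H).
apply cdiff_continuous, cdiff_Cexp.
Qed.

(** Goursat's theorem in logarithmic coordinates: the horizontal sides cancel
    by periodicity of the exponential. *)
Lemma circle_mean_constant (h : C -> C) (s t : R) :
  (forall z, unit_disc z -> cdiff h z) -> s < t -> t < 0 ->
  RInt (fun y => Re (h (Cexp (s, y)))) 0 (2 * PI)
  = RInt (fun y => Re (h (Cexp (t, y)))) 0 (2 * PI).
Proof.
intros Hh Hst Ht. pose proof PI_RGT_0 as Hpi.
assert (G : boundary_integral (fun z => h (Cexp z)) (Rect s t 0 (2 * PI)) = 0).
{ apply Goursat; [split; simpl; lra|].
  intros z [Hz _]. simpl in Hz. apply cdiff_comp; [apply cdiff_Cexp|].
  apply Hh. unfold unit_disc. rewrite Cmod_Cexp, <- exp_0. apply exp_increasing. lra. }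
unfold boundary_integral in G; simpl in G.
assert (E : RInt (fun x => Im (h (Cexp (x, 2 * PI)))) s t
          = RInt (fun x => Im (h (Cexp (x, 0)))) s t).
{ apply RInt_ext. intros x _. unfold Cexp; simpl.
  now rewrite cos_2PI, sin_2PI, cos_0, sin_0. }
rewrite E in G. lra.
Qed.

(** The circular mean is the same on a tiny circle, where it is near
    [Re (h 0)] by continuity, as on the circle of radius [r]. *)
Lemma Re_centre_le (h : C -> C) (r M : R) :
  (forall z, unit_disc z -> cdiff h z) -> 0 < r < 1 ->
  (forall z, Cmod z = r -> Re (h z) <= M) -> Re (h 0) <= M.
Proof.
intros Hh Hr HM. pose proof PI_RGT_0 as Hpi.
apply Rnot_lt_le. intros Hlt.
set (e := (Re (h 0) - M) / 2). assert (He : 0 < e) by (unfold e; lra).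
assert (H0 : unit_disc 0) by (unfold unit_disc; rewrite Cmod_0; lra).
pose proof (cdiff_continuous _ _ (Hh _ H0)) as Hc.
destruct (ccontinuous_eps _ _ Hc e He) as (d & Hd & Hcd). clear Hc. rename Hcd into Hc.
set (s := ln (Rmin d r / 2)).
assert (Hm : 0 < Rmin d r) by (apply Rmin_pos; lra).
assert (Hes : exp s = Rmin d r / 2) by (unfold s; rewrite exp_ln; lra).
pose proof (Rmin_l d r). pose proof (Rmin_r d r).
assert (Her : exp (ln r) = r) by (apply exp_ln; lra).
assert (Hst : s < ln r) by (apply exp_lt_inv; lra).
assert (Ht : ln r < 0) by (rewrite <- ln_1; apply ln_increasing; lra).
pose proof (circle_mean_constant h s (ln r) Hh Hst Ht) as Heq.
assert (Hint : forall u, u < 0 -> ex_RInt (fun y => Re (h (Cexp (u, y)))) 0 (2 * PI)).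
{ intros u Hu. refine (proj1 (ex_RInt_vertical (fun z => h (Cexp z)) u 0 (2 * PI) _ _)).
  - lra.
  - intros y _. apply ccontinuous_Cexp_line, cdiff_continuous, Hh.
    unfold unit_disc. rewrite Cmod_Cexp, <- exp_0. now apply exp_increasing. }
assert (L1 : RInt (fun _ => Re (h 0) - e) 0 (2 * PI)
             <= RInt (fun y => Re (h (Cexp (s, y)))) 0 (2 * PI)).
{ apply RInt_le; [lra|apply ex_RInt_const|apply Hint; lra|].
  intros y _. assert (Hd' : Cmod (Cexp (s, y) - 0)%C < d).
  { replace (Cexp (s, y) - 0)%C with (Cexp (s, y)) by ring.
    rewrite Cmod_Cexp; simpl. lra. }
  specialize (Hc _ Hd'). rewrite <- Cmod_opp in Hc.
  pose proof (Re_le_Cmod (- (h (Cexp (s, y)) - h 0))%C) as B. simpl in B.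
  unfold Re in *. simpl in B. lra. }
assert (L2 : RInt (fun y => Re (h (Cexp (ln r, y)))) 0 (2 * PI)
             <= RInt (fun _ => M) 0 (2 * PI)).
{ apply RInt_le; [lra|apply Hint; lra|apply ex_RInt_const|].
  intros y _. apply HM. rewrite Cmod_Cexp. exact Her. }
assert (K : forall c : R, RInt (fun _ => c) 0 (2 * PI) = 2 * PI * c).
{ intros c. rewrite (RInt_const (V := R_CompleteNormedModule)).
  change ((2 * PI - 0) * c = 2 * PI * c). ring. }
rewrite K in L1, L2. unfold e in *. nra.
Qed.

(** A rotation makes [h 0] a nonnegative real. *)
Lemma Cmod_centre_le (h : C -> C) (r M : R) :
  (forall z, unit_disc z -> cdiff h z) -> 0 < r < 1 ->
  (forall z, Cmod z = r -> Cmod (h z) <= M) -> Cmod (h 0) <= M.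
Proof.
intros Hh Hr HM. destruct (Ceq_dec (h 0) 0) as [E|Hn].
- rewrite E, Cmod_0. eapply Rle_trans; [|apply (HM (RtoC r))]; [apply Cmod_ge_0|].
  rewrite Cmod_R. apply Rabs_pos_eq. lra.
- assert (Hp : 0 < Cmod (h 0)) by now apply Cmod_gt_0.
  set (c := (Cconj (h 0) / Cmod (h 0))%C).
  assert (Hmn : RtoC (Cmod (h 0)) <> 0%C) by (intros E; injection E; lra).
  assert (Hcm : Cmod c = 1).
  { unfold c. rewrite Cmod_div, Cmod_conj, Cmod_R, Rabs_pos_eq by (try lra; auto).
    field. lra. }
  replace (Cmod (h 0)) with (Re (c * h 0)%C).
  + apply (Re_centre_le (fun z => c * h z)%C r M); [|exact Hr|].
    * intros z Hz. apply cdiff_mult; [apply cdiff_const|now apply Hh].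
    * intros z Hz. eapply Rle_trans; [apply Re_le_Cmod|].
      rewrite Cmod_mult, Hcm, Rmult_1_l. now apply HM.
  + replace (c * h 0)%C with (RtoC (Cmod (h 0))); [reflexivity|].
    unfold c. replace (Cconj (h 0) / Cmod (h 0) * h 0)%C
      with (h 0 * Cconj (h 0) / Cmod (h 0))%C by (field; exact Hmn).
    rewrite <- Cmod2_conj. rewrite RtoC_pow. simpl. field. exact Hmn.
Qed.

(** * The Schwarz-Pick lemma *)

Definition mobius (c z : C) : C := ((z - c) / (1 - Cconj c * z))%C.

Lemma mobius_denominator (c z : C) :
  unit_disc c -> unit_disc z -> (1 - Cconj c * z)%C <> 0%C.
Proof.
unfold unit_disc. intros Hc Hz E.
assert (E1 : (Cconj c * z)%C = 1%C).
{ replace (Cconj c * z)%C with (1 - (1 - Cconj c * z))%C by ring. rewrite E. ring. }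
assert (E2 : Cmod (Cconj c * z)%C = 1) by (rewrite E1; apply Cmod_1).
rewrite Cmod_mult, Cmod_conj in E2.
pose proof (Cmod_ge_0 c). pose proof (Cmod_ge_0 z). nra.
Qed.

(** This identity is behind every computation with Moebius maps of the disc. *)
Lemma mobius_identity (c z : C) :
  Cmod (1 - Cconj c * z)%C ^ 2 - Cmod (z - c)%C ^ 2
  = (1 - Cmod c ^ 2) * (1 - Cmod z ^ 2).
Proof. rewrite !Cmod2_alt. destruct c, z. simpl. ring. Qed.

Lemma unit_disc_sqr (z : C) : unit_disc z <-> 0 < 1 - Cmod z ^ 2.
Proof. unfold unit_disc. pose proof (Cmod_ge_0 z). split; intros; nra. Qed.

Lemma Cmod_mobius (c z : C) : unit_disc c -> unit_disc z ->
  1 - Cmod (mobius c z) ^ 2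
  = (1 - Cmod c ^ 2) * (1 - Cmod z ^ 2) / Cmod (1 - Cconj c * z)%C ^ 2.
Proof.
intros Hc Hz. pose proof (mobius_denominator c z Hc Hz) as Hn.
assert (Hp : 0 < Cmod (1 - Cconj c * z)%C) by now apply Cmod_gt_0.
rewrite <- mobius_identity. unfold mobius. rewrite Cmod_div by assumption.
field. lra.
Qed.

Lemma unit_disc_mobius (c z : C) :
  unit_disc c -> unit_disc z -> unit_disc (mobius c z).
Proof.
intros Hc Hz. apply unit_disc_sqr. rewrite Cmod_mobius by assumption.
assert (Hp : 0 < Cmod (1 - Cconj c * z)%C)
  by (apply Cmod_gt_0; now apply mobius_denominator).
apply unit_disc_sqr in Hc, Hz.
apply Rdiv_lt_0_compat; [nra|now apply pow_lt].
Qed.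

Lemma unit_disc_opp (c : C) : unit_disc c -> unit_disc (- c)%C.
Proof. unfold unit_disc. now rewrite Cmod_opp. Qed.

Lemma Cconj_opp (z : C) : Cconj (- z) = (- Cconj z)%C.
Proof. apply injective_projections; simpl; ring. Qed.

Lemma mobius_opp_K (c z : C) : unit_disc c -> unit_disc z ->
  mobius (- c) (mobius c z) = z.
Proof.
intros Hc Hz. pose proof (mobius_denominator c z Hc Hz) as Hn.
pose proof (mobius_denominator (- c) (mobius c z) (unit_disc_opp _ Hc)
  (unit_disc_mobius c z Hc Hz)) as Hn'.
assert (Hcc : (1 - Cconj c * c)%C <> 0%C) by now apply mobius_denominator.
assert (E : (1 - Cconj (- c) * mobius c z)%C
            = ((1 - Cconj c * c) / (1 - Cconj c * z))%C).
{ rewrite Cconj_opp. unfold mobius. field. exact Hn. }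
unfold mobius at 1. rewrite E. unfold mobius. field. split; [exact Hn|exact Hcc].
Qed.

Lemma cdiff_mobius (c z : C) : unit_disc c -> unit_disc z -> cdiff (mobius c) z.
Proof.
intros Hc Hz. apply cdiff_div.
- apply cdiff_minus; [apply cdiff_id|apply cdiff_const].
- apply cdiff_minus; [apply cdiff_const|].
  apply cdiff_mult; [apply cdiff_const|apply cdiff_id].
- now apply mobius_denominator.
Qed.

(** This lets the quotient of a bounded function by a Moebius factor inherit
    the bound, up to a factor as near to one as desired. *)
Lemma mobius_lower_bound (a : C) (e : R) : unit_disc a -> 0 < e ->
  exists r, 0 < r < 1 /\ forall z, Cmod z = r -> 1 - e <= Cmod (mobius a z).
Proof.
intros Ha He. pose proof (Cmod_ge_0 a) as H0. unfold unit_disc in Ha.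
set (m := Cmod a) in *.
(* [1 - |mobius a z|^2] is [(1 - m^2) (1 - r^2)] over a squared modulus that is
   at least [(1 - m)^2], hence at most [4 d / (1 - m)] for [r = 1 - d]. *)
set (d := Rmin (1 / 2) (e * (1 - m) / 4)).
assert (Hd : 0 < d).
{ apply Rmin_pos; [lra|]. assert (0 < e * (1 - m)) by nra. lra. }
assert (Hd2 : d <= 1 / 2) by apply Rmin_l.
assert (Hd3 : d <= e * (1 - m) / 4) by apply Rmin_r.
exists (1 - d). split; [lra|]. intros z Hz.
assert (Hzd : unit_disc z) by (unfold unit_disc; lra).
pose proof (Cmod_mobius a z Ha Hzd) as E.
pose proof (unit_disc_mobius a z Ha Hzd) as Hu. unfold unit_disc in Hu.
pose proof (Cmod_ge_0 (mobius a z)) as Hu0.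
assert (Hden : 1 - m <= Cmod (1 - Cconj a * z)%C).
{ pose proof (Cmod_triangle (1 - Cconj a * z) (Cconj a * z))%C as T.
  replace (1 - Cconj a * z + Cconj a * z)%C with (RtoC 1) in T by ring.
  rewrite Cmod_1, Cmod_mult, Cmod_conj, Hz in T. fold m in T. nra. }
fold m in E. rewrite Hz in E.
set (D := Cmod (1 - Cconj a * z)%C) in *.
assert (HB : (1 - m ^ 2) * (1 - (1 - d) ^ 2) / D ^ 2 <= e).
{ apply Rmult_le_reg_r with (D ^ 2); [apply pow_lt; lra|].
  unfold Rdiv. rewrite Rmult_assoc, Rinv_l by (apply pow_nonzero; lra).
  assert ((1 - m) ^ 2 <= D ^ 2) by (apply pow_incr; lra).
  assert ((1 - m ^ 2) * (1 - (1 - d) ^ 2) <= e * (1 - m) ^ 2).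
  { replace ((1 - m ^ 2) * (1 - (1 - d) ^ 2))
      with ((1 - m) * ((1 + m) * (d * (2 - d)))) by ring.
    replace (e * (1 - m) ^ 2) with ((1 - m) * (e * (1 - m))) by ring.
    apply Rmult_le_compat_l; [lra|].
    assert (d * (2 - d) <= 2 * d) by nra.
    assert ((1 + m) * (d * (2 - d)) <= 2 * (2 * d)).
    { apply Rmult_le_compat; nra. }
    lra. }
  nra. }
nra.
Qed.

Lemma pow_bounded_le_1 (a x : R) : 0 < a -> 0 <= x ->
  (forall n, a * x ^ n <= 1) -> x <= 1.
Proof.
intros Ha Hx H. apply Rnot_lt_le. intros Hlt.
destruct (Pow_x_infinity x) with (b := / a + 1) as [N HN].
- rewrite Rabs_pos_eq; lra.
- specialize (HN N (le_n _)). specialize (H N).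
  assert (P : 0 <= x ^ N) by now apply pow_le.
  rewrite Rabs_pos_eq in HN by assumption.
  assert (a * (/ a + 1) <= a * x ^ N) by (apply Rmult_le_compat_l; lra).
  rewrite Rmult_plus_distr_l, Rinv_r in H0 by lra. lra.
Qed.

Lemma cdiff_ext_loc (f g : C -> C) (z : C) :
  @locally C_UniformSpace z (fun w => f w = g w) -> cdiff f z -> cdiff g z.
Proof.
intros E (p & Hp & Ep). exists p. split; [exact Hp|].
pose proof (locally_singleton _ _ E) as Ez. simpl in Ez.
generalize (filter_and _ _ E Ep). apply filter_imp.
intros w [A B]. now rewrite <- A, <- Ez.
Qed.

(** Schwarz's lemma, with the roles of the centre and of the zero exchanged by a
    Moebius map.  The quotient [k] of [g] by the Moebius factor vanishing at [a] is
    continuous at [a], hence [g * k^n] is differentiable there, being a product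
    with a function that vanishes at [a].  Near the circle [k] is at most nearly
    one, so that [|g 0| (|g 0| / |a|)^n] is nearly bounded by one for all [n]. *)
Lemma value_at_0_le_zero (g : C -> C) (a : C) :
  (forall z, unit_disc z -> unit_disc (g z)) ->
  (forall z, unit_disc z -> cdiff g z) ->
  unit_disc a -> g a = 0%C -> Cmod (g 0) <= Cmod a.
Proof.
intros Hs Hd Ha Hga.
destruct (Ceq_dec a 0) as [->|Hna]; [rewrite Hga; lra|].
assert (Hma : 0 < Cmod a) by now apply Cmod_gt_0.
destruct (Req_dec (Cmod (g 0)) 0) as [E0|Hg0]; [lra|].
pose proof (Cmod_ge_0 (g 0)) as Hg0'.
destruct (Hd a Ha) as (p & Hp & Ep).
set (k := fun w => if Ceq_dec w a then (p a * (1 - Cconj a * a))%C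
                   else (g w * ((1 - Cconj a * w) / (w - a)))%C).
assert (Hka : ccontinuous k a).
{ assert (Hloc : @locally C_UniformSpace a (fun w => (p w * (1 - Cconj a * w))%C = k w)).
  { generalize Ep. apply filter_imp. intros w B. unfold k.
    destruct (Ceq_dec w a) as [->|n]; [reflexivity|].
    assert (Hn : (w - a)%C <> 0%C).
    { intros E. apply n. replace w with ((w - a) + a)%C by ring. rewrite E. ring. }
    rewrite Hga in B. replace (g w) with (g w - 0)%C by ring. rewrite B. field. exact Hn. }
  unfold continuous.
  replace (k a) with (p a * (1 - Cconj a * a))%C
    by (unfold k; destruct (Ceq_dec a a) as [_|n]; [reflexivity|now elim n]).
  eapply filterlim_ext_loc; [exact Hloc|].
  apply Clim_mult; [apply locally_filter|exact Hp|].
  apply Clim_minus; [apply locally_filter|apply Clim_const, locally_filter|].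
  apply Clim_mult; [apply locally_filter|apply Clim_const, locally_filter|].
  apply continuous_C_id. }
assert (Hkz : forall z, unit_disc z -> z <> a -> cdiff k z).
{ intros z Hz Hza.
  assert (Hn : (z - a)%C <> 0%C).
  { intros E. apply Hza. replace z with ((z - a) + a)%C by ring. rewrite E. ring. }
  apply (cdiff_ext_loc (fun w => g w * ((1 - Cconj a * w) / (w - a)))%C).
  - apply locally_Cmod. exists (Cmod (z - a)%C). split; [now apply Cmod_gt_0|].
    intros w Hw. unfold k. destruct (Ceq_dec w a) as [->|n]; [|reflexivity].
    rewrite <- Cmod_opp in Hw. replace (- (a - z))%C with (z - a)%C in Hw by ring. lra.
  - apply cdiff_mult; [now apply Hd|]. apply cdiff_div; [| |exact Hn].
    + apply cdiff_minus; [apply cdiff_const|].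
      apply cdiff_mult; [apply cdiff_const|apply cdiff_id].
    + apply cdiff_minus; [apply cdiff_id|apply cdiff_const]. }
assert (HG : forall n z, unit_disc z -> cdiff (fun w => g w * k w ^ n)%C z).
{ intros n z Hz. destruct (Ceq_dec z a) as [->|Hza].
  - apply cdiff_mult_zero; [now apply Hd|exact Hga|].
    apply Clim_pow; [apply locally_filter|exact Hka].
  - apply cdiff_mult; [now apply Hd|]. apply cdiff_pow. now apply Hkz. }
assert (Hk0 : Cmod (k 0%C) = Cmod (g 0) / Cmod a).
{ unfold k. destruct (Ceq_dec 0 a) as [E|_]; [now elim Hna|].
  replace ((1 - Cconj a * 0) / (0 - a))%C with (- / a)%C by (field; exact Hna).
  rewrite Cmod_mult, Cmod_opp, Cmod_inv by exact Hna. reflexivity. }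
assert (Hkey : forall e, 0 < e < 1 -> Cmod (g 0) * (1 - e) <= Cmod a).
{ intros e He. destruct (mobius_lower_bound a e Ha) as (r & Hr & Hlow); [lra|].
  assert (Hx : Cmod (g 0) * (1 - e) / Cmod a <= 1).
  { apply pow_bounded_le_1 with (a := Cmod (g 0)).
    - lra.
    - apply Rmult_le_pos; [nra|]. now apply Rlt_le, Rinv_0_lt_compat.
    - intros n. assert (Hin : 0 < / (1 - e)) by (apply Rinv_0_lt_compat; lra).
      assert (Hc : Cmod (g 0 * k 0%C ^ n)%C <= (/ (1 - e)) ^ n).
      { apply (Cmod_centre_le (fun w => g w * k w ^ n)%C r); [apply HG|exact Hr|].
        intros z Hz.
        assert (Hzd : unit_disc z) by (unfold unit_disc; lra).
        pose proof (Hlow z Hz) as Hl. pose proof (Hs z Hzd) as Hgz.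
        unfold unit_disc in Hgz.
        assert (Hza : z <> a).
        { intros ->. unfold mobius in Hl. replace (a - a)%C with (RtoC 0) in Hl by ring.
          unfold Cdiv in Hl. rewrite Cmult_0_l, Cmod_0 in Hl. lra. }
        assert (Hn : (z - a)%C <> 0%C).
        { intros E. apply Hza. replace z with ((z - a) + a)%C by ring. rewrite E. ring. }
        rewrite Cmod_mult, Cmod_pow.
        assert (Hk : Cmod (k z) <= / (1 - e)).
        { unfold k. destruct (Ceq_dec z a) as [E|_]; [now elim Hza|].
          replace ((1 - Cconj a * z) / (z - a))%C with (/ mobius a z)%C
            by (unfold mobius; field; split; [exact Hn|now apply mobius_denominator]).
          assert (Hm0 : mobius a z <> 0%C).
          { intros E. rewrite E, Cmod_0 in Hl. lra. }
          rewrite Cmod_mult, Cmod_inv by exact Hm0.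
          assert (/ Cmod (mobius a z) <= / (1 - e)) by (apply Rinv_le_contravar; lra).
          assert (0 < / Cmod (mobius a z)) by (apply Rinv_0_lt_compat; lra).
          pose proof (Cmod_ge_0 (g z)). nra. }
        assert (Hkn : Cmod (k z) ^ n <= (/ (1 - e)) ^ n)
          by (apply pow_incr; split; [apply Cmod_ge_0|exact Hk]).
        assert (0 <= Cmod (k z) ^ n) by (apply pow_le, Cmod_ge_0).
        pose proof (Cmod_ge_0 (g z)). nra. }
      rewrite Cmod_mult, Cmod_pow, Hk0 in Hc.
      replace (Cmod (g 0) * (1 - e) / Cmod a) with (Cmod (g 0) / Cmod a * (1 - e))
        by (field; lra).
      rewrite Rpow_mult_distr, <- Rmult_assoc.
      rewrite pow_inv in Hc by lra.
      assert (Pn : 0 < (1 - e) ^ n) by (apply pow_lt; lra).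
      apply Rmult_le_compat_r with (r := (1 - e) ^ n) in Hc; [|lra].
      rewrite Rinv_l in Hc by lra. exact Hc. }
  apply Rmult_le_compat_r with (r := Cmod a) in Hx; [|lra].
  unfold Rdiv in Hx. rewrite Rmult_assoc, Rinv_l in Hx by lra. lra. }
apply Rnot_lt_le. intros Hlt.
pose proof (Hs 0%C ltac:(unfold unit_disc; rewrite Cmod_0; lra)) as Hg1.
unfold unit_disc in Hg1.
specialize (Hkey ((Cmod (g 0) - Cmod a) / 2)). lazymatch type of Hkey with
  | ?A -> _ => assert (HA : A) by lra end.
specialize (Hkey HA). nra.
Qed.

(** Moebius maps on both sides move [a] to the centre and [f b] to zero. *)
Theorem Schwarz_Pick (f : C -> C) (a b : C) :
  holomorphic_self_map f -> unit_disc a -> unit_disc b ->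
  Cmod (mobius (f b) (f a)) <= Cmod (mobius a b).
Proof.
intros [Hs Hd] Ha Hb.
assert (Hd' : forall z, unit_disc z -> cdiff f z)
  by (intros z Hz; now apply cdiff_of_ex_derive, Hd).
pose proof (unit_disc_opp a Ha) as Ha'.
set (g := fun z => mobius (f b) (f (mobius (- a) z))).
assert (E0 : mobius (- a) 0 = a).
{ unfold mobius. field. }
replace (f a) with (f (mobius (- a) 0)) by now rewrite E0.
change (Cmod (g 0) <= Cmod (mobius a b)).
apply value_at_0_le_zero.
- intros z Hz. apply unit_disc_mobius; [now apply Hs|]. apply Hs.
  now apply unit_disc_mobius.
- intros z Hz. apply (cdiff_comp (mobius (f b)) (fun z => f (mobius (- a) z))).
  + apply (cdiff_comp f (mobius (- a))); [now apply cdiff_mobius|].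
    apply Hd'. now apply unit_disc_mobius.
  + apply cdiff_mobius; [now apply Hs|]. apply Hs. now apply unit_disc_mobius.
- now apply unit_disc_mobius.
- unfold g. rewrite mobius_opp_K by assumption. unfold mobius.
  replace (f b - f b)%C with (RtoC 0) by ring. unfold Cdiv. ring.
Qed.

(** * Geodesics of the disc *)

Lemma norm_C_R (z : C) : @norm R_AbsRing C_R_NormedModule z = Cmod z.
Proof.
change (sqrt (Rabs (fst z) ^ 2 + Rabs (snd z) ^ 2) = Cmod z).
now rewrite !pow2_abs.
Qed.

(** Caratheodory's form of the derivative, for curves. *)
Lemma is_derive_curve (sigma phi : R -> C) (t : R) :
  @continuous R_UniformSpace C_UniformSpace phi t ->
  locally t (fun s => (sigma s - sigma t = RtoC (s - t) * phi s)%C) ->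
  @is_derive R_AbsRing C_R_NormedModule sigma t (phi t).
Proof.
intros Hc Hl. split; [apply (is_linear_scal_l (V := C_R_NormedModule))|].
intros t' Ht' e.
assert (E : t = t').
{ apply (is_filter_lim_locally_unique (V := R_NormedModule)). exact Ht'. }
subst t'. clear Ht'.
pose proof (proj1 (filterlim_Cmod _ _ _) Hc e (cond_pos e)) as H.
generalize (filter_and _ _ H Hl). apply filter_imp. intros s [A B].
rewrite norm_C_R.
change (Cmod (sigma s - sigma t - (((s - t) * fst (phi t))%R, ((s - t) * snd (phi t))%R))%C
  <= e * Rabs (s - t)).
rewrite B.
replace (RtoC (s - t) * phi s - (((s - t) * fst (phi t))%R, ((s - t) * snd (phi t))%R))%C
  with (RtoC (s - t) * (phi s - phi t))%C
  by (apply injective_projections; simpl; ring).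
rewrite Cmod_mult, Cmod_R, Rmult_comm. apply Rmult_le_compat_r; [apply Rabs_pos|lra].
Qed.

Lemma is_derive_Re_Im (sigma : R -> C) (t : R) (d : C) :
  @is_derive R_AbsRing C_R_NormedModule sigma t d ->
  is_derive (fun s => Re (sigma s)) t (Re d) /\
  is_derive (fun s => Im (sigma s)) t (Im d).
Proof.
intros H. split.
- exact (filterdiff_comp (U := R_NormedModule) (V := C_R_NormedModule)
    (W := R_NormedModule) sigma (fun z => fst z) _ _ H
    (filterdiff_linear _ (is_linear_fst (U := R_NormedModule) (V := R_NormedModule)))).
- exact (filterdiff_comp (U := R_NormedModule) (V := C_R_NormedModule)
    (W := R_NormedModule) sigma (fun z => snd z) _ _ H
    (filterdiff_linear _ (is_linear_snd (U := R_NormedModule) (V := R_NormedModule)))).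
Qed.

Lemma velocity_eq (sigma : R -> C) (t : R) (d : C) :
  @is_derive R_AbsRing C_R_NormedModule sigma t d -> velocity sigma t = d.
Proof.
intros H. destruct (is_derive_Re_Im _ _ _ H) as [H1 H2].
unfold velocity. apply is_derive_unique in H1, H2.
apply injective_projections; simpl; assumption.
Qed.

Definition artanh (r : R) : R := ln ((1 + r) / (1 - r)) / 2.

Lemma is_derive_artanh (r : R) : -1 < r < 1 ->
  is_derive artanh r (/ (1 - r ^ 2)).
Proof.
intros Hr. unfold artanh. auto_derive.
- split; [lra|]. split; [|exact I]. apply Rdiv_lt_0_compat; lra.
- field. split; nra.
Qed.

(** The image of a radius under the Moebius map that takes [0] to [z]. *)
Definition geodesic (z v : C) (t : R) : C := mobius (- z) (RtoC t * v).

Section Geodesic.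
Variables z v : C.
Hypotheses (Hz : unit_disc z) (Hv : unit_disc v).

Definition geodesic_velocity (t : R) : C :=
  (RtoC (1 - Cmod z ^ 2) * v / (1 + Cconj z * (RtoC t * v)) ^ 2)%C.

Lemma geodesic_denominator (t : R) : Rabs t * Cmod v < 1 ->
  (1 + Cconj z * (RtoC t * v))%C <> 0%C.
Proof.
intros Ht.
assert (Ht' : unit_disc (RtoC t * v)) by (unfold unit_disc; now rewrite Cmod_mult, Cmod_R).
pose proof (mobius_denominator (- z) (RtoC t * v) (unit_disc_opp _ Hz) Ht') as Hn.
rewrite Cconj_opp in Hn.
now replace (1 - - Cconj z * (RtoC t * v))%C with (1 + Cconj z * (RtoC t * v))%C in Hn by ring.
Qed.

Lemma continuous_geodesic_denominator (t : R) :
  @continuous R_UniformSpace C_UniformSpace (fun s => 1 + Cconj z * (RtoC s * v))%C t.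
Proof.
apply Clim_plus; [apply locally_filter|apply Clim_const, locally_filter|].
apply Clim_mult; [apply locally_filter|apply Clim_const, locally_filter|].
apply Clim_mult; [apply locally_filter| |apply Clim_const, locally_filter].
apply filterlim_C_components; [apply locally_filter|]. split; simpl.
- apply filterlim_id.
- apply filterlim_const.
Qed.

Lemma continuous_geodesic_velocity (t : R) : Rabs t * Cmod v < 1 ->
  @continuous R_UniformSpace C_UniformSpace geodesic_velocity t.
Proof.
intros Ht. unfold continuous, geodesic_velocity.
apply Clim_div; [apply locally_filter|apply Clim_const, locally_filter| |].
- apply Clim_pow; [apply locally_filter|apply continuous_geodesic_denominator].
- apply Cpow_nz. now apply geodesic_denominator.
Qed.

Lemma is_derive_geodesic (t : R) : Rabs t * Cmod v < 1 ->
  @is_derive R_AbsRing C_R_NormedModule (geodesic z v) t (geodesic_velocity t).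
Proof.
intros Ht. pose proof (geodesic_denominator t Ht) as Hn.
set (phi := fun s : R => (RtoC (1 - Cmod z ^ 2) * v /
  ((1 + Cconj z * (RtoC s * v)) * (1 + Cconj z * (RtoC t * v))))%C).
replace (geodesic_velocity t) with (phi t)
  by (unfold phi, geodesic_velocity; field; exact Hn).
apply is_derive_curve.
- apply Clim_div; [apply locally_filter|apply Clim_const, locally_filter| |].
  + apply Clim_mult; [apply locally_filter|apply continuous_geodesic_denominator|].
    apply Clim_const, locally_filter.
  + now apply Cmult_neq_0.
- assert (Hc : filterlim (fun s => Rabs s * Cmod v) (locally t) (locally (Rabs t * Cmod v))).
  { apply Rlim_mult; [apply locally_filter| |apply Rlim_const, locally_filter].
    apply (continuous_Rabs t). }
  pose proof (Hc _ (open_lt 1 _ Ht)) as Hs. unfold filtermap in Hs.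
  revert Hs. apply filter_imp. intros s Hs.
  pose proof (geodesic_denominator s Hs) as Hn'.
  unfold geodesic, phi, mobius. rewrite Cconj_opp.
  rewrite !RtoC_minus, Cmod2_conj.
  replace (1 - - Cconj z * (RtoC s * v))%C with (1 + Cconj z * (RtoC s * v))%C by ring.
  replace (1 - - Cconj z * (RtoC t * v))%C with (1 + Cconj z * (RtoC t * v))%C by ring.
  field. split; assumption.
Qed.

(** Moebius maps are isometries for the hyperbolic metric, so the speed is that
    of the radius [t v]. *)
Lemma geodesic_speed (t : R) : Rabs t * Cmod v < 1 ->
  Cmod (geodesic_velocity t) / (1 - Cmod (geodesic z v t) ^ 2)
  = Cmod v / (1 - (t * Cmod v) ^ 2).
Proof.
intros Ht. pose proof (geodesic_denominator t Ht) as Hn.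
assert (Ht' : unit_disc (RtoC t * v)) by (unfold unit_disc; now rewrite Cmod_mult, Cmod_R).
unfold geodesic. rewrite Cmod_mobius by (try apply unit_disc_opp; assumption).
rewrite Cconj_opp, Cmod_opp, Cmod_mult, Cmod_R.
replace (1 - - Cconj z * (RtoC t * v))%C with (1 + Cconj z * (RtoC t * v))%C by ring.
unfold geodesic_velocity.
rewrite Cmod_div by (now apply Cpow_nz).
rewrite Cmod_mult, Cmod_R, Cmod_pow.
apply unit_disc_sqr in Hz.
rewrite (Rabs_pos_eq (1 - Cmod z ^ 2)) by lra.
assert (0 < Cmod (1 + Cconj z * (RtoC t * v))%C) by now apply Cmod_gt_0.
rewrite !Rpow_mult_distr, pow2_abs.
apply unit_disc_sqr in Ht'. rewrite Cmod_mult, Cmod_R, Rpow_mult_distr, pow2_abs in Ht'.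
field. repeat split; lra.
Qed.

Lemma hyp_length_geodesic :
  hyp_length_of_curve z (geodesic z v 1) (artanh (Cmod v)).
Proof.
pose proof (Cmod_ge_0 v) as Hv0. unfold unit_disc in Hv.
assert (Hin : forall t, 0 <= t <= 1 -> Rabs t * Cmod v < 1).
{ intros t Ht. rewrite Rabs_pos_eq by lra. nra. }
exists (geodesic z v), 0, 1. split; [|split; [|split; [|split]]].
- apply piecewise_C1_arc. split; [lra|]. split; [|exists geodesic_velocity; split].
  + intros t Ht. eapply filterlim_filter_le_1; [apply filter_le_within|].
    apply (@ex_derive_continuous R_AbsRing C_R_NormedModule).
    eexists. apply is_derive_geodesic. now apply Hin.
  + intros t Ht. eapply filterlim_filter_le_1; [apply filter_le_within|].
    apply continuous_geodesic_velocity. now apply Hin.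
  + intros t Ht. apply is_derive_geodesic, Hin. lra.
- intros t Ht. apply unit_disc_mobius; [now apply unit_disc_opp|].
  unfold unit_disc. rewrite Cmod_mult, Cmod_R. now apply Hin.
- unfold geodesic, mobius. field.
- reflexivity.
- apply is_RInt_ext with (fun t => Cmod v / (1 - (t * Cmod v) ^ 2)).
  { rewrite Rmin_left, Rmax_right by lra. intros t Ht.
    rewrite (velocity_eq _ _ (geodesic_velocity t)) by (apply is_derive_geodesic, Hin; lra).
    symmetry. apply geodesic_speed, Hin. lra. }
  replace (artanh (Cmod v)) with (artanh (1 * Cmod v) - artanh (0 * Cmod v)).
  + apply (is_RInt_derive (V := R_CompleteNormedModule) (fun t => artanh (t * Cmod v))).
    * rewrite Rmin_left, Rmax_right by lra. intros t Ht.
      assert (H1 : is_derive (fun s : R => s * Cmod v) t (Cmod v)) by (auto_derive; [exact I|ring]).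
      pose proof (is_derive_comp artanh (fun s => s * Cmod v) t _ _
        (is_derive_artanh (t * Cmod v) ltac:(specialize (Hin t Ht); rewrite Rabs_pos_eq in Hin by lra; nra)) H1) as H2.
      exact H2.
    * rewrite Rmin_left, Rmax_right by lra. intros t Ht.
      assert (Hne : 1 - (t * Cmod v) ^ 2 <> 0).
      { specialize (Hin t Ht). rewrite Rabs_pos_eq in Hin by lra.
        assert (0 <= t * Cmod v) by nra. intros E. nra. }
      apply (ex_derive_continuous (V := R_NormedModule)). auto_derive. simpl in Hne. exact Hne.
  + rewrite Rmult_1_l, Rmult_0_l. unfold artanh at 2.
    replace ((1 + 0) / (1 - 0)) with 1 by field. rewrite ln_1. unfold minus. simpl. field.
Qed.

End Geodesic.

(** * Lower bound for the length of a curve *)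

(** The Busemann function of the boundary point [zeta] (the logarithm of the
    Poisson kernel, up to a factor), in coordinates so that it can be
    differentiated along a curve. *)
Definition busemann (zeta w : C) : R :=
  / 2 * ln (((Re zeta - Re w) ^ 2 + (Im zeta - Im w) ^ 2)
            / (1 - (Re w ^ 2 + Im w ^ 2))).

Lemma busemann_Cmod (zeta w : C) :
  busemann zeta w = / 2 * ln (Cmod (zeta - w)%C ^ 2 / (1 - Cmod w ^ 2)).
Proof. unfold busemann. rewrite !Cmod2_alt. do 3 f_equal. Qed.

Lemma busemann_positive (zeta w : C) : Cmod zeta = 1 -> unit_disc w ->
  0 < (Re zeta - Re w) ^ 2 + (Im zeta - Im w) ^ 2 /\
  0 < 1 - (Re w ^ 2 + Im w ^ 2).
Proof.
intros H1 Hw. split.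
- assert (0 < Cmod (zeta - w)%C).
  { apply Cmod_gt_0. intros E. unfold unit_disc in Hw.
    replace w with (zeta - (zeta - w))%C in Hw by ring. rewrite E in Hw.
    replace (zeta - 0)%C with zeta in Hw by ring. lra. }
  pose proof (Cmod2_alt (zeta - w)%C) as E. simpl in E. unfold Re, Im, Rminus in *.
  simpl in *. nra.
- rewrite <- Cmod2_alt. now apply unit_disc_sqr.
Qed.

(** The differential of the Busemann function at [w], applied to [d]. *)
Definition busemann_diff (zeta w d : C) : R :=
  - ((Re zeta - Re w) * Re d + (Im zeta - Im w) * Im d)
    * / ((Re zeta - Re w) ^ 2 + (Im zeta - Im w) ^ 2)
  + (Re w * Re d + Im w * Im d) * / (1 - (Re w ^ 2 + Im w ^ 2)).

(** The gradient has Euclidean norm exactly [/ (1 - |w|^2)], so this is the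
    Cauchy-Schwarz inequality. *)
Lemma busemann_diff_le (zeta w d : C) : Cmod zeta = 1 -> unit_disc w ->
  busemann_diff zeta w d <= Cmod d / (1 - Cmod w ^ 2).
Proof.
intros H1 Hw. destruct (busemann_positive zeta w H1 Hw) as [HN HD].
assert (H1' : Re zeta ^ 2 + Im zeta ^ 2 = 1) by (rewrite <- Cmod2_alt, H1; ring).
rewrite Cmod2_alt.
pose proof (Cmod2_alt d) as Hd. pose proof (Cmod_ge_0 d) as Hd0.
unfold busemann_diff.
set (a := Re zeta - Re w) in *. set (b := Im zeta - Im w) in *.
set (x := Re w) in *. set (y := Im w) in *.
set (u := Re d) in *. set (v := Im d) in *. set (m := Cmod d) in *.
set (N := a ^ 2 + b ^ 2) in *. set (D := 1 - (x ^ 2 + y ^ 2)) in *.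
set (A := - a / N + x / D). set (B := - b / N + y / D).
replace (_ + _) with (A * u + B * v) by (unfold A, B; field; lra).
assert (HAB : A ^ 2 + B ^ 2 = / D ^ 2).
{ assert (Hxy : 2 * (a * x + b * y) = D - N).
  { unfold D, N, a, b. fold x y. nra. }
  unfold A, B.
  replace ((- a / N + x / D) ^ 2 + (- b / N + y / D) ^ 2)
    with (N / N ^ 2 - 2 * (a * x + b * y) / (N * D) + (1 - D) / D ^ 2)
    by (unfold D at 2, N at 1; field; split; lra).
  rewrite Hxy. field. split; lra. }
apply Rsqr_incr_0_var.
- rewrite !Rsqr_pow2.
  replace ((m / D) ^ 2) with (m ^ 2 * / D ^ 2) by (field; lra).
  rewrite <- HAB, Hd. pose proof (pow2_ge_0 (A * v - B * u)). nra.
- apply Rmult_le_pos; [exact Hd0|]. now apply Rlt_le, Rinv_0_lt_compat.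
Qed.

Lemma is_derive_busemann (zeta : C) (sigma : R -> C) (t : R) (d : C) :
  Cmod zeta = 1 -> unit_disc (sigma t) ->
  @is_derive R_AbsRing C_R_NormedModule sigma t d ->
  is_derive (fun s => busemann zeta (sigma s)) t (busemann_diff zeta (sigma t) d).
Proof.
intros H1 Hw Hd. destruct (busemann_positive zeta (sigma t) H1 Hw) as [HN HD].
destruct (is_derive_Re_Im _ _ _ Hd) as [Hx Hy].
assert (Key : forall (p q : R) (x y : R -> R) (dx dy : R),
  is_derive x t dx -> is_derive y t dy ->
  0 < (p - x t) ^ 2 + (q - y t) ^ 2 -> 0 < 1 - (x t ^ 2 + y t ^ 2) ->
  is_derive (fun s => / 2 * ln (((p - x s) ^ 2 + (q - y s) ^ 2) / (1 - (x s ^ 2 + y s ^ 2)))) t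
    (- ((p - x t) * dx + (q - y t) * dy) * / ((p - x t) ^ 2 + (q - y t) ^ 2)
     + (x t * dx + y t * dy) * / (1 - (x t ^ 2 + y t ^ 2)))).
{ intros p q x y dx dy Dx Dy N D. simpl in N, D. auto_derive.
  - repeat split; try (eexists; eassumption); try lra.
    apply Rdiv_lt_0_compat; lra.
  - change (Derive (fun s : R => x s) t) with (Derive x t).
    change (Derive (fun s : R => y s) t) with (Derive y t).
    rewrite (is_derive_unique _ _ _ Dx), (is_derive_unique _ _ _ Dy).
    field. repeat split; lra. }
exact (Key _ _ _ _ _ _ Hx Hy HN HD).
Qed.

Lemma filterlim_busemann {T : Type} (F : (T -> Prop) -> Prop) {FF : Filter F}
  (zeta w : C) (f : T -> C) : Cmod zeta = 1 -> unit_disc w ->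
  filterlim f F (@locally C_UniformSpace w) ->
  filterlim (fun t => busemann zeta (f t)) F (locally (busemann zeta w)).
Proof.
intros H1 Hw Hf. destruct (busemann_positive zeta w H1 Hw) as [HN HD].
apply filterlim_C_components in Hf; [|exact FF]. destruct Hf as [Hx Hy].
unfold busemann. apply Rlim_mult; [exact FF|apply Rlim_const, FF|].
apply (Rlim_continuous _ _ ln).
- apply Rlim_mult; [exact FF| |].
  + apply Rlim_plus; [exact FF| |]; apply Rlim_sqr, Rlim_minus;
      (assumption || apply Rlim_const, FF).
  + apply (Rlim_inv _ (fun t => 1 - (Re (f t) ^ 2 + Im (f t) ^ 2))); [|lra].
    apply Rlim_minus; [exact FF|apply Rlim_const, FF|].
    apply Rlim_plus; [exact FF| |]; now apply Rlim_sqr.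
- apply derivable_continuous_pt. eexists. apply derivable_pt_lim_ln.
  now apply Rdiv_lt_0_compat.
Qed.

Lemma continuous_busemann_diff (zeta : C) (sigma dsigma : R -> C) (t : R) :
  Cmod zeta = 1 -> unit_disc (sigma t) ->
  @continuous R_UniformSpace C_UniformSpace sigma t ->
  @continuous R_UniformSpace C_UniformSpace dsigma t ->
  continuous (fun s => busemann_diff zeta (sigma s) (dsigma s)) t.
Proof.
intros H1 Hw Hf Hg. destruct (busemann_positive zeta (sigma t) H1 Hw) as [HN HD].
apply filterlim_C_components in Hf; [|apply locally_filter]. destruct Hf as [Hx Hy].
apply filterlim_C_components in Hg; [|apply locally_filter]. destruct Hg as [Hu Hv].
unfold continuous, busemann_diff.
apply Rlim_plus; [apply locally_filter| |]; (apply Rlim_mult; [apply locally_filter| |]).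
- apply Rlim_opp.
  apply Rlim_plus; [apply locally_filter| |];
    (apply Rlim_mult; [apply locally_filter| |]); try apply Rlim_minus;
    (assumption || apply locally_filter || apply Rlim_const, locally_filter).
- apply (Rlim_inv _ (fun s => (Re zeta - Re (sigma s)) ^ 2 + (Im zeta - Im (sigma s)) ^ 2));
    [|lra].
  apply Rlim_plus; [apply locally_filter| |]; apply Rlim_sqr, Rlim_minus;
    (assumption || apply locally_filter || apply Rlim_const, locally_filter).
- apply Rlim_plus; [apply locally_filter| |];
    (apply Rlim_mult; [apply locally_filter| |]); assumption.
- apply (Rlim_inv _ (fun s => 1 - (Re (sigma s) ^ 2 + Im (sigma s) ^ 2))); [|lra].
  apply Rlim_minus; [apply locally_filter|apply Rlim_const, locally_filter|].
  apply Rlim_plus; [apply locally_filter| |]; now apply Rlim_sqr.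
Qed.

Lemma within_interior (a b t : R) (U : UniformSpace) (f : R -> U) :
  a < t < b ->
  filterlim f (within (fun s => a <= s <= b) (locally t)) (locally (f t)) ->
  continuous f t.
Proof.
intros Ht H P HP. specialize (H P HP). unfold filtermap, within in *.
assert (Hi : locally t (fun s => a < s /\ s < b)).
{ apply filter_and; [now apply open_gt|now apply open_lt]. }
generalize (filter_and _ _ H Hi). apply filter_imp. intros s [A B]. apply A. lra.
Qed.

(** A curve of class C1 on the open interval need not be differentiable at the
    end points; continuity there is enough to pass to the closed interval. *)
Lemma increment_le_of_interior (B : R -> R) (a b l : R) : a < b ->
  (forall t, a <= t <= b ->
     filterlim B (within (fun s => a <= s <= b) (locally t)) (locally (B t))) ->
  (forall a' b', a < a' -> a' < b' -> b' < b -> B b' - B a' <= l) ->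
  B b - B a <= l.
Proof.
intros Hab Hc H. apply Rnot_lt_le. intros Hlt.
set (e := (B b - B a - l) / 2). assert (He : 0 < e) by (unfold e; lra).
assert (Near : forall t, a <= t <= b -> exists d, 0 < d /\
  forall s, a <= s <= b -> Rabs (s - t) < d -> Rabs (B s - B t) < e).
{ intros t Ht. specialize (Hc t Ht (ball (B t) (mkposreal e He)) (locally_ball _ _)).
  destruct Hc as [d Hd]. exists d. split; [apply cond_pos|].
  intros s Hs Hst. exact (Hd s Hst Hs). }
destruct (Near a) as (d1 & Hd1 & N1); [lra|].
destruct (Near b) as (d2 & Hd2 & N2); [lra|].
set (h := Rmin (Rmin d1 d2) (b - a) / 3).
assert (Hm : 0 < Rmin (Rmin d1 d2) (b - a)) by (repeat apply Rmin_pos; lra).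
pose proof (Rmin_l (Rmin d1 d2) (b - a)). pose proof (Rmin_r (Rmin d1 d2) (b - a)).
pose proof (Rmin_l d1 d2). pose proof (Rmin_r d1 d2).
specialize (N1 (a + h)). specialize (N2 (b - h)).
assert (Hh : 0 < h /\ h < d1 /\ h < d2 /\ 3 * h <= b - a) by (unfold h; lra).
assert (N1' : Rabs (B (a + h) - B a) < e).
{ apply N1; [lra|]. replace (a + h - a) with h by ring. rewrite Rabs_pos_eq; lra. }
assert (N2' : Rabs (B (b - h) - B b) < e).
{ apply N2; [lra|]. replace (b - h - b) with (- h) by ring.
  rewrite Rabs_Ropp, Rabs_pos_eq; lra. }
apply Rabs_lt_between in N1'. apply Rabs_lt_between in N2'.
assert (B (b - h) - B (a + h) <= l) by (apply H; lra).
unfold e in *. lra.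
Qed.

Definition hyp_speed (sigma : R -> C) (t : R) : R :=
  Cmod (velocity sigma t) / (1 - Cmod (sigma t) ^ 2).

Lemma hyp_speed_ge_0 (sigma : R -> C) (t : R) :
  unit_disc (sigma t) -> 0 <= hyp_speed sigma t.
Proof.
intros H. apply Rmult_le_pos; [apply Cmod_ge_0|].
apply Rlt_le, Rinv_0_lt_compat. now apply unit_disc_sqr.
Qed.

(** Along an arc a Busemann function grows at most at the hyperbolic speed.  The
    inequality is integrated over inner subintervals, whose length is at most
    [l] since the speed is nonnegative. *)
Lemma busemann_arc (zeta : C) (sigma : R -> C) (a b l : R) :
  Cmod zeta = 1 -> C1_arc sigma a b ->
  (forall t, a <= t <= b -> unit_disc (sigma t)) ->
  is_RInt (hyp_speed sigma) a b l ->
  busemann zeta (sigma b) - busemann zeta (sigma a) <= l.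
Proof.
intros H1 (Hab & Hc & ds & Hds & Hder) Hu Hl.
apply (increment_le_of_interior (fun t => busemann zeta (sigma t))); [exact Hab| |].
- intros t Ht. apply filterlim_busemann; [apply within_filter, locally_filter|exact H1|now apply Hu|now apply Hc].
- intros a' b' Ha Hab' Hb.
  assert (Ex : ex_RInt (hyp_speed sigma) a b) by now exists l.
  assert (E1 : ex_RInt (hyp_speed sigma) a b')
    by (apply (ex_RInt_Chasles_1 (V := R_CompleteNormedModule)) with b; [lra|exact Ex]).
  assert (E2 : ex_RInt (hyp_speed sigma) b' b)
    by (apply (ex_RInt_Chasles_2 (V := R_CompleteNormedModule)) with a; [lra|exact Ex]).
  assert (E3 : ex_RInt (hyp_speed sigma) a a')
    by (apply (ex_RInt_Chasles_1 (V := R_CompleteNormedModule)) with b'; [lra|exact E1]).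
  assert (E4 : ex_RInt (hyp_speed sigma) a' b')
    by (apply (ex_RInt_Chasles_2 (V := R_CompleteNormedModule)) with a; [lra|exact E1]).
  apply (is_RInt_unique (V := R_CompleteNormedModule)) in Hl.
  rewrite (RInt_Chasles_R _ a b' b), (RInt_Chasles_R _ a a' b') in Hl by assumption.
  assert (P1 : 0 <= RInt (hyp_speed sigma) a a').
  { apply RInt_ge_0; [lra|exact E3|]. intros t Ht. apply hyp_speed_ge_0, Hu. lra. }
  assert (P2 : 0 <= RInt (hyp_speed sigma) b' b).
  { apply RInt_ge_0; [lra|exact E2|]. intros t Ht. apply hyp_speed_ge_0, Hu. lra. }
  assert (P3 : busemann zeta (sigma b') - busemann zeta (sigma a')
               <= RInt (hyp_speed sigma) a' b').
  { apply (is_RInt_le (fun t => busemann_diff zeta (sigma t) (ds t)) (hyp_speed sigma) a' b');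
      [lra| |now apply (RInt_correct (V := R_CompleteNormedModule))|].
    - apply (is_RInt_derive (V := R_CompleteNormedModule) (fun t => busemann zeta (sigma t)));
        rewrite Rmin_left, Rmax_right by lra; intros t Ht.
      + apply is_derive_busemann; [exact H1|apply Hu; lra|apply Hder; lra].
      + apply continuous_busemann_diff; [exact H1|apply Hu; lra| |];
          (apply (within_interior a b); [lra|]); [apply Hc|apply Hds]; lra.
    - intros t Ht. unfold hyp_speed. rewrite (velocity_eq _ _ (ds t)) by (apply Hder; lra).
      apply busemann_diff_le; [exact H1|apply Hu; lra]. }
  lra.
Qed.

Lemma piecewise_C1_lt (sigma : R -> C) (a b : R) : piecewise_C1 sigma a b -> a < b.
Proof.
induction 1 as [a b H|a b c H _ IH].
- exact (proj1 H).
- pose proof (proj1 H). lra.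
Qed.

Lemma busemann_curve (zeta : C) (sigma : R -> C) (a b l : R) :
  Cmod zeta = 1 -> piecewise_C1 sigma a b ->
  (forall t, a <= t <= b -> unit_disc (sigma t)) ->
  is_RInt (hyp_speed sigma) a b l ->
  busemann zeta (sigma b) - busemann zeta (sigma a) <= l.
Proof.
intros H1 Hp. revert l. induction Hp as [a b H|a b c H Hp IH]; intros l Hu Hl.
- exact (busemann_arc zeta sigma a b l H1 H Hu Hl).
- pose proof (proj1 H) as Hab. pose proof (piecewise_C1_lt _ _ _ Hp) as Hbc.
  assert (Ex : ex_RInt (hyp_speed sigma) a c) by now exists l.
  assert (E1 : ex_RInt (hyp_speed sigma) a b)
    by (apply (ex_RInt_Chasles_1 (V := R_CompleteNormedModule)) with c; [lra|exact Ex]).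
  assert (E2 : ex_RInt (hyp_speed sigma) b c)
    by (apply (ex_RInt_Chasles_2 (V := R_CompleteNormedModule)) with a; [lra|exact Ex]).
  apply (is_RInt_unique (V := R_CompleteNormedModule)) in Hl.
  rewrite (RInt_Chasles_R _ a b c) in Hl by assumption.
  assert (B1 : busemann zeta (sigma b) - busemann zeta (sigma a)
               <= RInt (hyp_speed sigma) a b).
  { apply busemann_arc; [exact H1|exact H|intros t Ht; apply Hu; lra|].
    now apply (RInt_correct (V := R_CompleteNormedModule)). }
  assert (B2 : busemann zeta (sigma c) - busemann zeta (sigma b)
               <= RInt (hyp_speed sigma) b c).
  { apply IH; [intros t Ht; apply Hu; lra|].
    now apply (RInt_correct (V := R_CompleteNormedModule)). }
  lra.
Qed.

(** The lower bound is attained: the end point [zeta] of the geodesic behind [z]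
    recedes at unit speed. *)
Lemma busemann_geodesic (z u : C) (r : R) :
  unit_disc z -> Cmod u = 1 -> 0 <= r < 1 ->
  exists zeta, Cmod zeta = 1 /\
  busemann zeta (mobius (- z) (RtoC r * u)) - busemann zeta z = artanh r.
Proof.
intros Hz Hu Hr.
assert (Hden : forall s, Rabs s <= 1 -> (1 + Cconj z * (RtoC s * u))%C <> 0%C).
{ intros s Hs E.
  assert (E1 : (Cconj z * (RtoC s * u))%C = (- (1))%C).
  { replace (Cconj z * (RtoC s * u))%C with ((1 + Cconj z * (RtoC s * u)) - 1)%C by ring.
    rewrite E. ring. }
  apply (f_equal Cmod) in E1. rewrite Cmod_m1, !Cmod_mult, Cmod_conj, Cmod_R, Hu in E1.
  unfold unit_disc in Hz. pose proof (Cmod_ge_0 z). pose proof (Rabs_pos s). nra. }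
pose proof (Hden r ltac:(rewrite Rabs_pos_eq; lra)) as Hn1.
pose proof (Hden (-1) ltac:(rewrite Rabs_left; lra)) as Hn2.
set (w := mobius (- z) (RtoC r * u)).
set (zeta := mobius (- z) (- u)).
assert (Hv : unit_disc (RtoC r * u)).
{ unfold unit_disc. rewrite Cmod_mult, Hu, Cmod_R, Rabs_pos_eq; lra. }
assert (Hn2' : (1 - Cconj z * u)%C <> 0%C).
{ intros E. apply Hn2. rewrite <- E. apply injective_projections; simpl; ring. }
assert (Hm1 : 0 < Cmod (1 + Cconj z * (RtoC r * u))%C) by now apply Cmod_gt_0.
assert (Hm2 : 0 < Cmod (1 - Cconj z * u)%C) by now apply Cmod_gt_0.
assert (Hzz := proj1 (unit_disc_sqr z) Hz).
assert (Hzeta : Cmod zeta = 1).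
{ unfold zeta, mobius. rewrite Cconj_opp.
  replace (1 - - Cconj z * - u)%C with (1 - Cconj z * u)%C by ring.
  rewrite Cmod_div by exact Hn2'.
  pose proof (mobius_identity z u) as I. rewrite Hu in I.
  replace (- u - - z)%C with (- (u - z))%C by ring. rewrite Cmod_opp.
  pose proof (Cmod_ge_0 (u - z)%C).
  assert (E : Cmod (u - z)%C = Cmod (1 - Cconj z * u)%C) by nra.
  rewrite E. field. lra. }
exists zeta. split; [exact Hzeta|].
assert (Hw : unit_disc w) by (apply unit_disc_mobius; [now apply unit_disc_opp|exact Hv]).
assert (Eu : Cmod (RtoC r * u)%C = r) by (rewrite Cmod_mult, Hu, Cmod_R, Rabs_pos_eq; lra).
assert (K : (RtoC (1 - Cmod z ^ 2) = 1 - z * Cconj z)%C).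
{ now rewrite RtoC_minus, Cmod2_conj. }
assert (Dz : Cmod (zeta - z)%C = (1 - Cmod z ^ 2) / Cmod (1 - Cconj z * u)%C).
{ replace (zeta - z)%C with (RtoC (1 - Cmod z ^ 2) * (- u) / (1 - Cconj z * u))%C.
  - rewrite Cmod_div by exact Hn2'. rewrite Cmod_mult, Cmod_opp, Hu, Cmod_R, Rabs_pos_eq by lra.
    field. lra.
  - rewrite K. unfold zeta, mobius. rewrite Cconj_opp.
    replace (1 - - Cconj z * - u)%C with (1 - Cconj z * u)%C by ring.
    field. exact Hn2'. }
assert (Dw : Cmod (zeta - w)%C = (1 + r) * (1 - Cmod z ^ 2)
  / (Cmod (1 - Cconj z * u)%C * Cmod (1 + Cconj z * (RtoC r * u))%C)).
{ replace (zeta - w)%C with (RtoC (1 - Cmod z ^ 2) * (RtoC (1 + r) * (- u))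
     / ((1 - Cconj z * u) * (1 + Cconj z * (RtoC r * u))))%C.
  - rewrite Cmod_div by now apply Cmult_neq_0.
    rewrite !Cmod_mult, Cmod_opp, Hu, !Cmod_R, !Rabs_pos_eq by lra. field. lra.
  - rewrite K, RtoC_plus. unfold zeta, w, mobius. rewrite Cconj_opp.
    replace (1 - - Cconj z * - u)%C with (1 - Cconj z * u)%C by ring.
    replace (1 - - Cconj z * (RtoC r * u))%C with (1 + Cconj z * (RtoC r * u))%C by ring.
    field. auto. }
assert (Dw2 : 1 - Cmod w ^ 2 = (1 - Cmod z ^ 2) * (1 - r ^ 2)
  / Cmod (1 + Cconj z * (RtoC r * u))%C ^ 2).
{ unfold w. rewrite Cmod_mobius by (try apply unit_disc_opp; assumption).
  rewrite Eu, Cmod_opp, Cconj_opp.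
  now replace (1 - - Cconj z * (RtoC r * u))%C with (1 + Cconj z * (RtoC r * u))%C by ring. }
rewrite !busemann_Cmod, Dw, Dw2, Dz. unfold artanh.
set (A := Cmod (1 - Cconj z * u)%C) in *.
set (B := Cmod (1 + Cconj z * (RtoC r * u))%C) in *.
set (m := 1 - Cmod z ^ 2) in *.
replace (((1 + r) * m / (A * B)) ^ 2 / (m * (1 - r ^ 2) / B ^ 2))
  with ((1 + r) / (1 - r) * ((m / A) ^ 2 / m)) by (field; repeat split; nra).
rewrite ln_mult.
- field.
- apply Rdiv_lt_0_compat; lra.
- apply Rdiv_lt_0_compat; [|lra]. apply pow_lt. now apply Rdiv_lt_0_compat.
Qed.

(** * The hyperbolic distance in closed form *)

(** The infimum is a minimum, attained by the geodesic; every other curve is at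
    least as long by the growth of one Busemann function. *)
Theorem hyp_dist_eq (z w : C) : unit_disc z -> unit_disc w ->
  hyp_dist z w = artanh (Cmod (mobius z w)).
Proof.
intros Hz Hw.
assert (Hv := unit_disc_mobius z w Hz Hw).
pose proof (mobius_opp_K z w Hz Hw) as EK.
set (v := mobius z w) in *.
assert (Hg : is_glb_Rbar (hyp_length_of_curve z w) (Finite (artanh (Cmod v)))).
{ split.
  - intros l (sigma & a & b & Hp & Hu & Ha & Hb & Hl). simpl.
    assert (Hpol : exists u, Cmod u = 1 /\ v = (RtoC (Cmod v) * u)%C).
    { destruct (Ceq_dec v 0) as [->|Hn].
      - exists 1%C. rewrite Cmod_0, Cmod_1. split; [reflexivity|ring].
      - assert (Hm : 0 < Cmod v) by now apply Cmod_gt_0.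
        assert (Hmn : RtoC (Cmod v) <> 0%C) by (intros E; injection E; lra).
        exists (v / RtoC (Cmod v))%C. split; [|field; exact Hmn].
        rewrite Cmod_div by exact Hmn. rewrite Cmod_R, Rabs_pos_eq by lra. field. lra. }
    destruct Hpol as (u & Hu1 & Ev).
    destruct (busemann_geodesic z u (Cmod v) Hz Hu1) as (zeta & Hz1 & E).
    { split; [apply Cmod_ge_0|exact Hv]. }
    rewrite <- Ev, EK, <- Ha, <- Hb in E. rewrite <- E.
    exact (busemann_curve zeta sigma a b l Hz1 Hp Hu Hl).
  - intros m Hm. apply Hm.
    replace w with (geodesic z v 1) by (unfold geodesic; now rewrite Cmult_1_l).
    apply hyp_length_geodesic; assumption. }
unfold hyp_dist. now rewrite (is_glb_Rbar_unique _ _ Hg).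
Qed.

(** * The half-plane model *)

Lemma unimodular_conj (tau : C) : Cmod tau = 1 -> (tau * Cconj tau)%C = 1%C.
Proof. intros H. rewrite <- Cmod2_conj, H. f_equal. ring. Qed.

(** It maps the disc onto the right half-plane and [tau] to infinity. *)
Definition cayley (tau z : C) : C := ((1 + Cconj tau * z) / (1 - Cconj tau * z))%C.

(** The square of the hyperbolic cosine of the distance between two points of
    the right half-plane. *)
Definition half_plane_cosh2 (Z W : C) : R :=
  Cmod (Z + Cconj W)%C ^ 2 / (4 * Re Z * Re W).

Lemma Cmod_plus_conj_pos (Z W : C) : 0 < Re Z -> 0 < Re W ->
  0 < Cmod (Z + Cconj W)%C.
Proof.
intros HZ HW. pose proof (Re_le_Cmod (Z + Cconj W)%C) as B.
unfold Re in *. simpl in B. lra.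
Qed.

Lemma cayley_denominator (tau z : C) : Cmod tau = 1 -> unit_disc z ->
  (1 - Cconj tau * z)%C <> 0%C.
Proof.
intros Ht Hz E.
assert (E1 : (Cconj tau * z)%C = 1%C).
{ replace (Cconj tau * z)%C with (1 - (1 - Cconj tau * z))%C by ring. rewrite E. ring. }
apply (f_equal Cmod) in E1. rewrite Cmod_mult, Cmod_conj, Ht, Cmod_1 in E1.
unfold unit_disc in Hz. lra.
Qed.

Lemma Re_cayley (tau z : C) : Cmod tau = 1 -> unit_disc z ->
  Re (cayley tau z) = (1 - Cmod z ^ 2) / Cmod (1 - Cconj tau * z)%C ^ 2.
Proof.
intros Ht Hz. pose proof (cayley_denominator tau z Ht Hz) as Hn.
assert (Hp : 0 < Cmod (1 - Cconj tau * z)%C) by now apply Cmod_gt_0.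
assert (Hp2 : 0 < Cmod (1 - Cconj tau * z)%C ^ 2) by now apply pow_lt.
assert (Ht2 : Re tau ^ 2 + Im tau ^ 2 = 1) by (rewrite <- Cmod2_alt, Ht; ring).
rewrite Cmod2_alt in Hp2. rewrite !Cmod2_alt.
unfold cayley. destruct tau as [p q], z as [x y].
unfold Re, Im in *. simpl in *. field_simplify_eq; [|lra].
replace (q ^ 2) with (1 - p ^ 2) by lra.
ring_simplify. nra.
Qed.

Lemma Re_cayley_pos (tau z : C) : Cmod tau = 1 -> unit_disc z ->
  0 < Re (cayley tau z).
Proof.
intros Ht Hz. rewrite Re_cayley by assumption. apply Rdiv_lt_0_compat.
- now apply unit_disc_sqr.
- apply pow_lt, Cmod_gt_0. now apply cayley_denominator.
Qed.

Lemma half_plane_cosh2_cayley (tau z w : C) :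
  Cmod tau = 1 -> unit_disc z -> unit_disc w ->
  half_plane_cosh2 (cayley tau z) (cayley tau w) = / (1 - Cmod (mobius z w) ^ 2).
Proof.
intros Ht Hz Hw.
pose proof (cayley_denominator tau z Ht Hz) as Nz.
pose proof (cayley_denominator tau w Ht Hw) as Nw.
pose proof (mobius_denominator z w Hz Hw) as Nzw.
assert (Nw' : (1 - tau * Cconj w)%C <> 0%C).
{ intros E. apply Nw. apply (f_equal Cconj) in E.
  rewrite Cminus_conj, Cmult_conj, Cconj_conj in E.
  apply injective_projections; [apply (f_equal fst) in E|apply (f_equal snd) in E];
  simpl in *; lra. }
assert (Mz : 0 < Cmod (1 - Cconj tau * z)%C) by now apply Cmod_gt_0.
assert (Mw : 0 < Cmod (1 - Cconj tau * w)%C) by now apply Cmod_gt_0.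
assert (Mzw : 0 < Cmod (1 - Cconj z * w)%C) by now apply Cmod_gt_0.
assert (E : Cmod (cayley tau z + Cconj (cayley tau w))%C
  = 2 * Cmod (1 - Cconj z * w)%C / (Cmod (1 - Cconj tau * z)%C * Cmod (1 - Cconj tau * w)%C)).
{ assert (Ec : Cconj (cayley tau w) = ((1 + tau * Cconj w) / (1 - tau * Cconj w))%C).
  { unfold cayley, Cdiv. rewrite Cmult_conj, Cplus_conj, Cmult_conj, Cconj_conj.
    rewrite Cinv_conj by assumption.
    rewrite Cminus_conj, Cmult_conj, Cconj_conj.
    replace (Cconj 1) with (RtoC 1) by (apply injective_projections; simpl; ring).
    reflexivity. }
  assert (M1 : Cmod (1 - tau * Cconj w)%C = Cmod (1 - Cconj tau * w)%C).
  { rewrite <- Cmod_conj. f_equal. apply injective_projections; simpl; ring. }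
  assert (M2 : Cmod (1 - z * Cconj w)%C = Cmod (1 - Cconj z * w)%C).
  { rewrite <- Cmod_conj. f_equal. apply injective_projections; simpl; ring. }
  rewrite Ec, <- M1, <- M2.
  replace (cayley tau z + (1 + tau * Cconj w) / (1 - tau * Cconj w))%C
    with (RtoC 2 * (1 - z * Cconj w) / ((1 - Cconj tau * z) * (1 - tau * Cconj w)))%C.
  - rewrite Cmod_div by now apply Cmult_neq_0.
    rewrite !Cmod_mult, Cmod_R, Rabs_pos_eq by lra. reflexivity.
  - unfold cayley.
    replace (RtoC 2 * (1 - z * Cconj w))%C
      with (2 - 2 * ((tau * Cconj tau) * (z * Cconj w)))%C
      by (rewrite unimodular_conj by assumption; ring).
    field. split; assumption. }
unfold half_plane_cosh2. rewrite E, !Re_cayley, Cmod_mobius by assumption.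
apply unit_disc_sqr in Hz, Hw. field. repeat split; lra.
Qed.

Lemma artanh_lt (r s : R) : 0 <= r -> r < s -> s < 1 -> artanh r < artanh s.
Proof.
intros H0 H1 H2. unfold artanh. apply Rmult_lt_compat_r; [lra|].
apply ln_increasing; [apply Rdiv_lt_0_compat; lra|].
apply Rmult_lt_reg_r with ((1 - r) * (1 - s)); [nra|].
replace ((1 + r) / (1 - r) * ((1 - r) * (1 - s))) with ((1 + r) * (1 - s)) by (field; lra).
replace ((1 + s) / (1 - s) * ((1 - r) * (1 - s))) with ((1 + s) * (1 - r)) by (field; lra).
nra.
Qed.

(** All comparisons of distances are made through this rational function of
    the coordinates; [artanh] and the infimum of lengths no longer appear. *)
Lemma hyp_dist_lt_of_cosh2 (tau z w z' w' : C) : Cmod tau = 1 ->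
  unit_disc z -> unit_disc w -> unit_disc z' -> unit_disc w' ->
  half_plane_cosh2 (cayley tau z) (cayley tau w)
    < half_plane_cosh2 (cayley tau z') (cayley tau w') ->
  hyp_dist z w < hyp_dist z' w'.
Proof.
intros Ht Hz Hw Hz' Hw'. rewrite !half_plane_cosh2_cayley, !hyp_dist_eq by assumption.
pose proof (unit_disc_mobius z w Hz Hw) as U.
pose proof (unit_disc_mobius z' w' Hz' Hw') as U'.
pose proof (Cmod_ge_0 (mobius z w)). pose proof (Cmod_ge_0 (mobius z' w')).
intros HQ. apply artanh_lt; [assumption| |exact U'].
apply unit_disc_sqr in U, U'.
apply Rnot_le_lt. intros Hle. apply (Rlt_irrefl (/ (1 - Cmod (mobius z w) ^ 2))).
eapply Rlt_le_trans; [exact HQ|]. apply Rinv_le_contravar; [exact U|nra].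
Qed.

Lemma Cmod_mobius_sym (a b : C) : unit_disc a -> unit_disc b ->
  Cmod (mobius a b) = Cmod (mobius b a).
Proof.
intros Ha Hb. unfold mobius. rewrite !Cmod_div by now apply mobius_denominator.
f_equal; [rewrite <- Cmod_opp|rewrite <- Cmod_conj]; f_equal;
  apply injective_projections; simpl; ring.
Qed.

(** The Schwarz-Pick lemma in the half-plane. *)
Lemma half_plane_cosh2_contraction (tau : C) (f : C -> C) (z w : C) : Cmod tau = 1 ->
  holomorphic_self_map f -> unit_disc z -> unit_disc w ->
  half_plane_cosh2 (cayley tau (f z)) (cayley tau (f w))
    <= half_plane_cosh2 (cayley tau z) (cayley tau w).
Proof.
intros Ht Hf Hz Hw. pose proof (proj1 Hf) as Hs.
rewrite !half_plane_cosh2_cayley by auto.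
pose proof (Schwarz_Pick f w z Hf Hw Hz) as SP.
rewrite (Cmod_mobius_sym w z Hw Hz) in SP.
pose proof (unit_disc_mobius (f z) (f w) (Hs z Hz) (Hs w Hw)) as U.
pose proof (unit_disc_mobius z w Hz Hw) as U'.
pose proof (Cmod_ge_0 (mobius (f z) (f w))).
apply unit_disc_sqr in U'. apply Rinv_le_contravar; [exact U'|]. nra.
Qed.

(** In the half-plane picture the difference quotient of [f] at [tau] is the
    inverse growth rate at infinity. *)
Lemma angular_quotient (tau z w : C) : Cmod tau = 1 -> unit_disc z -> unit_disc w ->
  ((w - tau) / (z - tau))%C = ((cayley tau z + 1) / (cayley tau w + 1))%C.
Proof.
intros Ht Hz Hw.
pose proof (cayley_denominator tau z Ht Hz) as Nz.
pose proof (cayley_denominator tau w Ht Hw) as Nw.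
assert (Nt : tau <> 0%C).
{ intros E. rewrite E, Cmod_0 in Ht. lra. }
assert (N2 : RtoC 2 <> 0%C) by (intros E; injection E; lra).
assert (P : forall u, (1 - Cconj tau * u)%C <> 0%C ->
  (cayley tau u + 1)%C = (2 / (1 - Cconj tau * u))%C).
{ intros u Nu. unfold cayley. field. exact Nu. }
rewrite !P by assumption.
assert (K : forall u, (u - tau)%C = (- tau * (1 - Cconj tau * u))%C).
{ intros u. replace (- tau * (1 - Cconj tau * u))%C
    with ((tau * Cconj tau) * u - tau)%C by ring.
  rewrite unimodular_conj by assumption. ring. }
rewrite (K w), (K z). field. repeat split; assumption.
Qed.

Lemma Cmod_minus_tau (tau z : C) : Cmod tau = 1 -> unit_disc z ->
  Cmod (z - tau)%C = 2 / Cmod (cayley tau z + 1)%C.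
Proof.
intros Ht Hz. pose proof (cayley_denominator tau z Ht Hz) as Nz.
assert (Mz : 0 < Cmod (1 - Cconj tau * z)%C) by now apply Cmod_gt_0.
replace (cayley tau z + 1)%C with (RtoC 2 / (1 - Cconj tau * z))%C
  by (unfold cayley; field; exact Nz).
rewrite Cmod_div, Cmod_R, Rabs_pos_eq by (try assumption; lra).
replace (z - tau)%C with (- tau * (1 - Cconj tau * z))%C.
- rewrite Cmod_mult, Cmod_opp, Ht. field. lra.
- replace (- tau * (1 - Cconj tau * z))%C
    with ((tau * Cconj tau) * z - tau)%C by ring.
  rewrite unimodular_conj by assumption. ring.
Qed.

(** * Julia's lemma *)

(** The image under the Cayley transform of the point [radial_point k] below. *)
Definition radial_height (k : nat) : R := 2 * INR k + 3.

Lemma radial_height_infty :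
  filterlim radial_height eventually (Rbar_locally p_infty).
Proof.
unfold radial_height.
replace p_infty with (Rbar_plus (Rbar_mult 2 p_infty) 3).
-
  apply (is_lim_seq_plus (fun k => 2 * INR k) (fun _ => 3) (Rbar_mult 2 p_infty) 3).
  + apply is_lim_seq_scal_l, is_lim_seq_INR.
  + apply is_lim_seq_const.
  + simpl. destruct Rle_dec; [|lra]. destruct Rle_lt_or_eq_dec; [|lra]. reflexivity.
- simpl. destruct Rle_dec; [|lra]. destruct Rle_lt_or_eq_dec; [|lra]. reflexivity.
Qed.

Section Julia.
Variables (f : C -> C) (tau : C) (alpha : R).
Hypotheses (Hf : holomorphic_self_map f) (Ht : Cmod tau = 1)
  (Ha : angular_derivative f tau (RtoC alpha)).

Definition radial_point (k : nat) : C := (RtoC ((INR k + 1) / (INR k + 2)) * tau)%C.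

Lemma radial_point_spec (k : nat) :
  unit_disc (radial_point k) /\ cayley tau (radial_point k) = RtoC (radial_height k).
Proof.
pose proof (pos_INR k) as Hk.
assert (Hr : 0 < (INR k + 1) / (INR k + 2) < 1).
{ split; [apply Rdiv_lt_0_compat; lra|].
  apply Rmult_lt_reg_r with (INR k + 2); [lra|]. unfold Rdiv.
  rewrite Rmult_assoc, Rinv_l by lra. lra. }
assert (Hd : unit_disc (radial_point k)).
{ unfold unit_disc, radial_point. rewrite Cmod_mult, Ht, Cmod_R, Rabs_pos_eq; lra. }
split; [exact Hd|].
unfold cayley, radial_point, radial_height.
set (r := (INR k + 1) / (INR k + 2)) in *.
replace (Cconj tau * (RtoC r * tau))%C with (RtoC r * (tau * Cconj tau))%C by ring.
rewrite unimodular_conj, Cmult_1_r by exact Ht.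
rewrite <- RtoC_plus, <- RtoC_minus, <- RtoC_div by lra. f_equal.
unfold r. field. split; lra.
Qed.

Lemma angular_derivative_along (u : nat -> C) (M : R) : 1 < M ->
  (forall n, Stolz_region tau M (u n)) ->
  filterlim u eventually (@locally C_UniformSpace tau) ->
  filterlim (fun n => (f (u n) - tau) / (u n - tau))%C eventually
    (@locally C_UniformSpace (RtoC alpha)).
Proof.
intros HM HS Hu P HP. specialize (Ha M HM P HP). unfold filtermap, within in *.
specialize (Hu _ Ha). unfold filtermap in Hu.
revert Hu. apply filter_imp. intros n Hn. apply Hn, HS.
Qed.

(** In the half-plane, convergence to [tau] means growth of the modulus, and
    staying in a Stolz region means staying in a sector. *)
Lemma angular_quotient_along (u : nat -> C) (A : R) :
  (forall n, unit_disc (u n)) ->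
  (forall n, Cmod (cayley tau (u n) + 1)%C <= A * Re (cayley tau (u n))) ->
  filterlim (fun n => Cmod (cayley tau (u n) + 1)%C) eventually (Rbar_locally p_infty) ->
  filterlim (fun n => (cayley tau (u n) + 1) / (cayley tau (f (u n)) + 1))%C eventually
    (@locally C_UniformSpace (RtoC alpha)).
Proof.
intros Hu HA Hinf.
apply (filterlim_ext (fun n => (f (u n) - tau) / (u n - tau))%C).
{ intros n. apply angular_quotient; [exact Ht|apply Hu|]. now apply (proj1 Hf). }
apply angular_derivative_along with (M := Rmax 2 (A + 1)).
- pose proof (Rmax_l 2 (A + 1)). lra.
- intros n. unfold Stolz_region.
  pose proof (Rmax_r 2 (A + 1)) as HM. set (M := Rmax 2 (A + 1)) in *.
  pose proof (Cmod_minus_tau tau (u n) Ht (Hu n)) as E.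
  pose proof (Re_cayley tau (u n) Ht (Hu n)) as ER.
  pose proof (Re_cayley_pos tau (u n) Ht (Hu n)) as HR.
  pose proof (HA n) as HAn.
  assert (E1 : Cmod (1 - Cconj tau * u n)%C = Cmod (u n - tau)%C).
  { replace (u n - tau)%C with (- tau * (1 - Cconj tau * u n))%C.
    - now rewrite Cmod_mult, Cmod_opp, Ht, Rmult_1_l.
    - replace (- tau * (1 - Cconj tau * u n))%C
        with ((tau * Cconj tau) * u n - tau)%C by ring.
      rewrite unimodular_conj by assumption. ring. }
  rewrite E1 in ER.
  set (X := Re (cayley tau (u n))) in *. set (Y := Cmod (cayley tau (u n) + 1)%C) in *.
  assert (HY : 0 < Y).
  { pose proof (Re_le_Cmod (cayley tau (u n) + 1)%C) as B.
    change (X + 1 <= Y) in B. lra. }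
  set (D := Cmod (u n - tau)%C) in *.
  assert (HD : 0 < D) by (rewrite E; apply Rdiv_lt_0_compat; lra).
  assert (EX : 1 - Cmod (u n) ^ 2 = X * D ^ 2) by (rewrite ER; field; lra).
  assert (EY : Y * D = 2) by (rewrite E; field; lra).
  pose proof (Hu n) as Hun. unfold unit_disc in Hun. pose proof (Cmod_ge_0 (u n)).
  assert (H1 : X * D ^ 2 <= 2 * (1 - Cmod (u n))) by nra.
  assert (H2 : 2 * D <= A * (X * D ^ 2)) by nra.
  assert (HA0 : 0 < A) by nra.
  nra.
- apply filterlim_Cmod; [apply eventually_filter|]. intros e He.
  assert (He2 : 0 < 2 / e) by (apply Rdiv_lt_0_compat; lra).
  specialize (Hinf (fun y => 2 / e < y)). unfold filtermap in Hinf.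
  refine (filter_imp _ _ _ (Hinf _)).
  + intros n Hn. rewrite (Cmod_minus_tau tau (u n) Ht (Hu n)).
    assert (HY : 0 < Cmod (cayley tau (u n) + 1)%C) by lra.
    apply Rmult_lt_reg_r with (1 := HY). unfold Rdiv at 1.
    rewrite Rmult_assoc, Rinv_l by lra.
    apply Rmult_lt_compat_l with (r := e) in Hn; [|exact He].
    replace (e * (2 / e)) with 2 in Hn by (field; lra). lra.
  + exists (2 / e). auto.
Qed.

(** Apply the Schwarz-Pick lemma to [z] and to a point tending to [tau] along the
    radius, whose image in the half-plane is a large real [x], and multiply by
    [x].  The distance inequality becomes
    [Re Z * |x / (x + conj Z)|^2 <= Re W * |x / (F x + conj W)|], whose two
    quotients tend to [1] and to [alpha]. *)
Lemma Julia_lemma (z : C) : unit_disc z ->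
  Re (cayley tau z) <= alpha * Re (cayley tau (f z)).
Proof.
intros Hz. pose proof (proj1 Hf) as Hs.
set (x := radial_height). set (u := radial_point).
set (Fk := fun k => cayley tau (f (u k))).
set (Z := cayley tau z). set (W := cayley tau (f z)).
assert (HZ : 0 < Re Z) by now apply Re_cayley_pos.
assert (HW : 0 < Re W) by (apply Re_cayley_pos; auto).
assert (Hx : forall k, 0 < x k).
{ intros k. unfold x, radial_height. pose proof (pos_INR k). lra. }
assert (Hu : forall k, unit_disc (u k)) by (intros k; apply radial_point_spec).
assert (Ex : forall k, cayley tau (u k) = RtoC (x k)) by (intros k; apply radial_point_spec).
assert (HF : forall k, 0 < Re (Fk k)) by (intros k; apply Re_cayley_pos; auto).
assert (Hxinf : filterlim x eventually (Rbar_locally p_infty)) by apply radial_height_infty.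
set (G := fun k => ((RtoC (x k) + 1) / (Fk k + 1))%C).
assert (HG : filterlim G eventually (@locally C_UniformSpace (RtoC alpha))).
{ apply (filterlim_ext (fun n => (cayley tau (u n) + 1) / (cayley tau (f (u n)) + 1))%C).
  { intros k. now rewrite Ex. }
  apply angular_quotient_along with (A := 2); [exact Hu| |].
  - intros k. rewrite Ex. rewrite <- RtoC_plus, Cmod_R. simpl.
    unfold x, radial_height. pose proof (pos_INR k). rewrite Rabs_pos_eq; lra.
  - apply (filterlim_ext (fun k => x k + 1)).
    { intros k. rewrite Ex, <- RtoC_plus, Cmod_R. rewrite Rabs_pos_eq; [reflexivity|].
      specialize (Hx k). lra. }
    apply (is_lim_seq_plus x (fun _ => 1) p_infty 1); [exact Hxinf|apply is_lim_seq_const|].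
    reflexivity. }
assert (Nx : forall k, RtoC (x k) <> 0%C).
{ intros k E. injection E. specialize (Hx k). lra. }
assert (Nx1 : forall k, (RtoC (x k) + 1)%C <> 0%C).
{ intros k E. apply (f_equal Re) in E. change (x k + 1 = 0) in E.
  specialize (Hx k). lra. }
assert (NF1 : forall k, (Fk k + 1)%C <> 0%C).
{ intros k E. apply (f_equal Re) in E. change (Re (Fk k) + 1 = 0) in E.
  specialize (HF k). lra. }
assert (NFW : forall k, (Fk k + Cconj W)%C <> 0%C).
{ intros k. apply Cmod_gt_0. now apply Cmod_plus_conj_pos. }
assert (NxZ : forall k, (RtoC (x k) + Cconj Z)%C <> 0%C).
{ intros k. apply Cmod_gt_0. apply Cmod_plus_conj_pos; [apply Hx|exact HZ]. }
(* The quotient is a ratio of a positive real and a point of the right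
   half-plane, so its limit has nonnegative real part. *)
assert (Ha0 : 0 <= alpha).
{ apply filterlim_C_components in HG; [|apply eventually_filter].
  destruct HG as [HG _].
  apply (is_lim_seq_le (fun _ => 0) (fun k => Re (G k)) 0 alpha).
  - intros k. unfold G.
    replace ((RtoC (x k) + 1) / (Fk k + 1))%C
      with (RtoC ((x k + 1) / Cmod (Fk k + 1)%C ^ 2) * Cconj (Fk k + 1))%C.
    + assert (0 < Cmod (Fk k + 1)%C) by now apply Cmod_gt_0.
      specialize (HF k). specialize (Hx k).
      assert (0 < (x k + 1) / Cmod (Fk k + 1)%C ^ 2)
        by (apply Rdiv_lt_0_compat; [lra|now apply pow_lt]).
      set (q := (x k + 1) / Cmod (Fk k + 1)%C ^ 2) in *.
      change (0 <= q * (Re (Fk k) + 1) - 0 * - (Im (Fk k) + 0)). nra.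
    + assert (Cmod (Fk k + 1)%C ^ 2 <> 0).
      { apply pow_nonzero. assert (0 < Cmod (Fk k + 1)%C) by now apply Cmod_gt_0. lra. }
      rewrite RtoC_div, Cmod2_conj, RtoC_plus by assumption. field. split; [apply NF1|].
      intros E. apply (NF1 k). apply (f_equal Cconj) in E. rewrite Cconj_conj in E.
      rewrite E. apply injective_projections; simpl; ring.
  - apply is_lim_seq_const.
  - exact HG. }
assert (Hix : filterlim (fun k => / RtoC (x k))%C eventually (@locally C_UniformSpace (RtoC 0))).
{ apply Clim_inv_infty; [apply eventually_filter|exact Nx|].
  apply (filterlim_ext x); [|exact Hxinf].
  intros k. rewrite Cmod_R, Rabs_pos_eq; [reflexivity|]. apply Rlt_le, Hx. }
assert (L1 : filterlim (fun k => Cmod (RtoC (x k) / (RtoC (x k) + Cconj Z))%C ^ 2)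
  eventually (locally (Cmod 1 ^ 2))).
{ assert (K : filterlim (fun k => / (1 + Cconj Z * / RtoC (x k)))%C eventually
     (@locally C_UniformSpace (/ (1 + Cconj Z * 0))%C)).
  { apply (Clim_inv _ (fun k => 1 + Cconj Z * / RtoC (x k))%C).
    - apply Clim_plus; [apply eventually_filter|apply Clim_const, eventually_filter|].
      apply Clim_mult; [apply eventually_filter|apply Clim_const, eventually_filter|exact Hix].
    - intros E. apply (f_equal fst) in E. simpl in E. lra. }
  replace (/ (1 + Cconj Z * 0))%C with (RtoC 1) in K by (field).
  apply (Rlim_continuous _ _ (fun s => s ^ 2));
    [|apply derivable_continuous_pt, derivable_pt_pow].
  apply Clim_Cmod; [apply eventually_filter|].
  eapply filterlim_ext; [|exact K]. intros k. simpl. field. split; [apply NxZ|apply Nx]. }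
assert (L2 : filterlim (fun k => Cmod (RtoC (x k) / (Fk k + Cconj W))%C)
  eventually (locally (Cmod (RtoC alpha)))).
{ apply Clim_Cmod; [apply eventually_filter|].
  assert (K : filterlim (fun k => G k * / (1 + / RtoC (x k) +
      (Cconj W - 1) * (G k * / RtoC (x k))))%C eventually
     (@locally C_UniformSpace (RtoC alpha * / (1 + 0 + (Cconj W - 1) * (RtoC alpha * 0)))%C)).
  { apply Clim_mult; [apply eventually_filter|exact HG|].
    apply (Clim_inv _ (fun k => 1 + / RtoC (x k) + (Cconj W - 1) * (G k * / RtoC (x k)))%C).
    - apply Clim_plus; [apply eventually_filter| |].
      + apply Clim_plus; [apply eventually_filter|apply Clim_const, eventually_filter|exact Hix].
      + apply Clim_mult; [apply eventually_filter|apply Clim_const, eventually_filter|].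
        now apply Clim_mult; [apply eventually_filter| |].
    - intros E. apply (f_equal fst) in E. simpl in E. lra. }
  replace (RtoC alpha * / (1 + 0 + (Cconj W - 1) * (RtoC alpha * 0)))%C
    with (RtoC alpha) in K by field.
  eapply filterlim_ext; [|exact K]. intros k. unfold G.
  assert (Eq : (1 + / RtoC (x k) + (Cconj W - 1) * ((RtoC (x k) + 1) / (Fk k + 1) * / RtoC (x k)))%C
    = ((RtoC (x k) + 1) * (Fk k + Cconj W) / (RtoC (x k) * (Fk k + 1)))%C).
  { field. split; [apply NF1|apply Nx]. }
  rewrite Eq. field. repeat split; (apply NFW || apply Nx1 || apply NF1 || apply Nx). }
assert (Hle : Re Z * Cmod 1 ^ 2 <= Re W * Cmod (RtoC alpha)).
{ apply (is_lim_seq_le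
    (fun k => Re Z * Cmod (RtoC (x k) / (RtoC (x k) + Cconj Z))%C ^ 2)
    (fun k => Re W * Cmod (RtoC (x k) / (Fk k + Cconj W))%C)
    (Re Z * Cmod 1 ^ 2) (Re W * Cmod (RtoC alpha))).
  - intros k.
    pose proof (half_plane_cosh2_contraction tau f (u k) z Ht Hf (Hu k) Hz) as Q.
    fold (Fk k) W Z in Q. rewrite Ex in Q. unfold half_plane_cosh2 in Q. simpl Re at 3 in Q.
    assert (M1 : 0 < Cmod (Fk k + Cconj W)%C) by now apply Cmod_gt_0.
    assert (M2 : 0 < Cmod (RtoC (x k) + Cconj Z)%C) by now apply Cmod_gt_0.
    rewrite !Cmod_div, Cmod_R, Rabs_pos_eq by (try apply NFW; try apply NxZ; apply Rlt_le, Hx).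
    specialize (Hx k). specialize (HF k).
    pose proof (Re_le_Cmod (Fk k + Cconj W)%C) as B.
    set (a := Cmod (Fk k + Cconj W)%C) in *. set (b := Cmod (RtoC (x k) + Cconj Z)%C) in *.
    assert (B' : Re (Fk k) <= a) by (change (Re (Fk k) + Re W <= a) in B; lra).
    set (X := x k) in *. set (R1 := Re (Fk k)) in *.
    change (Re (RtoC X)) with X in Q.
    assert (Q' : a * (X * Re Z) <= Re W * b ^ 2).
    { assert (Q2 : a ^ 2 * (X * Re Z) <= b ^ 2 * (R1 * Re W)).
      { apply Rmult_le_compat_r with (r := 4 * R1 * Re W * (X * Re Z)) in Q.
        - replace (a ^ 2 / (4 * R1 * Re W) * (4 * R1 * Re W * (X * Re Z)))
            with (a ^ 2 * (X * Re Z)) in Q by (field; lra).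
          replace (b ^ 2 / (4 * X * Re Z) * (4 * R1 * Re W * (X * Re Z)))
            with (b ^ 2 * (R1 * Re W)) in Q by (field; lra).
          exact Q.
        - repeat apply Rmult_le_pos; lra. }
      apply Rmult_le_reg_l with (1 := M1).
      assert (b ^ 2 * (R1 * Re W) <= b ^ 2 * (a * Re W)).
      { apply Rmult_le_compat_l; [apply pow2_ge_0|]. apply Rmult_le_compat_r; lra. }
      lra. }
    apply Rmult_le_reg_r with (a * b ^ 2 / X).
    { apply Rdiv_lt_0_compat; [|exact Hx]. apply Rmult_lt_0_compat; [exact M1|now apply pow_lt]. }
    replace (Re Z * (X / b) ^ 2 * (a * b ^ 2 / X)) with (a * (X * Re Z)) by (field; lra).
    replace (Re W * (X / a) * (a * b ^ 2 / X)) with (Re W * b ^ 2) by (field; lra).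
    exact Q'.
  - apply Rlim_mult; [apply eventually_filter|apply Rlim_const, eventually_filter|exact L1].
  - apply Rlim_mult; [apply eventually_filter|apply Rlim_const, eventually_filter|exact L2]. }
rewrite Cmod_1, Cmod_R, Rabs_pos_eq in Hle by exact Ha0. fold Z W. lra.
Qed.

End Julia.

(** * Orbits of a hyperbolic map *)

Section Orbit.
Variables (f : C -> C) (tau : C) (alpha : R) (z : C).
Hypotheses (Hf : holomorphic_self_map f) (Ht : Cmod tau = 1)
  (Ha : angular_derivative f tau (RtoC alpha)) (Ha1 : alpha < 1)
  (Hz : unit_disc z).

Definition orbit (n : nat) : C := cayley tau (Nat.iter n f z).

Lemma unit_disc_orbit (n : nat) : unit_disc (Nat.iter n f z).
Proof. induction n as [|n IH]; [exact Hz|]. simpl. now apply (proj1 Hf). Qed.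

Lemma Re_orbit_pos (n : nat) : 0 < Re (orbit n).
Proof. apply Re_cayley_pos; [exact Ht|apply unit_disc_orbit]. Qed.

Lemma Re_orbit_step (n : nat) : Re (orbit n) <= alpha * Re (orbit (S n)).
Proof. apply (Julia_lemma f tau alpha Hf Ht Ha). apply unit_disc_orbit. Qed.

Lemma multiplier_pos : 0 < alpha.
Proof.
pose proof (Re_orbit_step 0). pose proof (Re_orbit_pos 0). pose proof (Re_orbit_pos 1). nra.
Qed.

Lemma Re_orbit_growth (n : nat) : Re (orbit 0) * (/ alpha) ^ n <= Re (orbit n).
Proof.
pose proof multiplier_pos as Hp.
induction n as [|n IH]; [simpl; lra|].
pose proof (Re_orbit_step n) as H.
apply Rmult_le_reg_l with (1 := Hp).
replace (alpha * (Re (orbit 0) * (/ alpha) ^ S n))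
  with (Re (orbit 0) * (/ alpha) ^ n) by (rewrite <- tech_pow_Rmult; field; lra).
lra.
Qed.

Lemma Re_orbit_ge_0 (n : nat) : Re (orbit 0) <= Re (orbit n).
Proof.
pose proof multiplier_pos as Hp. induction n as [|n IH]; [lra|].
pose proof (Re_orbit_step n). pose proof (Re_orbit_pos (S n)). nra.
Qed.

Lemma Re_orbit_infty :
  filterlim (fun n => Re (orbit n)) eventually (Rbar_locally p_infty).
Proof.
pose proof multiplier_pos as Hp. pose proof (Re_orbit_pos 0) as H0.
apply (lim_infty_le (fun n => Re (orbit 0) * (/ alpha) ^ n)); [exact Re_orbit_growth|].
assert (Hq : 1 < / alpha) by (rewrite <- Rinv_1; apply Rinv_lt_contravar; lra).
replace p_infty with (Rbar_mult (Re (orbit 0)) p_infty).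
- apply is_lim_seq_scal_l, is_lim_seq_geom_p. exact Hq.
- set (r := Re (orbit 0)) in *. clearbody r.
  simpl. destruct Rle_dec; [|lra]. destruct Rle_lt_or_eq_dec; [reflexivity|lra].
Qed.

Lemma orbit_displacement (n : nat) :
  half_plane_cosh2 (orbit (S n)) (orbit n) <= half_plane_cosh2 (orbit 1) (orbit 0).
Proof.
induction n as [|n IH]; [lra|]. eapply Rle_trans; [|exact IH].
apply (half_plane_cosh2_contraction tau f (Nat.iter (S n) f z) (Nat.iter n f z));
  [exact Ht|exact Hf|apply unit_disc_orbit|apply unit_disc_orbit].
Qed.

(** A hyperbolic disc of fixed radius around a point has Euclidean size
    comparable to the real part of its centre. *)
Lemma orbit_step_bounds : exists c, 0 < c /\
  forall n, Rabs (Im (orbit (S n)) - Im (orbit n)) <= c * Re (orbit n).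
Proof.
set (q := half_plane_cosh2 (orbit 1) (orbit 0)).
assert (Hq : 0 < q).
{ unfold q, half_plane_cosh2. pose proof (Re_orbit_pos 0). pose proof (Re_orbit_pos 1).
  apply Rdiv_lt_0_compat; [|repeat apply Rmult_lt_0_compat; lra].
  apply pow_lt. now apply Cmod_plus_conj_pos. }
exists (4 * q). split; [lra|]. intros n.
pose proof (orbit_displacement n) as H. fold q in H. unfold half_plane_cosh2 in H.
pose proof (Re_orbit_pos n) as X. pose proof (Re_orbit_pos (S n)) as X'.
rewrite Cmod2_alt in H.
replace (Re (orbit (S n) + Cconj (orbit n))%C) with (Re (orbit (S n)) + Re (orbit n)) in H
  by reflexivity.
replace (Im (orbit (S n) + Cconj (orbit n))%C) with (Im (orbit (S n)) - Im (orbit n)) in H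
  by reflexivity.
set (x := Re (orbit n)) in *. set (x' := Re (orbit (S n))) in *.
set (d := Im (orbit (S n)) - Im (orbit n)) in *.
apply Rmult_le_compat_r with (r := 4 * x' * x) in H; [|nra].
unfold Rdiv in H. rewrite Rmult_assoc, Rinv_l, Rmult_1_r in H by nra.
assert (H1 : x' <= 4 * q * x).
{ apply Rmult_le_reg_r with (1 := X'). pose proof (pow2_ge_0 d). nra. }

apply Rle_trans with (Rabs (4 * q * x)); [|rewrite Rabs_pos_eq; nra].
apply Rsqr_le_abs_0. rewrite !Rsqr_pow2.
assert (d ^ 2 <= q * (4 * x' * x)) by nra.
assert (q * (4 * x' * x) <= q * (4 * (4 * q * x) * x)).
{ apply Rmult_le_compat_l; [lra|]. apply Rmult_le_compat_r; lra. }
nra.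
Qed.

(** The displacements form a series dominated by a geometric one, so the orbit
    stays in a sector. *)
Lemma orbit_in_sector : exists A, 0 < A /\
  forall n, Rabs (Im (orbit n)) <= A * Re (orbit n).
Proof.
destruct orbit_step_bounds as (c & Hc & H).
pose proof multiplier_pos as Hp. pose proof (Re_orbit_pos 0) as H0.
(* The second term makes [(A + c) * alpha <= A], the induction step. *)
set (A := Rmax (Rabs (Im (orbit 0)) / Re (orbit 0)) (c * alpha / (1 - alpha))).
assert (A1 : Rabs (Im (orbit 0)) / Re (orbit 0) <= A) by apply Rmax_l.
assert (A2 : c * alpha / (1 - alpha) <= A) by apply Rmax_r.
assert (A0 : 0 < c * alpha / (1 - alpha)) by (apply Rdiv_lt_0_compat; nra).
assert (A3 : c * alpha <= A * (1 - alpha)).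
{ apply Rmult_le_compat_r with (r := 1 - alpha) in A2; [|lra].
  unfold Rdiv in A2. rewrite Rmult_assoc, Rinv_l in A2 by lra. lra. }
exists A. split; [lra|].
induction n as [|n IH].
- apply Rmult_le_compat_r with (r := Re (orbit 0)) in A1; [|lra].
  unfold Rdiv in A1. rewrite Rmult_assoc, Rinv_l in A1 by lra. lra.
- pose proof (H n) as Hn. pose proof (Re_orbit_step n) as Hs.
  pose proof (Re_orbit_pos (S n)) as Hx.
  replace (Im (orbit (S n)))
    with (Im (orbit n) + (Im (orbit (S n)) - Im (orbit n))) by ring.
  eapply Rle_trans; [apply Rabs_triang|].
  assert ((A + c) * Re (orbit n) <= (A + c) * (alpha * Re (orbit (S n))))
    by (apply Rmult_le_compat_l; lra).
  nra.
Qed.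

Lemma orbit_neq_0 (n : nat) : orbit n <> 0%C.
Proof.
intros E. pose proof (Re_orbit_pos n) as H. rewrite E in H. simpl in H. lra.
Qed.

Lemma Cmod_orbit_infty :
  filterlim (fun n => Cmod (orbit n)) eventually (Rbar_locally p_infty).
Proof.
apply (lim_infty_le (fun n => Re (orbit n))); [intros n; apply Re_le_Cmod|].
exact Re_orbit_infty.
Qed.

(** The angular derivative along the orbit; adding one to numerator and
    denominator does not matter since the moduli tend to infinity. *)
Lemma orbit_ratio :
  filterlim (fun n => Cmod (orbit n) / Cmod (orbit (S n))) eventually (locally alpha).
Proof.
destruct orbit_in_sector as (A & HA & Hsec).
pose proof (Re_orbit_pos 0) as H0. pose proof multiplier_pos as Hp.
assert (G : filterlim (fun n => (orbit n + 1) / (orbit (S n) + 1))%C eventually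
   (@locally C_UniformSpace (RtoC alpha))).
{ apply (angular_quotient_along f tau alpha Hf Ht Ha (fun n => Nat.iter n f z)
    (1 + A + / Re (orbit 0))).
  - exact unit_disc_orbit.
  - intros n. change (cayley tau (Nat.iter n f z)) with (orbit n).
    eapply Rle_trans; [apply Cmod_le_Rabs|].
    change (Re (orbit n + 1)%C) with (Re (orbit n) + 1).
    replace (Im (orbit n + 1)%C) with (Im (orbit n)) by (simpl; unfold Im; ring).
    pose proof (Re_orbit_pos n). pose proof (Hsec n). pose proof (Re_orbit_ge_0 n) as Hge.
    rewrite (Rabs_pos_eq (Re (orbit n) + 1)) by lra.
    apply Rmult_le_compat_l with (r := / Re (orbit 0)) in Hge;
      [|now apply Rlt_le, Rinv_0_lt_compat].
    rewrite Rinv_l in Hge by lra. lra.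
  - apply (lim_infty_le (fun n => Re (orbit n))); [|exact Re_orbit_infty].
    intros n. pose proof (Re_le_Cmod (orbit n + 1)%C) as B.
    change (Re (orbit n) + 1 <= Cmod (orbit n + 1)%C) in B.
    change (Re (orbit n) <= Cmod (orbit n + 1)%C). lra. }
assert (I : filterlim (fun n => / orbit n)%C eventually (@locally C_UniformSpace (RtoC 0))).
{ apply Clim_inv_infty; [apply eventually_filter|exact orbit_neq_0|exact Cmod_orbit_infty]. }
assert (I' : filterlim (fun n => / orbit (S n))%C eventually (@locally C_UniformSpace (RtoC 0))).
{ apply (filterlim_comp _ _ _ S (fun n => / orbit n)%C eventually eventually); [|exact I].
  apply eventually_subseq. intros n. lia. }
assert (K : filterlim (fun n => ((orbit n + 1) / (orbit (S n) + 1)) *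
    ((1 + / orbit (S n)) / (1 + / orbit n)))%C eventually
   (@locally C_UniformSpace (RtoC alpha * ((1 + 0) / (1 + 0)))%C)).
{ apply Clim_mult; [apply eventually_filter|exact G|].
  apply Clim_div; [apply eventually_filter| | |].
  - apply Clim_plus; [apply eventually_filter|apply Clim_const, eventually_filter|exact I'].
  - apply Clim_plus; [apply eventually_filter|apply Clim_const, eventually_filter|exact I].
  - intros E. apply (f_equal fst) in E. simpl in E. lra. }
replace (RtoC alpha * ((1 + 0) / (1 + 0)))%C with (RtoC alpha) in K by field.
apply Clim_Cmod in K; [|apply eventually_filter].
rewrite Cmod_R, Rabs_pos_eq in K by lra.
eapply filterlim_ext; [|exact K].
assert (N1 : forall k, (orbit k + 1)%C <> 0%C).
{ intros k E. apply (f_equal Re) in E. change (Re (orbit k) + 1 = 0) in E.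
  pose proof (Re_orbit_pos k). lra. }
intros n. simpl. rewrite <- Cmod_div by apply orbit_neq_0. f_equal.
pose proof (orbit_neq_0 n). pose proof (orbit_neq_0 (S n)).
field. repeat split; (apply N1 || assumption).
Qed.

End Orbit.

(** * Projections in the half-plane *)

Definition direction (Z : C) : C := (Z / RtoC (Cmod Z))%C.

Lemma direction_spec (Z : C) : 0 < Re Z ->
  Cmod (direction Z) = 1 /\ 0 < Re (direction Z) <= 1 /\
  Re Z = Cmod Z * Re (direction Z) /\ Im Z = Cmod Z * Im (direction Z) /\ 0 < Cmod Z.
Proof.
intros HZ. pose proof (Re_le_Cmod Z) as HB.
assert (Hm : 0 < Cmod Z) by lra.
assert (Hn : RtoC (Cmod Z) <> 0%C) by (intros E; injection E; lra).
assert (H1 : Cmod (direction Z) = 1).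
{ unfold direction. rewrite Cmod_div, Cmod_R, Rabs_pos_eq by (try exact Hn; lra). field. lra. }
assert (E : Z = (RtoC (Cmod Z) * direction Z)%C) by (unfold direction; field; exact Hn).
assert (ER : Re Z = Cmod Z * Re (direction Z)).
{ rewrite E at 1. set (d := direction Z). set (m := Cmod Z).
  change (m * Re d - 0 * Im d = m * Re d). ring. }
assert (EI : Im Z = Cmod Z * Im (direction Z)).
{ rewrite E at 1. set (d := direction Z). set (m := Cmod Z).
  change (m * Im d + 0 * Re d = m * Im d). ring. }
pose proof (Re_le_Cmod (direction Z)) as HB1. rewrite H1 in HB1.
repeat split; try assumption. nra.
Qed.

Lemma half_plane_cosh2_polar (Z W : C) : 0 < Re Z -> 0 < Re W ->
  half_plane_cosh2 Z W
  = (Cmod W / Cmod Z + Cmod Z / Cmod W + 2 * Re (direction Z * direction W)%C)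
    / (4 * Re (direction Z) * Re (direction W)).
Proof.
intros HZ HW.
destruct (direction_spec Z HZ) as (Z1 & Z2 & Z3 & Z4 & Z5).
destruct (direction_spec W HW) as (W1 & W2 & W3 & W4 & W5).
unfold half_plane_cosh2. rewrite Cmod2_alt.
change (Re (Z + Cconj W)%C) with (Re Z + Re W).
change (Im (Z + Cconj W)%C) with (Im Z + - Im W).
change (Re (direction Z * direction W)%C)
  with (Re (direction Z) * Re (direction W) - Im (direction Z) * Im (direction W)).
assert (EZ : Re (direction Z) ^ 2 + Im (direction Z) ^ 2 = 1) by (rewrite <- Cmod2_alt, Z1; ring).
assert (EW : Re (direction W) ^ 2 + Im (direction W) ^ 2 = 1) by (rewrite <- Cmod2_alt, W1; ring).
rewrite Z3, W3, Z4, W4.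
set (a := Re (direction Z)) in *. set (b := Im (direction Z)) in *.
set (c := Re (direction W)) in *. set (d := Im (direction W)) in *.
set (r := Cmod Z) in *. set (s := Cmod W) in *.
replace ((r * a + s * c) ^ 2 + (r * b + - (s * d)) ^ 2)
  with (r ^ 2 * (a ^ 2 + b ^ 2) + s ^ 2 * (c ^ 2 + d ^ 2) + 2 * r * s * (a * c - b * d)) by ring.
rewrite EZ, EW. field. repeat split; lra.
Qed.

(** If [W] is at least as near to [Z] as a point [W'] of the same modulus as
    [Z], then the ratio of moduli of [W] and [Z] is controlled by the difference
    of the directions of [W] and [W'].  The direction of [Z] drops out. *)
Lemma nearest_modulus_ratio (Z W W' : C) :
  0 < Re Z -> 0 < Re W -> 0 < Re W' -> Cmod W' = Cmod Z ->
  half_plane_cosh2 Z W <= half_plane_cosh2 Z W' ->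
  Cmod W / Cmod Z + Cmod Z / Cmod W - 2
  <= Cmod (direction W - direction W')%C * (2 + 4 / Re (direction W')).
Proof.
intros HZ HW HW' Em H. rewrite !half_plane_cosh2_polar, Em in H by assumption.
destruct (direction_spec Z HZ) as (Z1 & Z2 & _ & _ & Z5).
destruct (direction_spec W HW) as (W1 & W2 & _ & _ & W5).
destruct (direction_spec W' HW') as (V1 & V2 & _ & _ & _).
replace (Cmod Z / Cmod Z + Cmod Z / Cmod Z) with 2 in H by (field; lra).
set (x := Cmod W / Cmod Z + Cmod Z / Cmod W) in *.
set (a := direction Z) in *. set (g := direction W) in *. set (h := direction W') in *.
assert (Bc : Re (a * h)%C <= 1).
{ eapply Rle_trans; [apply Re_le_Cmod|]. rewrite Cmod_mult, Z1, V1. lra. }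
assert (Bd : Re (a * h)%C - Re (a * g)%C <= Cmod (g - h)%C).
{ replace (Re (a * h)%C - Re (a * g)%C) with (Re (- (a * (g - h)))%C)
    by (simpl; unfold Re, Im; ring).
  eapply Rle_trans; [apply Re_le_Cmod|]. rewrite Cmod_opp, Cmod_mult, Z1. lra. }
assert (Be : Re g - Re h <= Cmod (g - h)%C).
{ eapply Rle_trans; [|apply Re_le_Cmod]. simpl. unfold Re. lra. }
pose proof (Cmod_ge_0 (g - h)%C) as Bg.
set (D := Cmod (g - h)%C) in *. set (c := Re (a * g)%C) in *. set (c' := Re (a * h)%C) in *.
assert (H' : x + 2 * c <= (2 + 2 * c') * (Re g / Re h)).
{ apply Rmult_le_compat_r with (r := 4 * Re a * Re g) in H; [|nra].
  replace ((x + 2 * c) / (4 * Re a * Re g) * (4 * Re a * Re g)) with (x + 2 * c) in H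
    by (field; lra).
  replace ((2 + 2 * c') / (4 * Re a * Re h) * (4 * Re a * Re g))
    with ((2 + 2 * c') * (Re g / Re h)) in H by (field; lra).
  exact H. }
assert (Bm : -1 <= c').
{ pose proof (re_le_Cmod (a * h)%C) as B. rewrite Cmod_mult, Z1, V1, Rmult_1_l in B.
  fold c' in B. apply Rabs_le_between in B. lra. }
assert (E : Re g / Re h = 1 + (Re g - Re h) / Re h) by (field; lra).
assert (Hq : (Re g - Re h) / Re h <= D / Re h).
{ apply Rmult_le_compat_r; [|exact Be]. apply Rlt_le, Rinv_0_lt_compat; lra. }
assert (0 <= D / Re h) by (apply Rmult_le_pos; [lra|apply Rlt_le, Rinv_0_lt_compat; lra]).
rewrite E in H'.
assert ((2 + 2 * c') * ((Re g - Re h) / Re h) <= 4 * (D / Re h)).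
{ apply Rle_trans with ((2 + 2 * c') * (D / Re h)).
  - apply Rmult_le_compat_l; lra.
  - apply Rmult_le_compat_r; lra. }
replace (D * (2 + 4 / Re h)) with (2 * D + 4 * (D / Re h)) by (field; lra).
lra.
Qed.

(** [x + / x - 2 = (x - 1)^2 / x], and the hypothesis forces [x <= 3]. *)
Lemma ratio_near_1 (x e : R) : 0 < x -> 0 < e <= 1 ->
  x + / x - 2 <= e ^ 2 / 4 -> Rabs (x - 1) < e.
Proof.
intros Hx He H.
assert (Hi : 0 < / x) by now apply Rinv_0_lt_compat.
assert (x <= 3) by nra.
assert (E : (x - 1) ^ 2 = x * (x + / x - 2)) by (field; lra).
apply Rabs_lt_between. nra.
Qed.

Section Projection.
Variables (Gamma : R -> C) (e : C).
Hypotheses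
  (Hpos : forall t, 0 <= t -> 0 < Re (Gamma t))
  (Hcont : continuity (fun t => Cmod (Gamma (Rabs t))))
  (Hinf : filterlim (fun t => Cmod (Gamma t)) (Rbar_locally p_infty) (Rbar_locally p_infty))
  (Hdir : filterlim (fun t => direction (Gamma t)) (Rbar_locally p_infty)
            (@locally C_UniformSpace e))
  (He : 0 < Re e).

(** The curve is bounded on compact intervals, so a large modulus forces a large
    parameter.  Stated in terms of the modulus, this applies to any choice of
    points on the curve, whatever their parameters. *)
Lemma far_direction (d : R) : 0 < d -> exists B, forall t, 0 <= t ->
  B < Cmod (Gamma t) -> Cmod (direction (Gamma t) - e)%C < d.
Proof.
intros Hd.
destruct (proj1 (filterlim_Cmod _ _ _) Hdir d Hd) as [T HT].
destruct (continuity_ab_maj (fun t => Cmod (Gamma (Rabs t))) 0 (Rmax 0 T)) as (t1 & Ht1 & _).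
- apply Rmax_l.
- intros c _. apply Hcont.
- exists (Cmod (Gamma (Rabs t1))). intros t Ht Hlt. apply HT.
  apply Rnot_le_lt. intros Hle. apply (Rlt_irrefl (Cmod (Gamma (Rabs t1)))).
  eapply Rlt_le_trans; [exact Hlt|]. rewrite <- (Rabs_pos_eq t) at 1 by exact Ht.
  apply Ht1. split; [exact Ht|]. eapply Rle_trans; [exact Hle|apply Rmax_r].
Qed.

(** By the intermediate value theorem, as the modulus is unbounded. *)
Lemma modulus_attained (r : R) : Cmod (Gamma 0) <= r ->
  exists t, 0 <= t /\ Cmod (Gamma t) = r.
Proof.
intros Hr. destruct (Hinf (fun y => r < y)) as [T HT]; [now exists r|].
set (b := Rmax 0 T + 1).
assert (Hb : 0 < b /\ T < b).
{ pose proof (Rmax_l 0 T). pose proof (Rmax_r 0 T). unfold b. lra. }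
pose proof (HT b (proj2 Hb)) as HTb. unfold filtermap in HTb.
destruct (IVT_gen (fun t => Cmod (Gamma (Rabs t))) 0 b r Hcont) as (t & Ht & E).
- rewrite Rabs_R0, (Rabs_pos_eq b) by lra. split.
  + eapply Rle_trans; [apply Rmin_l|exact Hr].
  + eapply Rle_trans; [|apply Rmax_r]. lra.
- exists (Rabs t). split; [apply Rabs_pos|exact E].
Qed.

Variables (Z P : nat -> C).
Hypotheses
  (HZ : forall n, 0 < Re (Z n))
  (HZinf : filterlim (fun n => Cmod (Z n)) eventually (Rbar_locally p_infty))
  (HP : forall n, exists s, 0 <= s /\ P n = Gamma s)
  (Hmin : forall n t, 0 <= t -> half_plane_cosh2 (Z n) (P n) <= half_plane_cosh2 (Z n) (Gamma t)).

Lemma Re_projection_pos (n : nat) : 0 < Re (P n).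
Proof. destruct (HP n) as (s & Hs & ->). now apply Hpos. Qed.

Lemma projection_comparison (d : R) : 0 < d -> eventually (fun n =>
  exists g, Cmod (g - e)%C < d /\ 0 < Re g /\
    Cmod (P n) / Cmod (Z n) + Cmod (Z n) / Cmod (P n) - 2
    <= Cmod (direction (P n) - g)%C * (2 + 4 / Re g)).
Proof.
intros Hd. destruct (far_direction d Hd) as [B HB].
generalize (lim_infty_gt _ _ (Rmax B (Cmod (Gamma 0))) HZinf). apply filter_imp.
intros n Hn. pose proof (Rmax_l B (Cmod (Gamma 0))). pose proof (Rmax_r B (Cmod (Gamma 0))).
destruct (modulus_attained (Cmod (Z n))) as (t & Ht & E); [lra|].
exists (direction (Gamma t)). split; [apply HB; [exact Ht|lra]|].
split; [apply direction_spec, Hpos, Ht|].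
apply nearest_modulus_ratio; auto using Re_projection_pos.
Qed.

Lemma Cmod_projection_pos (n : nat) : 0 < Cmod (P n).
Proof. apply direction_spec, Re_projection_pos. Qed.

Lemma Cmod_Z_pos (n : nat) : 0 < Cmod (Z n).
Proof. apply direction_spec, HZ. Qed.

Lemma Re_near (g : C) (d : R) : Cmod (g - e)%C < d -> Re e - d < Re g.
Proof.
intros H. rewrite <- Cmod_opp in H. pose proof (Re_le_Cmod (- (g - e))%C) as B.
change (- (Re g + - Re e) <= Cmod (- (g - e))%C) in B. lra.
Qed.

Lemma direction_gap_bound (g : C) (n : nat) :
  Cmod (g - e)%C < Re e / 2 -> Cmod (direction (P n) - g)%C * (2 + 4 / Re g)
    <= Cmod (direction (P n) - g)%C * (2 + 8 / Re e).
Proof.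
intros H. pose proof (Re_near g _ H) as Hg.
apply Rmult_le_compat_l; [apply Cmod_ge_0|].
assert (4 / Re g <= 8 / Re e); [|lra].
apply Rmult_le_reg_r with (Re g * Re e); [nra|].
replace (4 / Re g * (Re g * Re e)) with (4 * Re e) by (field; lra).
replace (8 / Re e * (Re g * Re e)) with (8 * Re g) by (field; lra). lra.
Qed.

(** A crude form of the comparison: directions differ by a bounded amount, so
    the ratio of moduli stays away from zero. *)
Lemma Cmod_projection_infty :
  filterlim (fun n => Cmod (P n)) eventually (Rbar_locally p_infty).
Proof.
set (c := 2 + (2 + Re e) * (2 + 8 / Re e)).
assert (H8 : 0 < 8 / Re e) by (apply Rdiv_lt_0_compat; lra).
assert (Hc : 0 < c) by (unfold c; nra).
intros S [M HM].
assert (Hd : 0 < Re e / 2) by lra.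
pose proof (projection_comparison _ Hd) as H1.
unfold filtermap. generalize (filter_and _ _ H1 (lim_infty_gt _ _ (Rmax 0 M * c) HZinf)). apply filter_imp.
intros n [(g & G1 & G2 & G3) HZn]. apply HM.
pose proof (direction_gap_bound g n G1) as G4.
pose proof (Cmod_projection_pos n) as Hp. pose proof (Cmod_Z_pos n) as Hz.
assert (Hgap : Cmod (direction (P n) - g)%C <= 2 + Re e).
{ replace (direction (P n) - g)%C with (direction (P n) + (- (g - e) + - e))%C by ring.
  eapply Rle_trans; [apply Cmod_triangle|].
  destruct (direction_spec (P n) (Re_projection_pos n)) as [D1 _]. rewrite D1.
  pose proof (Cmod_triangle (- (g - e)) (- e))%C as B. rewrite !Cmod_opp in B.
  assert (Cmod e <= 1); [|lra].
  apply (is_lim_seq_le (fun n => Cmod (direction (Gamma (INR n)))) (fun _ => 1) (Cmod e) 1).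
  - intros k. rewrite (proj1 (direction_spec _ (Hpos (INR k) (pos_INR k)))). lra.
  - apply Clim_Cmod; [apply eventually_filter|].
    apply (filterlim_comp _ _ _ INR (fun t => direction (Gamma t)) eventually
      (Rbar_locally p_infty)); [apply is_lim_seq_INR|exact Hdir].
  - apply is_lim_seq_const. }
assert (Hx : Cmod (Z n) / Cmod (P n) <= c).
{ assert (0 < Cmod (P n) / Cmod (Z n)) by now apply Rdiv_lt_0_compat.
  assert (Cmod (direction (P n) - g)%C * (2 + 8 / Re e) <= (2 + Re e) * (2 + 8 / Re e))
    by (apply Rmult_le_compat_r; lra).
  unfold c. lra. }
apply Rmult_le_compat_r with (r := Cmod (P n)) in Hx; [|lra].
unfold Rdiv in Hx. rewrite Rmult_assoc, Rinv_l in Hx by lra.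
pose proof (Rmax_r 0 M). apply Rmult_lt_reg_r with (1 := Hc). nra.
Qed.

Lemma direction_projection :
  filterlim (fun n => direction (P n)) eventually (@locally C_UniformSpace e).
Proof.
apply filterlim_Cmod; [apply eventually_filter|]. intros d Hd.
destruct (far_direction d Hd) as [B HB].
generalize (lim_infty_gt _ _ B Cmod_projection_infty). apply filter_imp.
intros n Hn. destruct (HP n) as (s & Hs & E). rewrite E in *. now apply HB.
Qed.

Lemma projection_ratio :
  filterlim (fun n => Cmod (P n) / Cmod (Z n)) eventually (locally 1).
Proof.
assert (H8 : 0 < 8 / Re e) by (apply Rdiv_lt_0_compat; lra).
set (k := 2 + 8 / Re e).
intros S [d0 Hd0]. set (d := Rmin d0 1).
assert (Hd : 0 < d <= 1).
{ split; [apply Rmin_pos; [apply cond_pos|lra]|apply Rmin_r]. }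
assert (Hdd : d <= d0) by apply Rmin_l.
(* The directions of [P n] and of the comparison point are [h]-near to [e], so
   the comparison gives [x + / x - 2 <= 2 * h * k <= d^2 / 4]. *)
set (h := Rmin (Re e / 2) (d ^ 2 / (8 * k))).
assert (Hk : 0 < k) by (unfold k; lra).
assert (Hd2 : 0 < d ^ 2) by (apply pow_lt; lra).
assert (Hh : 0 < h) by (apply Rmin_pos; [lra|apply Rdiv_lt_0_compat; lra]).
assert (Hh1 : h <= Re e / 2) by apply Rmin_l.
assert (Hh2 : h * k <= d ^ 2 / 8).
{ apply Rle_trans with (d ^ 2 / (8 * k) * k); [|right; field; lra].
  apply Rmult_le_compat_r; [lra|apply Rmin_r]. }
pose proof (projection_comparison h Hh) as H1.
pose proof (proj1 (filterlim_Cmod _ _ _) direction_projection h Hh) as H2.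
unfold filtermap. generalize (filter_and _ _ H1 H2). apply filter_imp.
intros n [(g & G1 & G2 & G3) Hn]. apply Hd0.
pose proof (direction_gap_bound g n ltac:(lra)) as G4. fold k in G4.
pose proof (Cmod_projection_pos n) as Hp. pose proof (Cmod_Z_pos n) as Hz.
assert (Hgap : Cmod (direction (P n) - g)%C <= 2 * h).
{ replace (direction (P n) - g)%C with ((direction (P n) - e) + - (g - e))%C by ring.
  eapply Rle_trans; [apply Cmod_triangle|]. rewrite Cmod_opp. lra. }
assert (Hb : Cmod (direction (P n) - g)%C * k <= 2 * h * k)
  by (apply Rmult_le_compat_r; lra).
change (Rabs (Cmod (P n) / Cmod (Z n) - 1) < d0).
eapply Rlt_le_trans; [|exact Hdd].
apply ratio_near_1; [now apply Rdiv_lt_0_compat|exact Hd|].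
replace (/ (Cmod (P n) / Cmod (Z n))) with (Cmod (Z n) / Cmod (P n)) by (field; lra).
lra.
Qed.

End Projection.

(** * Growth of the distance to a fixed point *)

Lemma eventually_increasing_of_step (u : nat -> R) :
  eventually (fun n => u n < u (S n)) -> eventually_strictly_increasing u.
Proof.
intros [N HN]. exists N. intros m n Hm Hmn.
induction Hmn as [|n Hmn IH]; [now apply HN|].
eapply Rlt_trans; [exact IH|]. apply HN. lia.
Qed.

(** From the polar form: when the modulus of [P n] is large, the term
    [|P n| / |W|] dominates and the denominator converges. *)
Lemma half_plane_cosh2_over_modulus (W e : C) (P : nat -> C) :
  0 < Re W -> 0 < Re e -> (forall n, 0 < Re (P n)) ->
  filterlim (fun n => Cmod (P n)) eventually (Rbar_locally p_infty) ->
  filterlim (fun n => direction (P n)) eventually (@locally C_UniformSpace e) ->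
  filterlim (fun n => half_plane_cosh2 W (P n) / Cmod (P n)) eventually
    (locally (/ (4 * Re W * Re e))).
Proof.
intros HW He HP Hinf Hdir.
assert (NP : forall n, Cconj (P n) <> 0%C).
{ intros n E. apply (f_equal Re) in E. change (Re (P n) = 0) in E.
  specialize (HP n). lra. }
assert (I : filterlim (fun n => / Cconj (P n))%C eventually (@locally C_UniformSpace (RtoC 0))).
{ apply Clim_inv_infty; [apply eventually_filter|exact NP|].
  apply (filterlim_ext (fun n => Cmod (P n))); [|exact Hinf].
  intros n. symmetry. apply Cmod_conj. }
assert (K : filterlim (fun n => Cmod (W * / Cconj (P n) + 1)%C ^ 2) eventually
              (locally (Cmod (W * 0 + 1)%C ^ 2))).
{ apply (Rlim_continuous _ _ (fun s => s ^ 2));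
    [|apply derivable_continuous_pt, derivable_pt_pow].
  apply Clim_Cmod; [apply eventually_filter|].
  apply Clim_plus; [apply eventually_filter| |apply Clim_const, eventually_filter].
  apply Clim_mult; [apply eventually_filter|apply Clim_const, eventually_filter|exact I]. }
replace (W * 0 + 1)%C with (RtoC 1) in K by ring. rewrite Cmod_1 in K.
apply filterlim_C_components in Hdir; [|apply eventually_filter]. destruct Hdir as [Hd _].
assert (L : filterlim (fun n => Cmod (W * / Cconj (P n) + 1)%C ^ 2
    * / (4 * Re W * Re (direction (P n)))) eventually
    (locally (1 ^ 2 * / (4 * Re W * Re e)))).
{ apply Rlim_mult; [apply eventually_filter|exact K|].
  apply (Rlim_inv _ (fun n => 4 * Re W * Re (direction (P n)))).
  - apply Rlim_mult; [apply eventually_filter|apply Rlim_const, eventually_filter|exact Hd].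
  - assert (0 < 4 * Re W * Re e) by (repeat apply Rmult_lt_0_compat; lra). lra. }
replace (1 ^ 2 * / (4 * Re W * Re e)) with (/ (4 * Re W * Re e)) in L by ring.
eapply filterlim_ext; [|exact L]. intros n. cbv beta.
destruct (direction_spec (P n) (HP n)) as (D1 & D2 & D3 & _ & D5).
unfold half_plane_cosh2. rewrite D3 at 1.
replace (W + Cconj (P n))%C with ((W * / Cconj (P n) + 1) * Cconj (P n))%C
  by (field; apply NP).
rewrite Cmod_mult, Cmod_conj. field. repeat split; lra.
Qed.

(** Consecutive values have the ratio of the moduli in the limit, that is
    [alpha < 1]. *)
Lemma half_plane_cosh2_increasing (W e : C) (P : nat -> C) (alpha : R) :
  0 < Re W -> 0 < Re e -> (forall n, 0 < Re (P n)) ->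
  filterlim (fun n => Cmod (P n)) eventually (Rbar_locally p_infty) ->
  filterlim (fun n => direction (P n)) eventually (@locally C_UniformSpace e) ->
  filterlim (fun n => Cmod (P n) / Cmod (P (S n))) eventually (locally alpha) ->
  alpha < 1 ->
  eventually (fun n => half_plane_cosh2 W (P n) < half_plane_cosh2 W (P (S n))).
Proof.
intros HW He HP Hinf Hdir Hr Ha.
pose proof (half_plane_cosh2_over_modulus W e P HW He HP Hinf Hdir) as H.
pose proof (lim_shift (fun n => half_plane_cosh2 W (P n) / Cmod (P n)) _ H) as H'.
assert (Hp : 0 < 4 * Re W * Re e) by (repeat apply Rmult_lt_0_compat; lra).
assert (Hq : / (4 * Re W * Re e) <> 0) by (apply Rinv_neq_0_compat; lra).
assert (L : filterlim (fun n => half_plane_cosh2 W (P n) / Cmod (P n)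
   * / (half_plane_cosh2 W (P (S n)) / Cmod (P (S n))) * (Cmod (P n) / Cmod (P (S n)))) eventually
   (locally (/ (4 * Re W * Re e) * / / (4 * Re W * Re e) * alpha))).
{ apply Rlim_mult; [apply eventually_filter| |exact Hr].
  apply Rlim_mult; [apply eventually_filter|exact H|].
  now apply (Rlim_inv _ (fun n => half_plane_cosh2 W (P (S n)) / Cmod (P (S n)))). }
rewrite Rinv_r, Rmult_1_l in L by exact Hq.
specialize (L (fun y => y < 1) (open_lt 1 alpha Ha)). unfold filtermap in L.
revert L. apply filter_imp. intros n Hn.
assert (Pos : forall k, 0 < half_plane_cosh2 W (P k)).
{ intros k. unfold half_plane_cosh2. specialize (HP k).
  apply Rdiv_lt_0_compat; [|repeat apply Rmult_lt_0_compat; lra].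
  apply pow_lt. now apply Cmod_plus_conj_pos. }
destruct (direction_spec (P n) (HP n)) as (_ & _ & _ & _ & M1).
destruct (direction_spec (P (S n)) (HP (S n))) as (_ & _ & _ & _ & M2).
pose proof (Pos n) as Q1. pose proof (Pos (S n)) as Q2.
replace (half_plane_cosh2 W (P n) / Cmod (P n)
   * / (half_plane_cosh2 W (P (S n)) / Cmod (P (S n))) * (Cmod (P n) / Cmod (P (S n))))
  with (half_plane_cosh2 W (P n) / half_plane_cosh2 W (P (S n))) in Hn by (field; lra).
apply Rmult_lt_compat_r with (r := half_plane_cosh2 W (P (S n))) in Hn; [|exact Q2].
unfold Rdiv in Hn. rewrite Rmult_assoc, Rinv_l in Hn by lra. lra.
Qed.

(** * The curve in the half-plane *)

Section Curve.
Variables (gamma : R -> C) (tau : C) (theta : R).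
Hypotheses (Ht : Cmod tau = 1) (Hg : disc_curve gamma) (Hl : lands_at gamma tau)
  (Harg : is_lim (fun t => Arg (1 - Cconj tau * gamma t)%C) p_infty theta).

(** The absolute value extends the curve to the whole line, so that theorems
    about globally continuous functions apply. *)
Lemma continuity_cayley_curve :
  continuity (fun t => Cmod (cayley tau (gamma (Rabs t)))).
Proof.
intros t. apply continuity_pt_filterlim.
apply (Clim_Cmod (locally t) (fun t => cayley tau (gamma (Rabs t)))).
assert (Hc : filterlim (fun s => gamma (Rabs s)) (locally t)
  (@locally C_UniformSpace (gamma (Rabs t)))).
{ apply (filterlim_comp _ _ _ Rabs gamma (locally t)
    (within (fun s => 0 <= s) (locally (Rabs t)))); [|apply (proj2 Hg), Rabs_pos].
  intros S HS. unfold within in HS. specialize (continuous_Rabs t _ HS).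
  unfold filtermap. apply filter_imp. intros s Hs. apply Hs, Rabs_pos. }
unfold cayley. apply Clim_div; [apply locally_filter| | |].
- apply Clim_plus; [apply locally_filter|apply Clim_const, locally_filter|].
  apply Clim_mult; [apply locally_filter|apply Clim_const, locally_filter|exact Hc].
- apply Clim_minus; [apply locally_filter|apply Clim_const, locally_filter|].
  apply Clim_mult; [apply locally_filter|apply Clim_const, locally_filter|exact Hc].
- apply cayley_denominator; [exact Ht|]. apply (proj1 Hg), Rabs_pos.
Qed.

Lemma denominator_to_0 :
  filterlim (fun t => 1 - Cconj tau * gamma t)%C (Rbar_locally p_infty)
    (@locally C_UniformSpace (RtoC 0)).
Proof.
replace (RtoC 0) with (1 - Cconj tau * tau)%C.
- apply Clim_minus; [apply Rbar_locally_filter|apply Clim_const, Rbar_locally_filter|].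
  apply Clim_mult; [apply Rbar_locally_filter|apply Clim_const, Rbar_locally_filter|exact Hl].
- rewrite Cmult_comm, unimodular_conj by exact Ht. ring.
Qed.

Lemma gamma_eventually_disc :
  Rbar_locally p_infty (fun t => 0 <= t /\ unit_disc (gamma t)).
Proof. exists 0. intros t H. split; [lra|]. apply (proj1 Hg). lra. Qed.

Lemma cayley_curve_infty :
  filterlim (fun t => Cmod (cayley tau (gamma t))) (Rbar_locally p_infty)
    (Rbar_locally p_infty).
Proof.
intros S [M HM].
assert (Hd : 0 < 1 / (Rmax 0 M + 2)).
{ apply Rdiv_lt_0_compat; [lra|]. pose proof (Rmax_l 0 M). lra. }
pose proof (proj1 (filterlim_Cmod _ _ _) denominator_to_0 _ Hd) as H.
unfold filtermap. generalize (filter_and _ _ H gamma_eventually_disc).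
apply filter_imp. intros t [H1 [H2 H3]]. apply HM.
pose proof (cayley_denominator tau (gamma t) Ht H3) as Hn.
set (U := (1 - Cconj tau * gamma t)%C) in *.
replace (U - 0)%C with U in H1 by ring.
assert (HU : 0 < Cmod U) by now apply Cmod_gt_0.
assert (E : cayley tau (gamma t) = ((2 - U) / U)%C).
{ unfold cayley. fold U. f_equal. unfold U. ring. }
rewrite E, Cmod_div by exact Hn.
pose proof (Rmax_l 0 M) as M0. pose proof (Rmax_r 0 M) as M1. set (m := Rmax 0 M) in *.
pose proof (Cmod_triangle (2 - U) U)%C as B.
replace (2 - U + U)%C with (RtoC 2) in B by ring.
rewrite Cmod_R, Rabs_pos_eq in B by lra.
assert (H4 : Cmod U * (m + 2) < 1).
{ apply Rmult_lt_compat_r with (r := m + 2) in H1; [|lra].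
  unfold Rdiv in H1. rewrite Rmult_assoc, Rinv_l in H1 by lra. lra. }
apply Rmult_lt_reg_r with (1 := HU). unfold Rdiv. rewrite Rmult_assoc, Rinv_l by lra.
nra.
Qed.

Lemma direction_denominator :
  filterlim (fun t => direction (1 - Cconj tau * gamma t)%C) (Rbar_locally p_infty)
    (@locally C_UniformSpace (cos theta, sin theta)).
Proof.
assert (K : filterlim (fun t => (cos (Arg (1 - Cconj tau * gamma t)%C),
     sin (Arg (1 - Cconj tau * gamma t)%C)) : C) (Rbar_locally p_infty)
    (@locally C_UniformSpace (cos theta, sin theta))).
{ apply filterlim_C_components; [apply Rbar_locally_filter|]. split; simpl.
  - apply (Rlim_continuous _ (fun t => Arg (1 - Cconj tau * gamma t)%C) cos);
      [exact Harg|apply continuity_cos].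
  - apply (Rlim_continuous _ (fun t => Arg (1 - Cconj tau * gamma t)%C) sin);
      [exact Harg|apply continuity_sin]. }
eapply filterlim_ext_loc; [|exact K].
generalize gamma_eventually_disc. apply filter_imp. intros t [_ H3].
pose proof (cayley_denominator tau (gamma t) Ht H3) as Hn.
set (U := (1 - Cconj tau * gamma t)%C) in *. clearbody U.
destruct (Arg_spec U Hn) as (_ & E1 & E2).
assert (HU : 0 < Cmod U) by now apply Cmod_gt_0.
assert (Hm : RtoC (Cmod U) <> 0%C) by (intros E; injection E; lra).
unfold direction.
replace U with (RtoC (Cmod U) * (cos (Arg U), sin (Arg U)))%C at 3.
- change (@eq C (cos (Arg U), sin (Arg U))
    (RtoC (Cmod U) * (cos (Arg U), sin (Arg U)) / RtoC (Cmod U))%C).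
  set (c := (cos (Arg U), sin (Arg U)) : C). field. exact Hm.
- set (m := Cmod U) in *.
  apply injective_projections;
    [change (m * cos (Arg U) - 0 * sin (Arg U) = Re U)
    |change (m * sin (Arg U) + 0 * cos (Arg U) = Im U)]; lra.
Qed.

(** With [U = 1 - conj tau * gamma t] tending to zero, the image of the curve is
    [(2 - U) / U], whose direction is asymptotically the inverse of that of
    [U]. *)
Lemma direction_cayley_curve :
  filterlim (fun t => direction (cayley tau (gamma t))) (Rbar_locally p_infty)
    (@locally C_UniformSpace (cos theta, - sin theta)).
Proof.
set (e := (cos theta, sin theta) : C).
assert (He : Cmod e = 1).
{ apply Rsqr_inj; [apply Cmod_ge_0|lra|]. rewrite !Rsqr_pow2, Cmod2_alt.
  unfold e; simpl. pose proof (sin2_cos2 theta) as T. unfold Rsqr in T. nra. }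
assert (He0 : e <> 0%C) by (apply Cmod_gt_0; lra).
assert (Hi : (/ e)%C = (cos theta, - sin theta)).
{ assert (X : (e * (cos theta, (- sin theta)%R))%C = 1%C).
  { pose proof (sin2_cos2 theta) as T. unfold Rsqr in T.
    apply injective_projections; unfold e; simpl; lra. }
  replace (/ e)%C with (/ e * (e * (cos theta, (- sin theta)%R)))%C by (rewrite X; ring).
  set (c := (cos theta, (- sin theta)%R) : C). field. exact He0. }
assert (L2 : filterlim (fun t => 2 - (1 - Cconj tau * gamma t))%C (Rbar_locally p_infty)
    (@locally C_UniformSpace (2 - 0)%C)).
{ apply Clim_minus; [apply Rbar_locally_filter|apply Clim_const, Rbar_locally_filter|].
  exact denominator_to_0. }
assert (M2 : filterlim (fun t => RtoC (Cmod (2 - (1 - Cconj tau * gamma t))%C))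
    (Rbar_locally p_infty) (@locally C_UniformSpace (RtoC (Cmod (2 - 0)%C)))).
{ apply filterlim_C_components; [apply Rbar_locally_filter|]. split; simpl.
  - exact (Clim_Cmod _ _ _ L2).
  - apply filterlim_const. }
replace (2 - 0)%C with (RtoC 2) in L2, M2 by ring.
rewrite Cmod_R, Rabs_pos_eq in M2 by lra.
assert (N2 : RtoC 2 <> 0%C) by (intros E; injection E; lra).
assert (K : filterlim (fun t => (2 - (1 - Cconj tau * gamma t))
     / RtoC (Cmod (2 - (1 - Cconj tau * gamma t))%C)
     * / direction (1 - Cconj tau * gamma t))%C (Rbar_locally p_infty)
    (@locally C_UniformSpace (RtoC 2 / RtoC 2 * / e)%C)).
{ apply Clim_mult; [apply Rbar_locally_filter| |].
  - apply Clim_div; [apply Rbar_locally_filter|exact L2|exact M2|exact N2].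
  - apply (Clim_inv _ (fun t => direction (1 - Cconj tau * gamma t)%C));
      [exact direction_denominator|exact He0]. }
replace (RtoC 2 / RtoC 2 * / e)%C with (/ e)%C in K by (field; exact He0).
rewrite Hi in K.
eapply filterlim_ext_loc; [|exact K].
generalize gamma_eventually_disc. apply filter_imp. intros t [_ H3].
pose proof (cayley_denominator tau (gamma t) Ht H3) as Hn.
pose proof (Re_cayley_pos tau (gamma t) Ht H3) as HR.
set (U := (1 - Cconj tau * gamma t)%C) in *.
assert (HU : 0 < Cmod U) by now apply Cmod_gt_0.
assert (Hm : RtoC (Cmod U) <> 0%C) by (intros E; injection E; lra).
assert (E : cayley tau (gamma t) = ((2 - U) / U)%C).
{ unfold cayley. fold U. f_equal. unfold U. ring. }
assert (NV : (2 - U)%C <> 0%C).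
{ intros E'. rewrite E, E' in HR. unfold Cdiv in HR. rewrite Cmult_0_l in HR.
  simpl in HR. lra. }
assert (HV : RtoC (Cmod (2 - U)%C) <> 0%C).
{ intros E'. apply Cmod_gt_0 in NV. injection E'. lra. }
unfold direction. rewrite E, Cmod_div by exact Hn.
rewrite RtoC_div by lra. field. repeat split; assumption.
Qed.

End Curve.

(** * Uniqueness of the Denjoy-Wolff point *)

Lemma compact_singleton (z : C) : compact_set (fun w => w = z).
Proof.
intros F _ Hc. destruct (Hc z eq_refl) as (U & HU & Uz).
exists (cons U nil). split; [now repeat constructor|].
intros w ->. now constructor.
Qed.

(** The iterates of the single point [0] converge to both. *)
Lemma Denjoy_Wolff_unique (f : C -> C) (s t : C) :
  Denjoy_Wolff_point f s -> Denjoy_Wolff_point f t -> s = t.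
Proof.
intros [_ Hs] [_ Ht].
destruct (Ceq_dec s t) as [|Hn]; [assumption|exfalso].
assert (Hst : (s - t)%C <> 0%C).
{ intros E. apply Hn. replace s with ((s - t) + t)%C by ring. rewrite E. ring. }
apply Cmod_gt_0 in Hst.
assert (H0 : forall w : C, w = 0%C -> unit_disc w).
{ intros w ->. unfold unit_disc. rewrite Cmod_0. lra. }
destruct (Hs _ (compact_singleton 0%C) H0 (Cmod (s - t)%C / 2)) as [N1 H1]; [lra|].
destruct (Ht _ (compact_singleton 0%C) H0 (Cmod (s - t)%C / 2)) as [N2 H2]; [lra|].
specialize (H1 (N1 + N2)%nat ltac:(lia) 0%C eq_refl).
specialize (H2 (N1 + N2)%nat ltac:(lia) 0%C eq_refl).
set (w := Nat.iter (N1 + N2) f 0%C) in *.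
pose proof (Cmod_triangle (- (w - s)) (w - t))%C as B.
replace (- (w - s) + (w - t))%C with (s - t)%C in B by ring.
rewrite Cmod_opp in B. lra.
Qed.

(** * Monotonicity of the distance to the projections *)

Theorem theorem1p1 :
  forall (f : C -> C) (tau : C) (gamma : R -> C) (theta : R)
    (z : C) (p : nat -> C),
  hyperbolic_map f ->
  Denjoy_Wolff_point f tau ->
  disc_curve gamma ->
  lands_at gamma tau ->
  - (PI / 2) < theta < PI / 2 ->
  is_lim (fun t => Arg (1 - Cconj tau * gamma t)%C) p_infty theta ->
  unit_disc z ->
  (forall n : nat, is_projection gamma (Nat.iter n f z) (p n)) ->
  forall w : C, unit_disc w ->
  eventually_strictly_increasing (fun n => hyp_dist w (p n)).
Proof.
intros f tau gamma theta z p (Hf & _ & tau' & alpha & Hdw' & Hang & Hal) Hdw Hg Hl Hth Harg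
  Hz Hp w Hw.
rewrite (Denjoy_Wolff_unique f tau' tau Hdw' Hdw) in Hang.
pose proof (proj1 Hdw) as Ht.
set (Gamma := fun t => cayley tau (gamma t)).
set (Z := orbit f tau z). set (P := fun n => cayley tau (p n)).
assert (Hpd : forall n, unit_disc (p n)).
{ intros n. destruct (Hp n) as (t & Ht0 & -> & _). now apply (proj1 Hg). }
assert (He : 0 < Re (cos theta, - sin theta)) by (simpl; apply cos_gt_0; lra).
assert (Gpos : forall t, 0 <= t -> 0 < Re (Gamma t)).
{ intros t H0. apply Re_cayley_pos; [exact Ht|]. now apply (proj1 Hg). }
assert (HP : forall n, exists s, 0 <= s /\ P n = Gamma s).
{ intros n. destruct (Hp n) as (t & Ht0 & E & _). exists t. split; [exact Ht0|].
  unfold P. now rewrite E. }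
assert (Hmin : forall n t, 0 <= t -> half_plane_cosh2 (Z n) (P n) <= half_plane_cosh2 (Z n) (Gamma t)).
{ intros n t H0. destruct (Hp n) as (s & Hs & E & [Hlb _]).
  apply Rnot_lt_le. intros Hlt.
  pose proof (Hlb (hyp_dist (Nat.iter n f z) (gamma t)) (ex_intro _ t (conj H0 eq_refl))) as B.
  simpl in B. rewrite <- E in B. apply (Rle_not_lt _ _ B).
  apply (hyp_dist_lt_of_cosh2 tau); [exact Ht| | | | |exact Hlt].
  - now apply unit_disc_orbit.
  - now apply (proj1 Hg).
  - now apply unit_disc_orbit.
  - apply Hpd. }
pose proof (continuity_cayley_curve gamma tau Ht Hg) as Gcont.
pose proof (cayley_curve_infty gamma tau Ht Hg Hl) as Ginf.
pose proof (direction_cayley_curve gamma tau theta Ht Hg Hl Harg) as Gdir.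
assert (HZ : forall n, 0 < Re (Z n)) by (intros n; now apply Re_orbit_pos).
pose proof (Cmod_orbit_infty f tau alpha z Hf Ht Hang Hal Hz) as Zinf.
pose proof (orbit_ratio f tau alpha z Hf Ht Hang Hal Hz) as Zratio.
fold Z in Zinf, Zratio.
pose proof (Cmod_projection_infty Gamma _ Gpos Gcont Ginf Gdir He Z P HZ Zinf HP Hmin) as Pinf.
pose proof (direction_projection Gamma _ Gpos Gcont Ginf Gdir He Z P HZ Zinf HP Hmin) as Pdir.
pose proof (projection_ratio Gamma _ Gpos Gcont Ginf Gdir He Z P HZ Zinf HP Hmin) as Pratio.
assert (Ppos : forall n, 0 < Re (P n)) by (intros n; now apply Re_cayley_pos).
assert (PP : filterlim (fun n => Cmod (P n) / Cmod (P (S n))) eventually (locally alpha)).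
{ pose proof (lim_shift (fun n => Cmod (P n) / Cmod (Z n)) _ Pratio) as Pratio'.
  assert (L : filterlim (fun n => Cmod (P n) / Cmod (Z n)
     * / (Cmod (P (S n)) / Cmod (Z (S n))) * (Cmod (Z n) / Cmod (Z (S n)))) eventually
     (locally (1 * / 1 * alpha))).
  { apply Rlim_mult; [apply eventually_filter| |exact Zratio].
    apply Rlim_mult; [apply eventually_filter|exact Pratio|].
    apply (Rlim_inv _ (fun n => Cmod (P (S n)) / Cmod (Z (S n)))); [exact Pratio'|lra]. }
  replace (1 * / 1 * alpha) with alpha in L by field.
  eapply filterlim_ext; [|exact L]. intros n. simpl.
  destruct (direction_spec _ (Ppos (S n))) as (_ & _ & _ & _ & M1).
  destruct (direction_spec _ (HZ n)) as (_ & _ & _ & _ & M2).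
  destruct (direction_spec _ (HZ (S n))) as (_ & _ & _ & _ & M3).
  field. repeat split; lra. }
apply eventually_increasing_of_step.
pose proof (half_plane_cosh2_increasing (cayley tau w) _ P alpha (Re_cayley_pos tau w Ht Hw) He
  Ppos Pinf Pdir PP Hal) as H.
revert H. apply filter_imp. intros n Hn.
now apply (hyp_dist_lt_of_cosh2 tau).
Qed.
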